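(* Let $b_2$ and $b_3$ be complex constants such that $b_2\ne 0$, and let $s$ and $l$ be relatively prime integers such that $1\le s<l\le 4$. Suppose that the differential equation $$f''-\left(e^{lz}+b_2e^{sz}+b_3\right)f=0$$ admits a nontrivial solution $f$ such that $\lambda(f)<\infty$. Then: (1) If $s=1$ and $l=2$, then $f=\kappa e^{h}$ with $\kappa=\sum_{i=-1}^{k}a_ie^{iz}$ and $h=c_0e^{z}+cz$, where $k\ge 0$ is an integer, $c_0$ and $c$ are constants such that $c_0^2=1$, $2c_0(c+k)+c_0=b_2$ and $c^2=b_3$, and $a_{-1},a_0,\dots,a_k$ are constants such that $a_0a_k\ne 0$, $a_{-1}=0$ and $$2c_0(k+1-i)a_{i-1}=(2ic+i^2)a_i,\qquad i=0,1,\dots,k.$$ (2) If $s=1$ and $l=4$, then $f=\kappa e^{h}$ with $\kappa=\sum_{i=-2}^{k+1}a_ie^{iz}$ and $h=\frac{c_0}{2}e^{2z}+cz$, where $k\ge 1$ is an integer, $c_0$ and $c$ are constants such that $c_0^2=1$, $2c+2k+2=0$ and $c^2=b_3$, and $a_{-2},a_{-1},a_0,\dots,a_{k+1}$ are constants such that $a_0a_k\ne 0$, $a_{-2}=a_{-1}=a_{k+1}=0$ and $$2c_0(k-i+2)a_{i-2}=-b_2a_{i-1}+(2ic+i^2)a_i,\qquad i=0,1,\dots,k+1.$$ (3) If $s=3$ and $l=4$, then $f=\kappa e^{h}$ with $\kappa=\sum_{i=-2}^{k+1}a_ie^{iz}$ and $h=\frac{c_0}{2}e^{2z}+c_1e^{z}+cz$,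 where $k\ge 0$ is an integer, $c_0$, $c_1$ and $c$ are constants such that $c_0^2=1$, $2c_0c_1=b_2$, $c^2=b_3$ and $c_1^2+(2+2c+2k)c_0=0$, and $a_{-2},a_{-1},a_0,\dots,a_{k+1}$ are constants such that $a_0a_k\ne 0$, $a_{-2}=a_{-1}=a_{k+1}=0$ and $$(2k-2i+4)c_0a_{i-2}=(2c+2i-1)c_1a_{i-1}+(2ic+i^2)a_i,\qquad i=0,1,\dots,k+1.$$
   Context: All solutions of the equation are entire functions. For an entire function $f\not\equiv0$, $\lambda(f)=\limsup_{r\to\infty}\frac{\log n(r,f)}{\log r}$ is the exponent of convergence of the zeros of $f$, where $n(r,f)$ is the number of zeros of $f$ in $\{z:|z|<r\}$ (with $\lambda(f)=0$ if $f$ has no zeros). *)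

(* Defs.v *)
(* Stdlib reals, with Coquelicot for complex numbers and complex derivatives. *)
From Stdlib Require Import Reals ZArith List.
From Coquelicot Require Import Coquelicot.

Open Scope R_scope.

Definition ZtoC (n : Z) : C := RtoC (IZR n).
Coercion ZtoC : Z >-> C.

Definition Cexp (z : C) : C :=
  (exp (Re z) * cos (Im z), exp (Re z) * sin (Im z)).

(* [is_derive] is taken over the field [C_AbsRing], i.e. it is complex
   differentiability.  Being required at every point of [C], it makes [f]
   entire. *)
Definition is_solution (A f : C -> C) : Prop :=
  exists f' f'' : C -> C,
    (forall z : C, is_derive (K := C_AbsRing) (V := C_NormedModule) f z (f' z)) /\
    (forall z : C, is_derive (K := C_AbsRing) (V := C_NormedModule) f' z (f'' z)) /\
    (forall z : C, (f'' z - A z * f z)%C = 0).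

Definition C_derive_n (n : nat) (f : C -> C) : C -> C := Nat.iter n C_derive f.

(* Every entry of [L] is a zero of [f] in [|z| < r], repeated in [L] at most
   as often as its multiplicity. *)
Definition lists_zeros (f : C -> C) (r : R) (L : list C) : Prop :=
  forall a : C, In a L ->
    Cmod a < r /\
    forall j : nat, (j < count_occ Ceq_dec L a)%nat -> C_derive_n j f a = 0.

(* n(r,f), counting multiplicities; finite when [f] is entire and not
   identically 0. *)
Definition zero_count (f : C -> C) (r : R) : Rbar :=
  Lub_Rbar (fun x : R => exists L : list C, lists_zeros f r L /\ x = INR (length L)).

(* log n(r,f) / log r.  As [ln 0 = 0] in Stdlib, it is 0 if n(r,f) = 0, which
   gives the convention that the exponent of convergence is 0 for a zero-free
   function. *)
Definition log_zero_count_ratio (f : C -> C) (r : R) : Rbar :=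
  match zero_count f r with
  | Finite n => Finite (ln n / ln r)
  | _ => p_infty
  end.

Definition LimSup_at_p_infty (g : R -> Rbar) : Rbar :=
  Rbar_glb (fun M : Rbar =>
    exists r0 : R, M = Rbar_lub (fun y : Rbar => exists r : R, r0 < r /\ y = g r)).

Definition exponent_of_convergence (f : C -> C) : Rbar :=
  LimSup_at_p_infty (log_zero_count_ratio f).

(* The sum of [u i] over the integers [m <= i <= n]. *)
Definition sumZ (m n : Z) (u : Z -> C) : C :=
  fold_right Cplus 0
    (map (fun j : nat => u (m + Z.of_nat j)%Z) (seq 0 (Z.to_nat (n - m + 1)))).

Definition exp_sum (m n : Z) (a : Z -> C) (z : C) : C :=
  sumZ m n (fun i : Z => (a i * Cexp (i * z))%C).

(* Main.v *)
Require Import Defs.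
From Stdlib Require Import Reals ZArith List Lra Lia Psatz ClassicalEpsilon.
From Coquelicot Require Import Coquelicot.
Open Scope R_scope.

(* Write [l = 2m] and look for approximate solutions [exp (phase_+)], [exp (phase_-)] with
   [phase_s' = s (e^(mz) + c1 e^z) + g_s], where [c1] and [g_s] are chosen so that the
   Riccati defect [phase'^2 + phase'' - A] is smaller than [phase'] by a factor
   [O(e^(-x))].  In the half-plane [x = Re z >= X] variation of constants writes every
   solution as [co_+ e^(phase_+) + co_- e^(phase_-)] with slowly varying coefficients.
   The rays [Im z = k pi / m] are, alternately, those on which one of the exponentials
   dominates the other most; on each ray the coefficient of the dominant exponential has
   a limit.  If these limits are nonzero on two adjacent rays, the two exponentials balance
   on a curve between them, and a minimum modulus argument gives more zeros in [|z| < r]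
   than any power of [r], contradicting [lambda(f) < oo].  Hence, with one fixed sign,
   [f / e^(phase)] tends to a nonzero constant over a whole period, which forces
   [f (z + 2 pi i) = e^(2 pi i g) f z].  So [G = f / e^(phase)] is [2 pi i]-periodic,
   bounded on the right and of exponential growth on the left (Gronwall): only finitely
   many of its Fourier coefficients are nonzero, and they satisfy the recurrence given by the
   differential equation.  The finite Fourier sum times [e^(phase)] is a solution with the
   same leading coefficients as [f], so it is [f]. *)

(** In the three cases m is 1 or 2, so a period contains 2m rays. The error is O(e^(-x)) because the
    two slopes differ by about e^(mx), while the Riccati defect is at most of size e^((m-1)x). This
    is integrable along rays, which gives limits, and it is small on vertical segments of bounded
    length. The obstacle is that each coefficient can be controlled only from the side where its
    exponential is the larger one. Hence the basic estimate is a weighted two-point boundary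
    estimate rather than an initial value estimate. A vanishing limit on one ray is used twice: the
    other exponential then governs the whole strip around that ray, and, since its coefficient has a
    nonzero limit L on the next ray, the limit on the ray after that must vanish too. In this way
    the same sign is carried around the period. The analysis rests on mean value inequalities and
    Gronwall bounds along segments; constancy of vertical integrals of periodic functions takes the
    place of Cauchy's theorem. The exponent c of the statement is g_s - k, where -k is the lowest
    Fourier index, and c^2 = b3 is the recurrence at that index. *)

Definition CD (f : C -> C) (z l : C) : Prop :=
  is_derive (K := C_AbsRing) (V := C_NormedModule) f z l.

(** * Rules for complex derivatives *)

Lemma CD_iff (f : C -> C) (z l : C) :
  CD f z l <->
  forall eps : R, 0 < eps -> exists d : R, 0 < d /\ forall h : C, Cmod h < d ->
    Cmod (f (z + h) - f z - h * l)%C <= eps * Cmod h.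
Proof.
split.
- intros [_ H] eps He.
  specialize (H z (fun P HP => HP) (mkposreal eps He)).
  destruct H as [d Hd]; exists d; split; [apply cond_pos|]; intros h Hh.
  specialize (Hd (z + h)%C).
  assert (E : minus (z + h)%C z = h) by (unfold minus, plus, opp; simpl; ring).
  assert (B : ball (M := AbsRing_UniformSpace C_AbsRing) z d (z + h)%C).
  { change (Cmod (minus (z + h)%C z) < d). rewrite E; exact Hh. }
  specialize (Hd B); simpl in Hd.
  change (Cmod (minus (minus (f (z + h)%C) (f z)) (scal (minus (z + h)%C z) l))
     <= eps * Cmod (minus (z + h)%C z)) in Hd.
  rewrite E in Hd. exact Hd.
- intros H; split.
  + apply is_linear_scal_l.
  + intros x Hx eps.
    assert (x = z) as ->.
    { symmetry. exact (@is_filter_lim_locally_unique C_AbsRing (AbsRing_NormedModule C_AbsRing) z x Hx). }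
    destruct (H eps (cond_pos eps)) as [d [Hd Hh]].
    exists (mkposreal d Hd). intros y Hy.
    change (Cmod (minus y z) < d) in Hy.
    specialize (Hh (minus y z) Hy).
    assert (E : (z + minus y z)%C = y) by (unfold minus, plus, opp; simpl; ring).
    rewrite E in Hh. exact Hh.
Qed.

Lemma C_eq (x y : C) : Re x = Re y -> Im x = Im y -> x = y.
Proof. destruct x, y; simpl; intros; f_equal; auto. Qed.

Lemma CD_ext_l (f : C -> C) (z l l' : C) : CD f z l -> l = l' -> CD f z l'.
Proof. intros H <-; exact H. Qed.

Lemma CD_ext (f g : C -> C) (z l : C) : (forall w, f w = g w) -> CD f z l -> CD g z l.
Proof.
intros E H; apply CD_iff; intros eps He.
destruct (proj1 (CD_iff f z l) H eps He) as [d [Hd K]].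
exists d; split; auto; intros h Hh; rewrite <- !E; auto.
Qed.

(** The two module structures on [C] have convertible norms, so the remainder estimate carries over
    as it is. The library's product and chain rules expect the second structure. *)
Lemma CD_abs (f : C -> C) (z l : C) : CD f z l <->
  is_derive (K := C_AbsRing) (V := AbsRing_NormedModule C_AbsRing) f z l.
Proof. split; intros [_ H]; (split; [apply is_linear_scal_l|exact H]). Qed.

Lemma CD_const (c z : C) : CD (fun _ => c) z 0.
Proof. exact (is_derive_const (K := C_AbsRing) (V := C_NormedModule) c z). Qed.

Lemma CD_id (z : C) : CD (fun w => w) z 1.
Proof. apply CD_abs. exact (is_derive_id (K := C_AbsRing) z). Qed.

Lemma CD_plus (f g : C -> C) (z l k : C) :
  CD f z l -> CD g z k -> CD (fun w => f w + g w)%C z (l + k)%C.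
Proof. intros H K; exact (is_derive_plus (K := C_AbsRing) (V := C_NormedModule) f g z l k H K). Qed.

Lemma CD_opp (f : C -> C) (z l : C) : CD f z l -> CD (fun w => - f w)%C z (- l)%C.
Proof. intros H; exact (is_derive_opp (K := C_AbsRing) (V := C_NormedModule) f z l H). Qed.

Lemma CD_minus (f g : C -> C) (z l k : C) :
  CD f z l -> CD g z k -> CD (fun w => f w - g w)%C z (l - k)%C.
Proof. intros H K; exact (is_derive_minus (K := C_AbsRing) (V := C_NormedModule) f g z l k H K). Qed.

Lemma CD_lip (f : C -> C) (z l : C) : CD f z l ->
  exists d : R, 0 < d /\ forall h : C, Cmod h < d ->
    Cmod (f (z + h) - f z)%C <= (Cmod l + 1) * Cmod h.
Proof.
intros H; destruct (proj1 (CD_iff f z l) H 1 Rlt_0_1) as [d [Hd K]].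
exists d; split; auto; intros h Hh; specialize (K h Hh).
replace (f (z + h) - f z)%C with ((f (z + h) - f z - h * l) + h * l)%C by ring.
eapply Rle_trans; [apply Cmod_triangle|]. rewrite Cmod_mult; lra.
Qed.

Lemma CD_mult (f g : C -> C) (z l k : C) :
  CD f z l -> CD g z k -> CD (fun w => f w * g w)%C z (l * g z + f z * k)%C.
Proof.
intros H K. apply CD_abs.
exact (is_derive_mult f g z l k (proj1 (CD_abs _ _ _) H) (proj1 (CD_abs _ _ _) K) Cmult_comm).
Qed.

Lemma CD_comp (f g : C -> C) (z l k : C) :
  CD f (g z) l -> CD g z k -> CD (fun w => f (g w)) z (k * l)%C.
Proof. intros H K. exact (is_derive_comp f g z l k H (proj1 (CD_abs _ _ _) K)). Qed.

Lemma Cmod_triangle_rev (x y : C) : Cmod x - Cmod y <= Cmod (x - y).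
Proof.
assert (H := Cmod_triangle (x - y) y).
replace (x - y + y)%C with x in H by ring. lra.
Qed.

Lemma CD_inv (z : C) : z <> 0 -> CD Cinv z (- / (z * z))%C.
Proof.
intros Hz; apply CD_iff; intros eps He.
assert (Hm : 0 < Cmod z) by (apply Cmod_gt_0; exact Hz).
set (r := Cmod z) in *.
(* The remainder is h^2 / (z^2 (z + h)). The first radius keeps |z + h| at least r / 2, the second
   makes 2 |h| / r^3 at most [eps]. *)
exists (Rmin (r / 2) (eps * (r * r * r) / 2)); split.
{ apply Rmin_glb_lt; [lra|]. apply Rdiv_lt_0_compat; [|lra].
  apply Rmult_lt_0_compat; auto. repeat apply Rmult_lt_0_compat; auto. }
intros h Hh.
assert (A1 : Cmod h < r / 2) by (eapply Rlt_le_trans; [exact Hh|apply Rmin_l]).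
assert (A2 : Cmod h < eps * (r * r * r) / 2) by (eapply Rlt_le_trans; [exact Hh|apply Rmin_r]).
assert (B : r / 2 <= Cmod (z + h)).
{ assert (T := Cmod_triangle_rev z (- h)). rewrite Cmod_opp in T.
  replace (z - - h)%C with (z + h)%C in T by ring. fold r in T. lra. }
assert (Hzh : (z + h)%C <> 0).
{ intros E; rewrite E, Cmod_0 in B. lra. }
replace (/ (z + h) - / z - h * - / (z * z))%C with (h * h * / (z * z) * / (z + h))%C
  by (field; auto).
rewrite !Cmod_mult, !Cmod_inv, Cmod_mult; auto.
2: { intros E; apply (f_equal Cmod) in E; rewrite Cmod_mult, Cmod_0 in E. fold r in E; nra. }
fold r. assert (Ht := Cmod_ge_0 h).
assert (C1 : / Cmod (z + h) <= 2 / r).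
{ replace (2 / r) with (/ (r / 2)) by (field; lra). apply Rinv_le_contravar; lra. }
apply Rle_trans with (Cmod h * Cmod h * / (r * r) * (2 / r)).
- apply Rmult_le_compat_l; auto.
  apply Rmult_le_pos; [nra|]. left; apply Rinv_0_lt_compat; nra.
- apply Rle_trans with (Cmod h * (eps * (r * r * r) / 2) * / (r * r) * (2 / r)).
  + apply Rmult_le_compat_r; [left; apply Rdiv_lt_0_compat; lra|].
    apply Rmult_le_compat_r; [left; apply Rinv_0_lt_compat; nra|].
    apply Rmult_le_compat_l; lra.
  + right; field; lra.
Qed.

(** * Derivatives along real paths *)

(** Stated by components, so that the real mean value theorem and real integrals apply directly. *)
Definition PD (F : R -> C) (t : R) (l : C) : Prop :=
  is_derive (fun u => Re (F u)) t (Re l) /\ is_derive (fun u => Im (F u)) t (Im l).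

Lemma Re_minus (x y : C) : Re (x - y)%C = Re x - Re y.
Proof. reflexivity. Qed.

Lemma Im_minus (x y : C) : Im (x - y)%C = Im x - Im y.
Proof. reflexivity. Qed.

Lemma Re_div_R (x : C) (h : R) : h <> 0 -> Re (x / h)%C = Re x / h.
Proof. intros H; destruct x; simpl; unfold Re, Im; simpl; field; auto. Qed.

Lemma Im_div_R (x : C) (h : R) : h <> 0 -> Im (x / h)%C = Im x / h.
Proof. intros H; destruct x; simpl; unfold Re, Im; simpl; field; auto. Qed.

Lemma im_le_Cmod (c : C) : Rabs (Im c) <= Cmod c.
Proof. eapply Rle_trans; [apply Rmax_r|apply Rmax_Cmod]. Qed.

Lemma CD_path (f : C -> C) (z0 w : C) (t : R) (l : C) :
  CD f (z0 + t * w)%C l -> PD (fun u : R => f (z0 + u * w)%C) t (w * l)%C.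
Proof.
intros H.
assert (K : forall eps, 0 < eps -> exists d : posreal, forall h : R, h <> 0 -> Rabs h < d ->
   Cmod ((f (z0 + (t + h)%R * w)%C - f (z0 + t * w)%C) / h - w * l)%C < eps).
{ intros eps He.
  assert (Hw := Cmod_ge_0 w).
  set (M := Cmod w + 1).
  destruct (proj1 (CD_iff f _ l) H (eps / (2 * M))) as [d [Hd K]].
  { apply Rdiv_lt_0_compat; unfold M; lra. }
  assert (Hd' : 0 < d / M) by (apply Rdiv_lt_0_compat; unfold M; lra).
  exists (mkposreal _ Hd'); simpl; intros h Hh0 Hh.
  assert (HC : RtoC h <> 0) by (intros E; apply RtoC_inj in E; auto).
  assert (Hpos := Rabs_pos_lt h Hh0).
  specialize (K (h * w)%C). rewrite Cmod_mult, Cmod_R in K.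
  assert (HM : Rabs h * Cmod w < d).
  { apply Rle_lt_trans with (Rabs h * M); [unfold M; nra|].
    apply Rlt_le_trans with (d / M * M); [|right; field; unfold M; lra].
    apply Rmult_lt_compat_r; [unfold M; lra|auto]. }
  specialize (K HM).
  replace (z0 + (t + h)%R * w)%C with (z0 + t * w + h * w)%C by (rewrite RtoC_plus; ring).
  replace ((f (z0 + t * w + h * w) - f (z0 + t * w)) / h - w * l)%C with
    ((f (z0 + t * w + h * w) - f (z0 + t * w) - h * w * l) / h)%C by (field; auto).
  rewrite Cmod_div, Cmod_R; auto.
  apply Rle_lt_trans with (eps / (2 * M) * (Rabs h * Cmod w) / Rabs h).
  - apply Rmult_le_compat_r; auto. left; apply Rinv_0_lt_compat; auto.
  - apply Rle_lt_trans with (eps / (2 * M) * M).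
    + replace (eps / (2 * M) * (Rabs h * Cmod w) / Rabs h) with (eps / (2 * M) * Cmod w) by (field; unfold M; lra).
      apply Rmult_le_compat_l; [|unfold M; lra].
      left; apply Rdiv_lt_0_compat; unfold M; lra.
    + apply Rle_lt_trans with (eps / 2); [right; field; unfold M; lra|lra]. }
split; apply is_derive_Reals; intros eps He; destruct (K eps He) as [d Hd];
  exists d; intros h Hh0 Hh; eapply Rle_lt_trans; [|apply (Hd h Hh0 Hh)| |apply (Hd h Hh0 Hh)].
- eapply Rle_trans; [|apply re_le_Cmod]. right; f_equal.
  rewrite <- Re_minus, <- Re_div_R, <- Re_minus by auto. reflexivity.
- eapply Rle_trans; [|apply im_le_Cmod]. right; f_equal.
  rewrite <- Im_minus, <- Im_div_R, <- Im_minus by auto. reflexivity.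
Qed.

Lemma PD_cont (F : R -> C) (t : R) (l : C) : PD F t l ->
  continuity_pt (fun u => Cmod (F u)) t.
Proof.
intros [H1 H2].
assert (D1 : continuity_pt (fun u => Re (F u)) t).
{ apply derivable_continuous_pt. exists (Re l). apply is_derive_Reals; auto. }
assert (D2 : continuity_pt (fun u => Im (F u)) t).
{ apply derivable_continuous_pt. exists (Im l). apply is_derive_Reals; auto. }
unfold Cmod.
apply (continuity_pt_comp (fun u => (fst (F u) ^ 2 + snd (F u) ^ 2)) sqrt).
- apply continuity_pt_plus.
  + apply continuity_pt_mult; [exact D1|]. apply continuity_pt_mult; [exact D1|].
    apply continuity_pt_const; intros ? ?; reflexivity.
  + apply continuity_pt_mult; [exact D2|]. apply continuity_pt_mult; [exact D2|].
    apply continuity_pt_const; intros ? ?; reflexivity.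
- apply continuity_pt_sqrt. nra.
Qed.

(** Project onto the direction of d = F v - F u and apply the real mean value theorem to N minus
    that projection, which is nondecreasing by Cauchy-Schwarz. The majorant N allows rates that vary
    along the path. *)
Lemma mean_value_ineq (F F' : R -> C) (N N' : R -> R) (u v : R) :
  u <= v ->
  (forall t, u <= t <= v -> PD F t (F' t)) ->
  (forall t, u <= t <= v -> is_derive N t (N' t)) ->
  (forall t, u <= t <= v -> Cmod (F' t) <= N' t) ->
  Cmod (F v - F u) <= N v - N u.
Proof.
intros Huv HF HN HB.
set (d := (F v - F u)%C).
set (phi := fun t : R => N t - (Re d * Re (F t) + Im d * Im (F t)) / Cmod d).
destruct (Req_dec (Cmod d) 0) as [E|E].
- rewrite E.
  destruct (MVT_gen N u v N') as [c [Hc1 Hc2]].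
  + intros x Hx. rewrite Rmin_left, Rmax_right in Hx by lra. apply HN; lra.
  + intros x Hx. rewrite Rmin_left, Rmax_right in Hx by lra.
    apply derivable_continuous_pt. exists (N' x). apply is_derive_Reals, HN; lra.
  + rewrite Rmin_left, Rmax_right in Hc1 by lra.
    rewrite Hc2. apply Rmult_le_pos; [|lra].
    eapply Rle_trans; [apply Cmod_ge_0|apply HB; lra].
- assert (P : 0 < Cmod d) by (assert (T := Cmod_ge_0 d); lra).
  assert (HD : forall t, u <= t <= v -> is_derive phi t
     (N' t - (Re d * Re (F' t) + Im d * Im (F' t)) / Cmod d)).
  { intros t Ht. destruct (HF t Ht) as [H1 H2]. specialize (HN t Ht).
    unfold phi. apply (is_derive_minus (K := R_AbsRing) (V := R_NormedModule)); [exact HN|].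
    apply (is_derive_ext (fun t0 => / Cmod d * (Re d * Re (F t0) + Im d * Im (F t0)))).
    { intros s; apply Rmult_comm. }
    evar_last. apply is_derive_scal. apply (is_derive_plus (K := R_AbsRing) (V := R_NormedModule)); apply is_derive_scal; eassumption.
    unfold plus; simpl; unfold Rdiv; ring. }
  destruct (MVT_gen phi u v (fun t => N' t - (Re d * Re (F' t) + Im d * Im (F' t)) / Cmod d)) as [c [Hc1 Hc2]].
  + intros x Hx. rewrite Rmin_left, Rmax_right in Hx by lra. apply HD; lra.
  + intros x Hx. rewrite Rmin_left, Rmax_right in Hx by lra.
    apply derivable_continuous_pt. eexists. apply is_derive_Reals, HD; lra.
  + rewrite Rmin_left, Rmax_right in Hc1 by lra.
    assert (HP : 0 <= phi v - phi u).
    { rewrite Hc2. apply Rmult_le_pos; [|lra].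
      specialize (HB c Hc1).
      assert (Q : Re d * Re (F' c) + Im d * Im (F' c) <= Cmod d * Cmod (F' c)).
      { replace (Re d * Re (F' c) + Im d * Im (F' c)) with (Re (Cconj d * F' c)%C) by (simpl; unfold Re, Im; ring).
        eapply Rle_trans; [apply Rle_abs|]. eapply Rle_trans; [apply re_le_Cmod|].
        rewrite Cmod_mult, Cmod_conj. lra. }
      assert ((Re d * Re (F' c) + Im d * Im (F' c)) / Cmod d <= Cmod (F' c)).
      { apply Rmult_le_reg_r with (Cmod d); auto. unfold Rdiv; rewrite Rmult_assoc, Rinv_l; lra. }
      lra. }
    unfold phi in HP.
    assert (Q : (Re d * Re (F v) + Im d * Im (F v)) / Cmod d - (Re d * Re (F u) + Im d * Im (F u)) / Cmod d = Cmod d).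
    { apply Rmult_eq_reg_r with (Cmod d); auto.
      replace (Cmod d * Cmod d) with (Cmod d ^ 2) by ring.
      rewrite Cmod2_alt. field_simplify; auto. unfold d; simpl; unfold Re, Im; simpl. ring. }
    lra.
Qed.

Lemma bounded_sup (F : R -> R) (u v B : R) :
  u <= v -> (forall t, u <= t <= v -> F t <= B) ->
  exists S, (forall t, u <= t <= v -> F t <= S) /\
    forall S', (forall t, u <= t <= v -> F t <= S') -> S <= S'.
Proof.
intros Huv HB.
destruct (completeness (fun y => exists t, u <= t <= v /\ y = F t)) as [S [HS1 HS2]].
- exists B; intros y [t [Ht ->]]; auto.
- exists (F u), u; split; [lra|auto].
- exists S; split.
  + intros t Ht; apply HS1; exists t; auto.
  + intros S' HS'; apply HS2; intros y [t [Ht ->]]; auto.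
Qed.

Lemma PD_bounded (F F' : R -> C) (u v : R) : u <= v ->
  (forall t, u <= t <= v -> PD F t (F' t)) ->
  exists B, forall t, u <= t <= v -> Cmod (F t) <= B.
Proof.
intros Huv H.
destruct (continuity_ab_maj (fun t => Cmod (F t)) u v Huv) as [x [Hx _]].
- intros c Hc; apply (PD_cont F c (F' c)); auto.
- exists (Cmod (F x)); intros t Ht; apply Hx; auto.
Qed.

(* [a] is controlled from the left end and [b] from the right end, which is
   where the factors [1/rho] and [rho] in the off-diagonal terms are bounded;
   hence the mixed boundary data. *)
Lemma dichotomy_estimate (a b a' b' : R -> C) (rho N N' : R -> R) (u v Q K : R) :
  u <= v -> 0 < K -> 1 <= Q ->
  (forall t, u <= t <= v -> 0 < rho t) ->
  (forall s t, u <= s -> s <= t -> t <= v -> rho t <= Q * rho s) ->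
  (forall t, u <= t <= v -> PD a t (a' t)) ->
  (forall t, u <= t <= v -> PD b t (b' t)) ->
  (forall t, u <= t <= v -> is_derive N t (N' t)) ->
  (forall t, u <= t <= v -> 0 <= N' t) ->
  (forall t, u <= t <= v -> Cmod (a' t) <= N' t * (Cmod (a t) + Cmod (b t) / rho t)) ->
  (forall t, u <= t <= v -> Cmod (b' t) <= N' t * (Cmod (a t) * rho t + Cmod (b t))) ->
  Q * (N v - N u) <= / 4 ->
  forall t, u <= t <= v ->
    Cmod (a t - a u) <=
      Q * (N v - N u) * (2 * (Cmod (a u) + Cmod (b v) / K)) * Rmax 1 (K / rho t) /\
    Cmod (b t - b v) <=
      Q * (N v - N u) * (2 * (Cmod (a u) + Cmod (b v) / K)) * Rmax K (rho t).
Proof.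
intros Huv HK HQ Hr Hmono Ha Hb HN HN' Ha' Hb' Hd.
(* Since w * rho = max(K, rho), the weights w for [a] and max(K, rho) for [b] turn both off-diagonal
   terms into the same multiple of the weight. Quasi-monotonicity of [rho] moves the weight from s
   to t at the cost of a factor Q. *)
set (w := fun t => Rmax 1 (K / rho t)).
set (d := Q * (N v - N u)) in *.
assert (Hw1 : forall t, 1 <= w t) by (intros; apply Rmax_l).
assert (Hwr : forall t, u <= t <= v -> Rmax K (rho t) = w t * rho t).
{ intros t Ht; specialize (Hr t Ht). unfold w.
  rewrite Rmult_comm, <- RmaxRmult by lra.
  rewrite Rmax_comm. f_equal; field; lra. }
assert (HNm : forall s t, u <= s -> s <= t -> t <= v -> N s <= N t).
{ intros s t H1 H2 H3.
  destruct (MVT_gen N s t N') as [c [Hc1 Hc2]].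
  + intros x Hx. rewrite Rmin_left, Rmax_right in Hx by lra. apply HN; lra.
  + intros x Hx. rewrite Rmin_left, Rmax_right in Hx by lra.
    apply derivable_continuous_pt. exists (N' x). apply is_derive_Reals, HN; lra.
  + rewrite Rmin_left, Rmax_right in Hc1 by lra.
    assert (0 <= N' c * (t - s)) by (apply Rmult_le_pos; [apply HN'|]; lra). lra. }
destruct (PD_bounded a a' u v Huv Ha) as [Ba HBa].
destruct (PD_bounded b b' u v Huv Hb) as [Bb HBb].
destruct (bounded_sup (fun t => Cmod (a t) / w t) u v Ba Huv) as [A [HA1 HA2]].
{ intros t Ht. apply Rle_trans with (Cmod (a t)); auto.
  apply Rmult_le_reg_r with (w t); [specialize (Hw1 t); lra|].
  unfold Rdiv; rewrite Rmult_assoc, Rinv_l by (specialize (Hw1 t); lra).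
  apply Rmult_le_compat_l; auto. apply Cmod_ge_0. }
destruct (bounded_sup (fun t => Cmod (b t) / Rmax K (rho t)) u v (Bb / K) Huv) as [B [HB1 HB2]].
{ intros t Ht. unfold Rdiv. apply Rmult_le_compat; auto.
  - apply Cmod_ge_0.
  - left; apply Rinv_0_lt_compat. eapply Rlt_le_trans; [exact HK|apply Rmax_l].
  - apply Rinv_le_contravar; [auto|apply Rmax_l]. }
assert (HA : forall t, u <= t <= v -> Cmod (a t) <= A * w t).
{ intros t Ht. specialize (HA1 t Ht). specialize (Hw1 t).
  apply Rmult_le_compat_r with (r := w t) in HA1; [|lra].
  unfold Rdiv in HA1; rewrite Rmult_assoc, Rinv_l in HA1; lra. }
assert (HB : forall t, u <= t <= v -> Cmod (b t) <= B * Rmax K (rho t)).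
{ intros t Ht. specialize (HB1 t Ht).
  assert (P : 0 < Rmax K (rho t)) by (eapply Rlt_le_trans; [exact HK|apply Rmax_l]).
  apply Rmult_le_compat_r with (r := Rmax K (rho t)) in HB1; [|lra].
  unfold Rdiv in HB1; rewrite Rmult_assoc, Rinv_l in HB1; lra. }
assert (HA0 : 0 <= A).
{ specialize (HA1 u ltac:(lra)). eapply Rle_trans; [|exact HA1].
  apply Rmult_le_pos; [apply Cmod_ge_0|]. left; apply Rinv_0_lt_compat. specialize (Hw1 u); lra. }
assert (HB0 : 0 <= B).
{ specialize (HB1 u ltac:(lra)). eapply Rle_trans; [|exact HB1].
  apply Rmult_le_pos; [apply Cmod_ge_0|]. left; apply Rinv_0_lt_compat.
  eapply Rlt_le_trans; [exact HK|apply Rmax_l]. }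
assert (Hd0 : 0 <= N v - N u) by (specialize (HNm u v); lra).
assert (Hd0' : 0 <= d) by (unfold d; apply Rmult_le_pos; lra).
assert (Ea : forall t, u <= t <= v -> Cmod (a t - a u) <= d * (A + B) * w t).
{ intros t Ht.
  apply Rle_trans with (Q * (A + B) * w t * N t - Q * (A + B) * w t * N u).
  - apply (mean_value_ineq a a' (fun s => Q * (A + B) * w t * N s) (fun s => Q * (A + B) * w t * N' s)).
    + lra.
    + intros s Hs; apply Ha; lra.
    + intros s Hs. apply is_derive_scal. apply HN; lra.
    + intros s Hs. assert (Hs' : u <= s <= v) by lra.
      eapply Rle_trans; [apply Ha'; auto|].
      rewrite (Rmult_comm _ (N' s)). apply Rmult_le_compat_l; auto.
      apply Rle_trans with ((A + B) * w s).
      * rewrite Rmult_plus_distr_r. apply Rplus_le_compat; auto.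
        specialize (HB s Hs'). rewrite Hwr in HB by auto. specialize (Hr s Hs').
        apply Rmult_le_reg_r with (rho s); auto.
        unfold Rdiv; rewrite Rmult_assoc, Rinv_l; lra.
      * rewrite (Rmult_comm Q), Rmult_assoc. apply Rmult_le_compat_l; [lra|].
        unfold w. apply Rmax_lub.
        -- apply Rle_trans with (1 * 1); [lra|]. apply Rmult_le_compat; try lra. apply Rmax_l.
        -- apply Rle_trans with (Q * (K / rho t)).
           ++ assert (P1 := Hr s Hs'). assert (P2 := Hr t Ht).
              assert (P3 := Hmono s t ltac:(lra) ltac:(lra) ltac:(lra)).
              apply Rmult_le_reg_r with (rho s * rho t); [nra|].
              replace (K / rho s * (rho s * rho t)) with (K * rho t) by (field; lra).
              replace (Q * (K / rho t) * (rho s * rho t)) with (K * (Q * rho s)) by (field; lra).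
              apply Rmult_le_compat_l; lra.
           ++ apply Rmult_le_compat_l; [lra|apply Rmax_r].
  - assert (N t - N u <= N v - N u) by (specialize (HNm t v); lra).
    unfold d. replace (Q * (A + B) * w t * N t - Q * (A + B) * w t * N u) with
      (Q * (N t - N u) * (A + B) * w t) by ring.
    apply Rmult_le_compat_r; [specialize (Hw1 t); lra|].
    apply Rmult_le_compat_r; [lra|]. apply Rmult_le_compat_l; lra. }
assert (Eb : forall t, u <= t <= v -> Cmod (b t - b v) <= d * (A + B) * Rmax K (rho t)).
{ intros t Ht. set (W := Rmax K (rho t)).
  assert (HW : K <= W) by apply Rmax_l.
  replace (b t - b v)%C with (- (b v - b t))%C by ring. rewrite Cmod_opp.
  apply Rle_trans with (Q * (A + B) * W * N v - Q * (A + B) * W * N t).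
  - apply (mean_value_ineq b b' (fun s => Q * (A + B) * W * N s) (fun s => Q * (A + B) * W * N' s)).
    + lra.
    + intros s Hs; apply Hb; lra.
    + intros s Hs. apply is_derive_scal. apply HN; lra.
    + intros s Hs. assert (Hs' : u <= s <= v) by lra.
      eapply Rle_trans; [apply Hb'; auto|].
      rewrite (Rmult_comm _ (N' s)). apply Rmult_le_compat_l; auto.
      apply Rle_trans with ((A + B) * Rmax K (rho s)).
      * rewrite Rmult_plus_distr_r. apply Rplus_le_compat; auto.
        rewrite Hwr by auto. rewrite <- Rmult_assoc. apply Rmult_le_compat_r; auto.
        left; apply Hr; auto.
      * rewrite (Rmult_comm Q), Rmult_assoc. apply Rmult_le_compat_l; [lra|].
        apply Rmax_lub.
        -- apply Rle_trans with (1 * K); [lra|]. apply Rmult_le_compat; lra.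
        -- eapply Rle_trans; [apply (Hmono t s); lra|].
           apply Rmult_le_compat_l; [lra|apply Rmax_r].
  - assert (N v - N t <= N v - N u) by (specialize (HNm u t); lra).
    unfold d. replace (Q * (A + B) * W * N v - Q * (A + B) * W * N t) with
      (Q * (N v - N t) * (A + B) * W) by ring.
    apply Rmult_le_compat_r; [lra|].
    apply Rmult_le_compat_r; [lra|]. apply Rmult_le_compat_l; lra. }
assert (FA : A <= Cmod (a u) + d * (A + B)).
{ apply HA2. intros t Ht. specialize (Hw1 t).
  apply Rmult_le_reg_r with (w t); [lra|].
  unfold Rdiv; rewrite Rmult_assoc, Rinv_l by lra. rewrite Rmult_1_r.
  replace (a t) with (a u + (a t - a u))%C by ring.
  eapply Rle_trans; [apply Cmod_triangle|]. specialize (Ea t Ht).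
  assert (P := Cmod_ge_0 (a u)). nra. }
assert (FB : B <= Cmod (b v) / K + d * (A + B)).
{ apply HB2. intros t Ht.
  assert (P : K <= Rmax K (rho t)) by apply Rmax_l.
  apply Rmult_le_reg_r with (Rmax K (rho t)); [lra|].
  unfold Rdiv at 1; rewrite Rmult_assoc, Rinv_l by lra. rewrite Rmult_1_r.
  replace (b t) with (b v + (b t - b v))%C by ring.
  eapply Rle_trans; [apply Cmod_triangle|]. specialize (Eb t Ht).
  rewrite Rmult_plus_distr_r. apply Rplus_le_compat; auto.
  apply Rle_trans with (Cmod (b v) / K * K); [right; field; lra|].
  apply Rmult_le_compat_l; auto. apply Rmult_le_pos; [apply Cmod_ge_0|].
  left; apply Rinv_0_lt_compat; auto. }
(* Adding the two bounds gives A + B <= data + 2 d (A + B); with d <= 1/4 half of the left side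
   absorbs the last term. *)
assert (FS : A + B <= 2 * (Cmod (a u) + Cmod (b v) / K)).
{ assert (d * (A + B) <= / 4 * (A + B)) by (apply Rmult_le_compat_r; lra). lra. }
intros t Ht; split.
- eapply Rle_trans; [apply Ea; auto|]. apply Rmult_le_compat_r; [change (0 <= w t); specialize (Hw1 t); lra|].
  apply Rmult_le_compat_l; auto.
- eapply Rle_trans; [apply Eb; auto|].
  apply Rmult_le_compat_r; [|apply Rmult_le_compat_l; auto].
  eapply Rle_trans; [|apply Rmax_l]; lra.
Qed.

(** * The complex exponential *)

Lemma Cexp_plus (z w : C) : Cexp (z + w) = (Cexp z * Cexp w)%C.
Proof.
unfold Cexp. destruct z as [a b], w as [c d]; simpl.
rewrite exp_plus, cos_plus, sin_plus. unfold Cmult; simpl. f_equal; ring.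
Qed.

Lemma Cexp_0 : Cexp 0 = 1.
Proof. unfold Cexp; simpl. rewrite exp_0, cos_0, sin_0. unfold RtoC; f_equal; ring. Qed.

Lemma Cmod_Cexp (z : C) : Cmod (Cexp z) = exp (Re z).
Proof.
unfold Cexp, Cmod; simpl.
replace (_ + _) with (exp (Re z) * exp (Re z) * (Rsqr (sin (Im z)) + Rsqr (cos (Im z)))) by (unfold Rsqr; ring).
rewrite sin2_cos2, Rmult_1_r. apply sqrt_square. left; apply exp_pos.
Qed.

Lemma Cexp_neq_0 (z : C) : Cexp z <> 0.
Proof. apply Cmod_gt_0. rewrite Cmod_Cexp. apply exp_pos. Qed.

Lemma Cexp_opp (z : C) : Cexp (- z) = (/ Cexp z)%C.
Proof.
assert (H := Cexp_plus z (- z)). replace (z + - z)%C with (RtoC 0) in H by ring.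
rewrite Cexp_0 in H. assert (N := Cexp_neq_0 z).
replace (Cexp (- z)) with (/ Cexp z * (Cexp z * Cexp (- z)))%C by (field; auto).
rewrite <- H. field; auto.
Qed.

Lemma Cexp_minus (z w : C) : Cexp (z - w) = (Cexp z / Cexp w)%C.
Proof. unfold Cminus. rewrite Cexp_plus, Cexp_opp. reflexivity. Qed.

Lemma PD_Cexp_line (h : C) (t : R) : PD (fun u : R => Cexp (u * h)) t (h * Cexp (t * h))%C.
Proof.
destruct h as [a b].
assert (E : forall u : R, Cexp (u * (a, b)) = (exp (u * a) * cos (u * b), exp (u * a) * sin (u * b))).
{ intros u. unfold Cexp; simpl. replace (u * a - 0 * b) with (u * a) by ring.
  replace (u * b + 0 * a) with (u * b) by ring. reflexivity. }
split.
- apply (is_derive_ext (fun u => exp (u * a) * cos (u * b))).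
  + intros u; rewrite E; reflexivity.
  + rewrite E; simpl. auto_derive; auto. unfold Re, Im; simpl; ring.
- apply (is_derive_ext (fun u => exp (u * a) * sin (u * b))).
  + intros u; rewrite E; reflexivity.
  + rewrite E; simpl. auto_derive; auto. unfold Re, Im; simpl; ring.
Qed.

Lemma PD_const (c : C) (t : R) : PD (fun _ => c) t 0.
Proof. split; simpl; apply (is_derive_const (K := R_AbsRing) (V := R_NormedModule)). Qed.

Lemma PD_minus (F G : R -> C) (t : R) (l k : C) :
  PD F t l -> PD G t k -> PD (fun u => F u - G u)%C t (l - k)%C.
Proof.
intros [H1 H2] [K1 K2]; split; simpl.
- apply (is_derive_minus (K := R_AbsRing) (V := R_NormedModule)) with (1 := H1) (2 := K1).
- apply (is_derive_minus (K := R_AbsRing) (V := R_NormedModule)) with (1 := H2) (2 := K2).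
Qed.

Lemma Cexp_sub_1 (h : C) (t : R) : 0 <= t <= 1 ->
  Cmod (Cexp (t * h) - 1)%C <= t * (Cmod h * exp (Cmod h)).
Proof.
intros Ht.
replace (RtoC 1) with (Cexp (RtoC 0 * h)) by (rewrite Cmult_0_l; apply Cexp_0).
apply Rle_trans with (t * (Cmod h * exp (Cmod h)) - 0 * (Cmod h * exp (Cmod h))); [|lra].
apply (mean_value_ineq (fun u : R => Cexp (u * h)) (fun u : R => h * Cexp (u * h))%C
  (fun u => u * (Cmod h * exp (Cmod h))) (fun u => Cmod h * exp (Cmod h))); [lra| | |].
- intros s Hs; apply PD_Cexp_line.
- intros s Hs. auto_derive; auto; ring.
- intros s Hs. rewrite Cmod_mult, Cmod_Cexp. apply Rmult_le_compat_l; [apply Cmod_ge_0|].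
  assert (E : Re (s * h)%C = s * Re h) by (destruct h; simpl; ring). rewrite E.
  assert (P := re_le_Cmod h). assert (P2 := Rle_abs (Re h)).
  assert (P3 := Cmod_ge_0 h).
  assert (s * Re h <= Cmod h) by nra.
  destruct (Rle_lt_or_eq_dec _ _ H) as [L|L]; [left; apply exp_increasing; auto|rewrite L; lra].
Qed.

Lemma Cexp_sub_1_sub_id (h : C) :
  Cmod (Cexp h - 1 - h)%C <= Cmod h * Cmod h * exp (Cmod h).
Proof.
set (F := fun u : R => (Cexp (u * h) - 1 - u * h)%C).
replace (Cexp h - 1 - h)%C with (F 1 - F 0)%C.
2: { unfold F. rewrite !Cmult_0_l, !Cmult_1_l, Cexp_0. ring. }
set (M := Cmod h * Cmod h * exp (Cmod h)).
apply Rle_trans with (1 * M - 0 * M); [|lra].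
apply (mean_value_ineq F (fun u : R => h * Cexp (u * h) - 0 - h)%C (fun u => u * M) (fun u => M)); [lra| | |].
- intros s Hs. unfold F. apply PD_minus; [apply PD_minus|].
  + apply PD_Cexp_line.
  + apply PD_const.
  + destruct h; split; simpl; auto_derive; auto; simpl; ring.
- intros s Hs. auto_derive; auto; ring.
- intros s Hs. replace (h * Cexp (s * h) - 0 - h)%C with (h * (Cexp (s * h) - 1))%C by ring.
  rewrite Cmod_mult. unfold M. rewrite Rmult_assoc. apply Rmult_le_compat_l; [apply Cmod_ge_0|].
  eapply Rle_trans; [apply Cexp_sub_1; auto|].
  assert (0 <= Cmod h * exp (Cmod h)).
  { apply Rmult_le_pos; [apply Cmod_ge_0|left; apply exp_pos]. }
  nra.
Qed.

Lemma CD_Cexp (z : C) : CD Cexp z (Cexp z).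
Proof.
apply CD_iff; intros eps He.
set (M := Cmod (Cexp z) * exp 1).
assert (HM : 0 < M).
{ apply Rmult_lt_0_compat; [rewrite Cmod_Cexp|]; apply exp_pos. }
exists (Rmin 1 (eps / M)); split.
{ apply Rmin_glb_lt; [lra|]. apply Rdiv_lt_0_compat; auto. }
intros h Hh.
assert (A1 : Cmod h < 1) by (eapply Rlt_le_trans; [exact Hh|apply Rmin_l]).
assert (A2 : Cmod h < eps / M) by (eapply Rlt_le_trans; [exact Hh|apply Rmin_r]).
rewrite Cexp_plus.
replace (Cexp z * Cexp h - Cexp z - h * Cexp z)%C with (Cexp z * (Cexp h - 1 - h))%C by ring.
rewrite Cmod_mult.
apply Rle_trans with (Cmod (Cexp z) * (Cmod h * Cmod h * exp 1)).
- apply Rmult_le_compat_l; [apply Cmod_ge_0|].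
  eapply Rle_trans; [apply Cexp_sub_1_sub_id|].
  apply Rmult_le_compat_l; [apply Rmult_le_pos; apply Cmod_ge_0|].
  left; apply exp_increasing; auto.
- replace (Cmod (Cexp z) * (Cmod h * Cmod h * exp 1)) with (M * Cmod h * Cmod h) by (unfold M; ring).
  apply Rmult_le_compat_r; [apply Cmod_ge_0|].
  apply Rle_trans with (M * (eps / M)); [apply Rmult_le_compat_l; lra|right; field; lra].
Qed.

Lemma CD_Cexp_comp (g : C -> C) (z k : C) :
  CD g z k -> CD (fun w => Cexp (g w)) z (k * Cexp (g z))%C.
Proof. intros H. apply (CD_comp Cexp g); auto. apply CD_Cexp. Qed.

(** * Approximate exponential solutions *)

Definition sgn (s : bool) : R := if s then 1 else -1.

Lemma sgn_negb (s : bool) : sgn (negb s) = - sgn s.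
Proof. destruct s; simpl; lra. Qed.

Lemma Rabs_sgn (s : bool) : Rabs (sgn s) = 1.
Proof. destruct s; simpl; [apply Rabs_R1|]. rewrite Rabs_left; lra. Qed.

(* [wA ~ Cexp (2 * wm * z)] is the coefficient of the equation [f'' = wA f].  For both signs
   [s], [p = sgn s * (Cexp (wm * z) + wc * Cexp z) + wg s] solves the Riccati equation
   [p^2 + p' = wA] up to the defect [we1 s * Cexp z + we0 s].  The disjunctions make the
   terms in [Cexp z] of lower order than [Cexp (wm * z)]. *)
Record wkb := {
  wm : R;
  wc : C;
  wg : bool -> C;
  we1 : bool -> C;
  we0 : bool -> C;
  wA : C -> C;
  wm_cases : wm = 1 \/ wm = 2;
  wc_cases : wc = 0 \/ wm = 2;
  we1_cases : forall s, we1 s = 0 \/ wm = 2;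
  w_riccati : forall s z,
    ((sgn s * (Cexp (wm * z) + wc * Cexp z) + wg s) *
     (sgn s * (Cexp (wm * z) + wc * Cexp z) + wg s)
     + sgn s * (wm * Cexp (wm * z) + wc * Cexp z)
     = wA z + (we1 s * Cexp z + we0 s))%C }.

(** * Elementary inequalities for exp, sin and cos *)

Lemma exp_le (x y : R) : x <= y -> exp x <= exp y.
Proof. intros [H | ->]; [left; apply exp_increasing; auto|lra]. Qed.

Lemma exp_ge_1 (x : R) : 0 <= x -> 1 <= exp x.
Proof. intros H; rewrite <- exp_0; apply exp_le; auto. Qed.

Lemma exp_ge_id (x : R) : x <= exp x.
Proof. assert (H := exp_ineq1_le x). lra. Qed.

Lemma Re_RtoC_mult (r : R) (z : C) : Re (r * z)%C = r * Re z.
Proof. destruct z; simpl; ring. Qed.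

Lemma Im_RtoC_mult (r : R) (z : C) : Im (r * z)%C = r * Im z.
Proof. destruct z; simpl; ring. Qed.

(** Up to PI/3 the derivative is at least 1/2; beyond, sin is at least sqrt 3 / 2 while v <= 2. *)
Lemma sin_ge_third (v : R) : 0 <= v <= PI / 2 -> v / 3 <= sin v.
Proof.
intros Hv. assert (P := PI_RGT_0). assert (P4 := PI_4).
destruct (Rle_or_lt v (PI / 3)) as [L|L].
- destruct (MVT_gen sin 0 v cos) as [c [Hc1 Hc2]].
  + intros x _. auto_derive; auto; ring.
  + intros x _. apply continuity_sin.
  + rewrite Rmin_left, Rmax_right in Hc1 by lra. rewrite sin_0 in Hc2.
    assert (/ 2 <= cos c).
    { replace (/ 2) with (cos (PI / 3)) by (rewrite cos_PI3; lra). apply cos_decr_1; lra. }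
    nra.
- apply Rle_trans with (sin (PI / 3)); [|apply sin_incr_1; lra].
  rewrite sin_PI3.
  assert (S := sqrt_sqrt 3 ltac:(lra)). assert (S' := sqrt_pos 3). nra.
Qed.

Lemma one_minus_cos_ge (u : R) : 0 <= u <= PI -> u * u / 18 <= 1 - cos u.
Proof.
intros Hu. assert (H := sin_ge_third (u / 2) ltac:(lra)).
replace (cos u) with (1 - 2 * sin (u / 2) * sin (u / 2)).
- nra.
- rewrite <- cos_2a_sin. f_equal; field.
Qed.

(** cos a - cos b = 2 sin((a+b)/2) sin((b-a)/2), and the first sine is at least the second because
    (b-a)/2 <= (a+b)/2 <= PI - (b-a)/2. So the drop is smallest when it starts at 0, where it is 2
    sin^2 of half the length. *)
Lemma cos_sub_ge (a b : R) : 0 <= a -> a <= b -> b <= PI ->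
  (b - a) * (b - a) / 18 <= cos a - cos b.
Proof.
intros H1 H2 H3. assert (P := PI_RGT_0).
apply Rle_trans with (1 - cos (b - a)); [apply one_minus_cos_ge; lra|].
replace (cos a - cos b) with (2 * (sin ((a + b) / 2) * sin ((b - a) / 2))).
2: { replace (cos a) with (cos ((a + b) / 2 - (b - a) / 2)) by (f_equal; field).
     replace (cos b) with (cos ((a + b) / 2 + (b - a) / 2)) by (f_equal; field).
     rewrite cos_minus, cos_plus. ring. }
replace (1 - cos (b - a)) with (2 * (sin ((b - a) / 2) * sin ((b - a) / 2))).
2: { replace (cos (b - a)) with (cos (2 * ((b - a) / 2))) by (f_equal; field). rewrite cos_2a_sin. ring. }
apply Rmult_le_compat_l; [lra|]. apply Rmult_le_compat_r; [apply sin_ge_0; lra|].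
destruct (Rle_or_lt ((a + b) / 2) (PI / 2)).
- apply sin_incr_1; lra.
- rewrite <- (sin_PI_x ((a + b) / 2)). apply sin_incr_1; lra.
Qed.

Lemma Cexp_polar (x y : R) : Cexp (x, y) = (RtoC (exp x) * Cexp (0, y))%C.
Proof. unfold Cexp; simpl. rewrite exp_0. apply C_eq; simpl; ring. Qed.

Lemma CD_Cexp_lin (c : C) (z : C) : CD (fun w => Cexp (c * w)) z (c * Cexp (c * z))%C.
Proof.
apply CD_Cexp_comp. eapply CD_ext_l; [apply CD_mult; [apply CD_const|apply CD_id]|]. cbv beta. ring.
Qed.

(** * Limits with error [O(exp (- x))] *)

Lemma decay_le (a b c X : R) : (forall x, X <= x -> a <= b + c * exp (- x)) -> a <= b.
Proof.
intros H. destruct (Rle_or_lt a b) as [|L]; auto. exfalso.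
set (x := Rmax X (Rmax c 0 / (a - b))).
specialize (H x (Rmax_l _ _)).
assert (P := exp_pos x). assert (I := exp_ineq1_le x).
rewrite exp_Ropp in H.
assert (c < (a - b) * exp x).
{ apply Rle_lt_trans with (Rmax c 0); [apply Rmax_l|].
  apply Rle_lt_trans with ((a - b) * x); [|apply Rmult_lt_compat_l; lra].
  apply Rle_trans with ((a - b) * (Rmax c 0 / (a - b))); [right; field; lra|].
  apply Rmult_le_compat_l; [lra|apply Rmax_r]. }
assert (c * / exp x < a - b).
{ apply Rmult_lt_reg_r with (exp x); auto. rewrite Rmult_assoc, Rinv_l; lra. }
lra.
Qed.

Lemma limit_bound (F : R -> C) (L : C) (B X : R) :
  L = 0 -> (forall x, X <= x -> Cmod (F x - L) <= B * exp (- x)) ->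
  forall x, X <= x -> Cmod (F x) <= B * exp (- x).
Proof. intros -> H x Hx. specialize (H x Hx). replace (F x - 0)%C with (F x) in H by ring. auto. Qed.

Lemma common_limit_bound (F G : R -> C) (L M : C) (B B' X : R) :
  0 <= X ->
  (forall x, X <= x -> Cmod (F x - L) <= B * exp (- x)) ->
  (forall x, X <= x -> Cmod (G x - M) <= B' * exp (- x)) ->
  (forall x, X <= x -> Cmod (F x - L) <= Rmax B B' * exp (- x)) /\
  (forall x, X <= x -> Cmod (G x - M) <= Rmax B B' * exp (- x)).
Proof.
intros HX H K. split; intros x Hx; (eapply Rle_trans; [eauto|]);
  apply Rmult_le_compat_r; try (left; apply exp_pos); [apply Rmax_l|apply Rmax_r].
Qed.

Lemma limit_unique (F : R -> C) (L M : C) (B B' X X' : R) :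
  (forall x, X <= x -> Cmod (F x - L) <= B * exp (- x)) ->
  (forall x, X' <= x -> Cmod (F x - M) <= B' * exp (- x)) -> L = M.
Proof.
intros H K. assert (E : (L - M = 0)%C).
{ apply Cmod_eq_0. apply Rle_antisym; [|apply Cmod_ge_0].
  apply (decay_le _ _ (B + B') (Rmax X X')). intros x Hx.
  specialize (H x (Rle_trans _ _ _ (Rmax_l _ _) Hx)). specialize (K x (Rle_trans _ _ _ (Rmax_r _ _) Hx)).
  replace (L - M)%C with (- (F x - L) + (F x - M))%C by ring.
  eapply Rle_trans; [apply Cmod_triangle|]. rewrite Cmod_opp. lra. }
replace L with (L - M + M)%C by ring. rewrite E. ring.
Qed.

(** The limit is taken along the points X + n; comparing F x with F y for y tending to infinity
    transfers it to every x without loss in the constant. *)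
Lemma exp_cauchy_R (F : R -> R) (X B : R) :
  (forall x0 x1, X <= x0 -> x0 <= x1 -> Rabs (F x0 - F x1) <= B * exp (- x0)) ->
  exists L, forall x, X <= x -> Rabs (F x - L) <= B * exp (- x).
Proof.
intros H.
assert (HB : 0 <= B).
{ specialize (H X X ltac:(lra) ltac:(lra)). assert (P := exp_pos (- X)).
  assert (Q := Rabs_pos (F X - F X)). nra. }
destruct (ex_lim_seq_cauchy_corr (fun n => F (X + INR n))) as [_ K].
destruct K as [l Hl].
{ intros eps.
  destruct (nfloor_ex (Rmax 0 (B * exp (- X) / eps))) as [n0 [_ Hn0]]; [apply Rmax_l|].
  assert (He := cond_pos eps).
  assert (Small : forall n : nat, (S n0 <= n)%nat -> B * exp (- (X + INR n)) < eps).
  { intros n Hn. apply le_INR in Hn. rewrite S_INR in Hn.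
    rewrite Ropp_plus_distr, exp_plus, (exp_Ropp (INR n)).
    assert (I := exp_ineq1_le (INR n)). assert (P := exp_pos (- X)).
    assert (Q : B * exp (- X) / eps < exp (INR n)).
    { eapply Rle_lt_trans; [apply Rmax_r|]. eapply Rlt_le_trans; [exact Hn0|]. lra. }
    apply Rmult_lt_reg_r with (exp (INR n)); [apply exp_pos|].
    replace (B * (exp (- X) * / exp (INR n)) * exp (INR n)) with (B * exp (- X))
      by (field; apply Rgt_not_eq, exp_pos).
    replace (B * exp (- X)) with (eps * (B * exp (- X) / eps)) by (field; lra).
    apply Rmult_lt_compat_l; auto. }
  exists (S n0). intros p q Hp Hq.
  destruct (Nat.le_ge_cases p q) as [L|L].
  - eapply Rle_lt_trans; [apply H|apply (Small p Hp)].
    + assert (R := pos_INR p); lra.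
    + apply le_INR in L; lra.
  - rewrite Rabs_minus_sym. eapply Rle_lt_trans; [apply H|apply (Small q Hq)].
    + assert (R := pos_INR q); lra.
    + apply le_INR in L; lra. }
exists l. intros x Hx.
apply (decay_le _ _ B x). intros y Hy.
assert (T : Rabs (F y - l) <= B * exp (- y)).
{ destruct (nfloor_ex (Rmax 0 (y - X))) as [n0 [_ Hn0]]; [apply Rmax_l|].
  assert (E := Rmax_r 0 (y - X)).
  assert (Lim : is_lim_seq (fun n => Rabs (F y - F (X + INR n))) (Rabs (F y - l))).
  { apply (is_lim_seq_abs (fun n => F y - F (X + INR n)) (F y - l)).
    apply (is_lim_seq_minus' (fun _ => F y)); [apply is_lim_seq_const|exact Hl]. }
  apply (is_lim_seq_le_loc _ (fun _ => B * exp (- y)) (Rabs (F y - l)) (B * exp (- y))) in Lim; auto.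
  - exists (S n0). intros n Hn. apply le_INR in Hn. rewrite S_INR in Hn. apply H; lra.
  - apply is_lim_seq_const. }
replace (F x - l) with ((F x - F y) + (F y - l)) by ring.
eapply Rle_trans; [apply Rabs_triang|]. specialize (H x y Hx Hy). lra.
Qed.

(** The factor 2 comes from treating real and imaginary parts separately. *)
Lemma exp_cauchy (F : R -> C) (X B : R) :
  (forall x0 x1, X <= x0 -> x0 <= x1 -> Cmod (F x0 - F x1) <= B * exp (- x0)) ->
  exists L, forall x, X <= x -> Cmod (F x - L) <= 2 * B * exp (- x).
Proof.
intros H.
destruct (exp_cauchy_R (fun x => Re (F x)) X B) as [l1 H1].
{ intros; eapply Rle_trans; [|apply H; eauto]. rewrite <- Re_minus. apply re_le_Cmod. }
destruct (exp_cauchy_R (fun x => Im (F x)) X B) as [l2 H2].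
{ intros; eapply Rle_trans; [|apply H; eauto]. rewrite <- Im_minus. apply im_le_Cmod. }
exists (l1, l2). intros x Hx. specialize (H1 x Hx). specialize (H2 x Hx).
replace (F x - (l1, l2))%C with (RtoC (Re (F x) - l1) + Ci * RtoC (Im (F x) - l2))%C.
- eapply Rle_trans; [apply Cmod_triangle|]. rewrite Cmod_mult, Cmod_Ci, !Cmod_R. lra.
- apply C_eq; destruct (F x); simpl; ring.
Qed.

(** The derivative of |f|^2 + |h|^2 is at most 4 c |f| |h|, hence at most 2 c (|f|^2 + |h|^2), so
    its product with exp(-2 c t) does not increase. With h the derivative of a solution f it yields
    uniqueness and growth bounds. *)
Lemma gronwall (f f' h h' : R -> C) (c T : R) : 0 <= T -> 0 <= c ->
  (forall t, 0 <= t <= T -> PD f t (f' t)) ->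
  (forall t, 0 <= t <= T -> PD h t (h' t)) ->
  (forall t, 0 <= t <= T -> Cmod (f' t) <= c * Cmod (h t)) ->
  (forall t, 0 <= t <= T -> Cmod (h' t) <= c * Cmod (f t)) ->
  Cmod (f T) ^ 2 + Cmod (h T) ^ 2 <= (Cmod (f 0) ^ 2 + Cmod (h 0) ^ 2) * exp (2 * c * T).
Proof.
intros HT Hc Hf Hh Bf Bh.
set (E := fun t => (Re (f t) ^ 2 + Im (f t) ^ 2 + (Re (h t) ^ 2 + Im (h t) ^ 2)) * exp (- (2 * c * t))).
set (E' := fun t => (2 * (Re (f t) * Re (f' t) + Im (f t) * Im (f' t) + (Re (h t) * Re (h' t) + Im (h t) * Im (h' t)))
   - 2 * c * (Re (f t) ^ 2 + Im (f t) ^ 2 + (Re (h t) ^ 2 + Im (h t) ^ 2))) * exp (- (2 * c * t))).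
assert (Aux : forall (p q r s : R -> R) (t p' q' r' s' : R),
   is_derive p t p' -> is_derive q t q' -> is_derive r t r' -> is_derive s t s' ->
   is_derive (fun t => (p t ^ 2 + q t ^ 2 + (r t ^ 2 + s t ^ 2)) * exp (- (2 * c * t))) t
   ((2 * (p t * p' + q t * q' + (r t * r' + s t * s')) - 2 * c * (p t ^ 2 + q t ^ 2 + (r t ^ 2 + s t ^ 2))) * exp (- (2 * c * t)))).
{ intros p q r s t p' q' r' s' P1 P2 P3 P4. auto_derive.
  - repeat split; eexists; eassumption.
  - replace (Derive (fun x : R => p x) t) with p' by (symmetry; apply is_derive_unique; exact P1).
    replace (Derive (fun x : R => q x) t) with q' by (symmetry; apply is_derive_unique; exact P2).
    replace (Derive (fun x : R => r x) t) with r' by (symmetry; apply is_derive_unique; exact P3).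
    replace (Derive (fun x : R => s x) t) with s' by (symmetry; apply is_derive_unique; exact P4).
    ring. }
assert (HE : forall t, 0 <= t <= T -> is_derive E t (E' t)).
{ intros t Ht. destruct (Hf t Ht) as [f1 f2]. destruct (Hh t Ht) as [h1 h2].
  apply (Aux (fun t => Re (f t)) (fun t => Im (f t)) (fun t => Re (h t)) (fun t => Im (h t))); auto. }
assert (HE' : forall t, 0 <= t <= T -> E' t <= 0).
{ intros t Ht. unfold E'. assert (P := exp_pos (- (2 * c * t))).
  specialize (Bf t Ht). specialize (Bh t Ht).
  assert (CS : forall x y : C, Re x * Re y + Im x * Im y <= Cmod x * Cmod y).
  { intros x y. replace (Re x * Re y + Im x * Im y) with (Re (Cconj x * y)%C) by (simpl; unfold Re, Im; ring).
    eapply Rle_trans; [apply Rle_abs|]. eapply Rle_trans; [apply re_le_Cmod|].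
    rewrite Cmod_mult, Cmod_conj; lra. }
  assert (C1 := CS (f t) (f' t)). assert (C2 := CS (h t) (h' t)).
  rewrite <- !Cmod2_alt.
  assert (P1 := Cmod_ge_0 (f t)). assert (P2 := Cmod_ge_0 (h t)).
  assert (C3 : Cmod (f t) * Cmod (f' t) <= Cmod (f t) * (c * Cmod (h t))) by (apply Rmult_le_compat_l; auto).
  assert (C4 : Cmod (h t) * Cmod (h' t) <= Cmod (h t) * (c * Cmod (f t))) by (apply Rmult_le_compat_l; auto).
  set (F := Cmod (f t)) in *. set (H := Cmod (h t)) in *.
  assert (0 <= c * (F - H) ^ 2) by (apply Rmult_le_pos; [lra|apply pow2_ge_0]).
  assert (Hneg : 2 * (Re (f t) * Re (f' t) + Im (f t) * Im (f' t) + (Re (h t) * Re (h' t) + Im (h t) * Im (h' t))) - 2 * c * (F ^ 2 + H ^ 2) <= 0) by nra.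
  nra. }
assert (Mono : E T <= E 0).
{ destruct (MVT_gen E 0 T E') as [x [Hx1 Hx2]].
  + intros x Hx. rewrite Rmin_left, Rmax_right in Hx by lra. apply HE; lra.
  + intros x Hx. rewrite Rmin_left, Rmax_right in Hx by lra.
    apply derivable_continuous_pt. exists (E' x). apply is_derive_Reals, HE; lra.
  + rewrite Rmin_left, Rmax_right in Hx1 by lra. specialize (HE' x Hx1). nra. }
unfold E in Mono. rewrite <- !Cmod2_alt in Mono.
replace (- (2 * c * 0)) with 0 in Mono by ring. rewrite exp_0, Rmult_1_r in Mono.
apply Rmult_le_reg_r with (exp (- (2 * c * T))); [apply exp_pos|].
rewrite (Rmult_assoc _ (exp (2 * c * T))), <- exp_plus. replace (2 * c * T + - (2 * c * T)) with 0 by ring.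
rewrite exp_0. lra.
Qed.

(** * Minimum modulus on a square, and the model function 1 - exp *)

Lemma Cmod_pair_le (a b : R) : Cmod (a, b) <= Rabs a + Rabs b.
Proof.
replace (a, b) with (RtoC a + Ci * RtoC b)%C by (apply C_eq; simpl; ring).
eapply Rle_trans; [apply Cmod_triangle|]. rewrite Cmod_mult, Cmod_Ci, !Cmod_R. lra.
Qed.

Lemma CD_continuity_2d_Cmod (h : C -> C) (x y : R) (l : C) : CD h (x, y) l ->
  continuity_2d_pt (fun a b => Cmod (h (a, b))) x y.
Proof.
intros H eps. destruct (CD_lip _ _ _ H) as [d [Hd K]].
assert (Hl := Cmod_ge_0 l). assert (He := cond_pos eps).
assert (Hd' : 0 < Rmin (d / 2) (eps / (4 * (Cmod l + 1)))).
{ apply Rmin_glb_lt; [lra|]. apply Rdiv_lt_0_compat; lra. }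
exists (mkposreal _ Hd'). simpl. intros u v Hu Hv.
assert (A1 := Rlt_le_trans _ _ _ Hu (Rmin_l _ _)). assert (A2 := Rlt_le_trans _ _ _ Hu (Rmin_r _ _)).
assert (B1 := Rlt_le_trans _ _ _ Hv (Rmin_l _ _)). assert (B2 := Rlt_le_trans _ _ _ Hv (Rmin_r _ _)).
set (k := (u - x, v - y)).
assert (Hk := Cmod_pair_le (u - x) (v - y)). fold k in Hk.
specialize (K k ltac:(lra)).
replace ((x, y) + k)%C with ((u, v) : C) in K by (unfold k; apply C_eq; simpl; ring).
assert (T1 := Cmod_triangle_rev (h (u, v)) (h (x, y))).
assert (T2 := Cmod_triangle_rev (h (x, y)) (h (u, v))).
replace (h (x, y) - h (u, v))%C with (- (h (u, v) - h (x, y)))%C in T2 by ring. rewrite Cmod_opp in T2.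
assert (E : (Cmod l + 1) * Cmod k < eps).
{ apply Rlt_le_trans with ((Cmod l + 1) * (2 * (eps / (4 * (Cmod l + 1))))).
  - apply Rmult_lt_compat_l; lra.
  - apply Rle_trans with (eps / 2); [right; field; lra|lra]. }
apply Rabs_def1; lra.
Qed.

(** Minimise in x for each y, then in y. The minimiser [p y] may jump, but the minimal value is
    continuous, because F varies uniformly in x when y changes. *)
Lemma square_min (F : R -> R -> R) : (forall x y, continuity_2d_pt F x y) ->
  exists x y, -1 <= x <= 1 /\ -1 <= y <= 1 /\
    forall u v, -1 <= u <= 1 -> -1 <= v <= 1 -> F x y <= F u v.
Proof.
intros HF.
assert (Hx : forall y, exists x, (forall c, -1 <= c <= 1 -> F x y <= F c y) /\ -1 <= x <= 1).
{ intros y. apply (continuity_ab_min (fun x => F x y) (-1) 1); [lra|].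
  intros c _ eps He. destruct (HF c y (mkposreal eps He)) as [d Hd].
  exists d. split; [apply cond_pos|]. intros z [_ Hz].
  apply Hd; [exact Hz|]. rewrite Rminus_diag, Rabs_R0; apply cond_pos. }
set (p := fun y => proj1_sig (constructive_indefinite_description _ (Hx y))).
assert (Hp : forall y, (forall c, -1 <= c <= 1 -> F (p y) y <= F c y) /\ -1 <= p y <= 1).
{ intros y. unfold p. destruct (constructive_indefinite_description _ (Hx y)); auto. }
destruct (continuity_ab_min (fun y => F (p y) y) (-1) 1) as [y [Hy1 Hy2]]; [lra| |].
- intros c _ eps He.
  destruct (uniform_continuity_2d_1d F (-1) 1 c (fun x _ => HF x c) (mkposreal eps He)) as [d Hd].
  exists d. split; [apply cond_pos|]. intros v [_ Hv].
  change (Rabs (v - c) < d) in Hv. change (Rabs (F (p v) v - F (p c) c) < eps).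
  assert (Hdp := cond_pos d).
  apply Rabs_def2 in Hv.
  assert (U : forall x, -1 <= x <= 1 -> Rabs (F x v - F x c) < eps).
  { intros x Hx'. apply (Hd x c x v); auto; try lra.
    rewrite Rminus_diag, Rabs_R0; auto. }
  destruct (Hp v) as [V1 V2]. destruct (Hp c) as [W1 W2].
  assert (U1 := U (p v) V2). assert (U2 := U (p c) W2).
  specialize (V1 (p c) W2). specialize (W1 (p v) V2).
  apply Rabs_def2 in U1. apply Rabs_def2 in U2. apply Rabs_def1; lra.
- exists (p y), y. destruct (Hp y) as [Y1 Y2]. repeat split; try lra.
  intros u v Hu Hv. specialize (Hy1 v Hv). destruct (Hp v) as [V1 _]. specialize (V1 u Hu). lra.
Qed.

(* Where [h] does not vanish and [h'] is nonzero, a step in the direction [- h / h'] decreases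
   [Cmod h], so an interior minimum of [Cmod h] is a zero. *)
Lemma min_modulus (h h' : C -> C) :
  (forall u, CD h u (h' u)) ->
  (forall x y, -1 <= x <= 1 -> -1 <= y <= 1 -> h' (x, y) <> 0) ->
  (forall x y, -1 <= x <= 1 -> -1 <= y <= 1 -> Rabs x = 1 \/ Rabs y = 1 ->
     Cmod (h 0) < Cmod (h (x, y))) ->
  exists x y, -1 <= x <= 1 /\ -1 <= y <= 1 /\ h (x, y) = 0.
Proof.
intros Hh Hn Hb.
destruct (square_min (fun a b => Cmod (h (a, b)))) as [x [y [Hx [Hy Hmin]]]].
{ intros a b. apply (CD_continuity_2d_Cmod h a b (h' (a, b))). apply Hh. }
exists x, y. split; auto. split; auto.
apply NNPP. intros Hne.
assert (N0 := Hmin 0 0 ltac:(lra) ltac:(lra)). change (0, 0) with (RtoC 0) in N0.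
assert (Ix : -1 < x < 1).
{ destruct (Req_dec (Rabs x) 1) as [E|E].
  - specialize (Hb x y Hx Hy (or_introl E)). lra.
  - assert (Rabs x <= 1) by (apply Rabs_le; lra).
    assert (L : Rabs x < 1) by lra. apply Rabs_def2 in L. lra. }
assert (Iy : -1 < y < 1).
{ destruct (Req_dec (Rabs y) 1) as [E|E].
  - specialize (Hb x y Hx Hy (or_intror E)). lra.
  - assert (Rabs y <= 1) by (apply Rabs_le; lra).
    assert (L : Rabs y < 1) by lra. apply Rabs_def2 in L. lra. }
specialize (Hn x y Hx Hy). set (u := (x, y) : C) in *.
set (l := h' u) in *. set (v := h u) in *.
assert (Pl : 0 < Cmod l) by (apply Cmod_gt_0; auto).
assert (Pv : 0 < Cmod v) by (apply Cmod_gt_0; auto).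
(* With tolerance |l| / 2 the step k = - t v / l has remainder at most t |v| / 2, half of the
   first-order gain t |v|. The number t keeps the step inside the square. *)
destruct (proj1 (CD_iff h u l) (Hh u) (Cmod l / 2) ltac:(lra)) as [d [Hd K]].
set (q := Rmin d (Rmin (1 - Rabs x) (1 - Rabs y))).
assert (Hq : 0 < q).
{ repeat apply Rmin_glb_lt; auto.
  - assert (Rabs x < 1) by (apply Rabs_def1; lra). lra.
  - assert (Rabs y < 1) by (apply Rabs_def1; lra). lra. }
set (t := Rmin 1 (q / 2 * Cmod l / Cmod v)).
assert (Ht : 0 < t).
{ apply Rmin_glb_lt; [lra|]. apply Rdiv_lt_0_compat; auto. nra. }
assert (Ht1 : t <= 1) by apply Rmin_l.
set (k := (- (t * v / l))%C).
assert (Ek : Cmod k = t * Cmod v / Cmod l).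
{ unfold k. rewrite Cmod_opp, Cmod_div, Cmod_mult, Cmod_R, Rabs_pos_eq by (auto; lra). reflexivity. }
assert (Hk : Cmod k < q).
{ rewrite Ek. apply Rle_lt_trans with (q / 2); [|lra].
  apply Rmult_le_reg_r with (Cmod l); auto.
  replace (t * Cmod v / Cmod l * Cmod l) with (t * Cmod v) by (field; lra).
  apply Rle_trans with (q / 2 * Cmod l / Cmod v * Cmod v).
  - apply Rmult_le_compat_r; [lra|apply Rmin_r].
  - right; field; lra. }
assert (Hk1 : Cmod k < d) by (eapply Rlt_le_trans; [exact Hk|apply Rmin_l]).
assert (Hk2 : Cmod k < 1 - Rabs x) by (eapply Rlt_le_trans; [exact Hk|]; eapply Rle_trans; [apply Rmin_r|apply Rmin_l]).
assert (Hk3 : Cmod k < 1 - Rabs y) by (eapply Rlt_le_trans; [exact Hk|]; eapply Rle_trans; [apply Rmin_r|apply Rmin_r]).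
specialize (K k Hk1).
assert (R1 := re_le_Cmod k). assert (R2 := im_le_Cmod k).
assert (M := Hmin (x + Re k) (y + Im k)). cbv beta in M. fold u in M. fold v in M.
assert (Tx := Rabs_triang x (Re k)). assert (Ty := Rabs_triang y (Im k)).
assert (Bx : Rabs (x + Re k) <= 1) by lra. assert (By : Rabs (y + Im k) <= 1) by lra.
apply Rabs_le_between in Bx. apply Rabs_le_between in By.
specialize (M ltac:(lra) ltac:(lra)).
replace ((x + Re k, y + Im k) : C) with (u + k)%C in M by (apply C_eq; reflexivity).
fold v in K.
assert (E : (h (u + k) = (h (u + k) - v - k * l) + (1 - t)%R * v)%C).
{ rewrite RtoC_minus. unfold k. field. auto. }
rewrite E in M.
assert (T := Cmod_triangle (h (u + k)%C - v - k * l) ((1 - t)%R * v)).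
rewrite Cmod_mult, Cmod_R, Rabs_pos_eq in T by lra.
rewrite Ek in K.
replace (Cmod l / 2 * (t * Cmod v / Cmod l)) with (t * Cmod v / 2) in K by (field; lra).
assert (0 < t * Cmod v) by (apply Rmult_lt_0_compat; auto).
lra.
Qed.

Lemma decay_lt (c e : R) : 0 < e -> exists X, forall x, X <= x -> c * exp (- x) < e.
Proof.
intros He. exists (Rabs c / e). intros x Hx. rewrite exp_Ropp.
assert (P := exp_pos x). assert (I := exp_ineq1_le x).
apply Rmult_lt_reg_r with (exp x); auto. rewrite Rmult_assoc, Rinv_l by lra.
apply Rle_lt_trans with (Rabs c); [rewrite Rmult_1_r; apply Rle_abs|].
apply Rle_lt_trans with (e * x); [|apply Rmult_lt_compat_l; lra].
apply Rle_trans with (e * (Rabs c / e)); [right; field; lra|apply Rmult_le_compat_l; lra].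
Qed.

Lemma unit_polar (q : C) : Cmod q = 1 -> exists t, - PI <= t <= PI /\ q = Cexp (Ci * t).
Proof.
intros H. assert (N := Cmod2_alt q). rewrite H in N.
assert (HR : -1 <= Re q <= 1).
{ assert (R := re_le_Cmod q). rewrite H in R. apply Rabs_le_between in R. lra. }
destruct (acos_bound (Re q)) as [A1 A2].
assert (S : sqrt (1 - Rsqr (Re q)) = Rabs (Im q)).
{ rewrite <- sqrt_Rsqr_abs. f_equal. unfold Rsqr. nra. }
destruct (Rle_or_lt 0 (Im q)) as [L|L].
- exists (acos (Re q)). split; [lra|].
  unfold Cexp; apply C_eq; simpl.
  + replace (0 * acos (Re q) - 1 * 0) with 0 by ring.
    replace (0 * 0 + 1 * acos (Re q)) with (acos (Re q)) by ring.
    rewrite exp_0, cos_acos by auto. ring.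
  + replace (0 * acos (Re q) - 1 * 0) with 0 by ring.
    replace (0 * 0 + 1 * acos (Re q)) with (acos (Re q)) by ring.
    rewrite exp_0, sin_acos, S, Rabs_pos_eq by auto. ring.
- exists (- acos (Re q)). split; [lra|].
  unfold Cexp; apply C_eq; simpl.
  + replace (0 * - acos (Re q) - 1 * 0) with 0 by ring.
    replace (0 * 0 + 1 * - acos (Re q)) with (- acos (Re q)) by ring.
    rewrite exp_0, cos_neg, cos_acos by auto. ring.
  + replace (0 * - acos (Re q) - 1 * 0) with 0 by ring.
    replace (0 * 0 + 1 * - acos (Re q)) with (- acos (Re q)) by ring.
    rewrite exp_0, sin_neg, sin_acos, S, Rabs_left by auto. ring.
Qed.

(** On the sides |a| = 1 the modulus of the exponential differs from 1 by at least 1/2; on the sides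
    |b| = 1 the imaginary part is at least exp(-1) sin 1, and each factor is at least 1/3. *)
Lemma one_minus_Cexp_boundary (a b : R) : -1 <= a <= 1 -> -1 <= b <= 1 ->
  Rabs a = 1 \/ Rabs b = 1 -> / 9 <= Cmod (1 - Cexp (a, b)).
Proof.
intros Ha Hb [E|E].
- assert (T1 := Cmod_triangle_rev 1 (Cexp (a, b))). assert (T2 := Cmod_triangle_rev (Cexp (a, b)) 1).
  replace (Cexp (a, b) - 1)%C with (- (1 - Cexp (a, b)))%C in T2 by ring. rewrite Cmod_opp in T2.
  rewrite Cmod_1, Cmod_Cexp in T1, T2. simpl in T1, T2.
  assert (X := exp_ineq1_le 1).
  unfold Rabs in E; destruct (Rcase_abs a).
  + assert (Ea : exp a = / exp 1) by (rewrite <- exp_Ropp; f_equal; lra). rewrite Ea in T1.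
    assert (/ exp 1 <= / 2) by (apply Rinv_le_contravar; lra). lra.
  + assert (Ea : exp a = exp 1) by (f_equal; lra). lra.
- eapply Rle_trans; [|apply im_le_Cmod].
  replace (Im (1 - Cexp (a, b))%C) with (- (exp a * sin b)) by (simpl; ring).
  rewrite Rabs_Ropp, Rabs_mult, (Rabs_pos_eq (exp a)) by (left; apply exp_pos).
  replace (/ 9) with (/ 3 * / 3) by lra. apply Rmult_le_compat; try lra.
  + apply Rle_trans with (exp (- (1))); [|apply exp_le; lra]. rewrite exp_Ropp.
    apply Rinv_le_contravar; [apply exp_pos|apply exp_le_3].
  + assert (P := PI2_1). assert (S := sin_ge_third 1 ltac:(lra)).
    unfold Rabs in E; destruct (Rcase_abs b).
    * replace b with (- (1)) by lra. rewrite sin_neg, Rabs_Ropp, Rabs_pos_eq; lra.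
    * replace b with 1 by lra. rewrite Rabs_pos_eq; lra.
Qed.

(** * Counting zeros against the exponent of convergence *)

Lemma exp_INR_mult (n : nat) (y : R) : exp (INR n * y) = exp y ^ n.
Proof.
induction n as [|n IH]; [simpl; rewrite Rmult_0_l; apply exp_0|].
rewrite S_INR, Rmult_plus_distr_r, exp_plus, IH, Rmult_1_l. simpl; ring.
Qed.

(** Raising x / k <= exp(x / k) to the power k = N + 1 bounds x^(N+1) by a multiple of exp x; the
    extra factor x outgrows every constant. *)
Lemma exp_beats_pow (N : nat) (c : R) : exists X, 1 <= X /\ forall x, X <= x -> c * x ^ N < exp x.
Proof.
set (k := INR (S N)). assert (Hk : 1 <= k) by (unfold k; rewrite S_INR; assert (P := pos_INR N); lra).
set (K := k ^ S N). assert (HK : 0 < K) by (apply pow_lt; lra).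
exists (Rmax 1 (Rabs c * K + 1)). split; [apply Rmax_l|]. intros x Hx.
assert (H1 := Rle_trans _ _ _ (Rmax_l _ _) Hx). assert (H2 := Rle_trans _ _ _ (Rmax_r _ _) Hx).
assert (E : x ^ S N <= K * exp x).
{ replace (exp x) with (exp (x / k) ^ S N).
  - unfold K. rewrite <- Rpow_mult_distr. apply pow_incr. split; [lra|].
    assert (I := exp_ge_id (x / k)). replace x with (k * (x / k)) at 1 by (field; lra).
    apply Rmult_le_compat_l; lra.
  - rewrite <- exp_INR_mult. f_equal. fold k. field. lra. }
assert (Px : 0 <= x ^ N) by (apply pow_le; lra). assert (Pe := exp_pos x).
assert (A := Rle_abs c). assert (A' := Rabs_pos c).
apply Rmult_lt_reg_r with x; [lra|].
apply Rle_lt_trans with (Rabs c * (K * exp x)).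
- rewrite Rmult_assoc. replace (x ^ N * x) with (x ^ S N) by (simpl; ring).
  assert (0 <= x ^ S N) by (apply pow_le; lra).
  apply Rle_trans with (Rabs c * x ^ S N); [apply Rmult_le_compat_r; auto|apply Rmult_le_compat_l; auto].
- rewrite <- Rmult_assoc, (Rmult_comm (exp x)). apply Rmult_lt_compat_r; lra.
Qed.

Lemma zeros_polynomially_many (f : C -> C) :
  Rbar_lt (exponent_of_convergence f) p_infty ->
  exists (N : nat) (r0 : R), forall r L, r0 < r -> lists_zeros f r L -> INR (length L) <= r ^ N.
Proof.
intros H. unfold exponent_of_convergence, LimSup_at_p_infty in H.
set (E := fun M : Rbar => exists r0 : R, M = Rbar_lub (fun y : Rbar => exists r : R, r0 < r /\ y = log_zero_count_ratio f r)) in *.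
assert (G : Rbar_is_glb E (Rbar_glb E)) by (unfold Rbar_glb; destruct (Rbar_ex_glb E); auto).
(* If every tail supremum were [p_infty], then [p_infty] would be a lower bound of them and so would
   be at most their infimum. *)
destruct (classic (exists M, E M /\ M <> p_infty)) as [[M [[r0 HM] HMp]]|Hn].
2: { exfalso. apply (Rbar_le_not_lt (Rbar_glb E) p_infty); auto.
  destruct G as [_ G2]. apply G2. intros M HM. destruct (classic (M = p_infty)) as [-> | Hne]; [apply Rbar_le_refl|].
  exfalso. apply Hn. exists M; auto. }
assert (U : forall r, r0 < r -> Rbar_le (log_zero_count_ratio f r) M).
{ assert (LubOK : forall S, Rbar_is_lub S (Rbar_lub S)) by (intros S; unfold Rbar_lub; destruct (Rbar_ex_lub S); auto).
  intros r Hr. rewrite HM. apply (proj1 (LubOK _)). exists r; auto. }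
destruct (nfloor_ex (Rmax 0 (real M))) as [n [_ Hn]]; [apply Rmax_l|].
assert (HnM := Rle_lt_trans _ _ _ (Rmax_r _ _) Hn).
exists (S n), (Rmax 1 r0). intros r L Hr HL.
assert (H1 := Rle_lt_trans _ _ _ (Rmax_l _ _) Hr). assert (H2 := Rle_lt_trans _ _ _ (Rmax_r _ _) Hr).
specialize (U r H2). unfold log_zero_count_ratio in U.
assert (Ub : Rbar_le (INR (length L)) (zero_count f r)).
{ unfold zero_count. apply Lub_Rbar_correct. exists L; auto. }
destruct (zero_count f r) as [c| |].
- simpl in Ub. destruct M as [M| |]; [|congruence|contradiction]. simpl in U, HnM.
  assert (Hl : 0 < ln r) by (rewrite <- ln_1; apply ln_increasing; lra).
  (* Counts up to 1 are separated because [ln] takes a default value at 0; for them the power bound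
     is trivial. *)
  destruct (Rle_or_lt c 1) as [Hc|Hc].
  + apply Rle_trans with 1; [lra|]. apply pow_R1_Rle; lra.
  + eapply Rle_trans; [exact Ub|]. left. apply ln_lt_inv; [lra|apply pow_lt; lra|].
    rewrite ln_pow by lra. rewrite S_INR.
    apply Rle_lt_trans with (M * ln r).
    * replace (ln c) with (ln c / ln r * ln r) by (field; lra). apply Rmult_le_compat_r; lra.
    * apply Rmult_lt_compat_r; lra.
- exfalso. apply HMp. destruct M; simpl in U; try contradiction; auto.
- simpl in Ub; contradiction.
Qed.

(** Sample the abscissas x + k / n' in an interval of length 1. The zeros found near them are
    distinct as soon as 6 exp(-x) is below half the spacing, so n' may be nearly as large as exp x
    while all these zeros lie in |z| < 2x. *)
Lemma zeros_along_strip_infinite_order (f : C -> C) (X c : R) :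
  (forall x, X <= x -> exists z, f z = 0 /\ Rabs (Re z - x) <= 6 * exp (- x) /\ Rabs (Im z) <= c) ->
  Rbar_lt (exponent_of_convergence f) p_infty -> False.
Proof.
intros HZ HL. destruct (zeros_polynomially_many f HL) as [N [r0 HN]].
(* n' is at most (2x)^N + 1 <= (2^N + 1) x^N, and 6 exp(-x) < 1 / (2 n') amounts to 12 n' < exp
   x. *)
destruct (exp_beats_pow N (12 * (2 ^ N + 1))) as [X1 [HX11 HX1]].
set (x := Rmax (Rmax X X1) (Rmax r0 (8 + Rabs c))).
assert (Hx1 : X <= x) by (eapply Rle_trans; [apply (Rmax_l X X1)|apply Rmax_l]).
assert (Hx2 : X1 <= x) by (eapply Rle_trans; [apply (Rmax_r X X1)|apply Rmax_l]).
assert (Hx3 : r0 <= x) by (eapply Rle_trans; [apply (Rmax_l r0 (8 + Rabs c))|apply Rmax_r]).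
assert (Hx4 : 8 + Rabs c <= x) by (eapply Rle_trans; [apply (Rmax_r r0 (8 + Rabs c))|apply Rmax_r]).
assert (Pc := Rabs_pos c). assert (Ac := Rle_abs c).
set (r := 2 * x).
assert (Pr : 0 <= r ^ N) by (apply pow_le; unfold r; lra).
destruct (nfloor_ex (r ^ N) Pr) as [n [Hn1 Hn2]].
set (n' := S n).
assert (Hn' : r ^ N < INR n' <= r ^ N + 1) by (unfold n'; rewrite S_INR; lra).
assert (Hxn : 1 <= x ^ N) by (apply pow_R1_Rle; lra).
assert (Big : 12 * INR n' < exp x).
{ eapply Rle_lt_trans; [|apply (HX1 x Hx2)]. unfold r in Hn'. rewrite Rpow_mult_distr in Hn'.
  assert (0 <= 2 ^ N) by (apply pow_le; lra). nra. }
assert (Pn : 0 < INR n') by (unfold n'; apply lt_0_INR; lia).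
set (h := / INR n').
assert (Ph : 0 < h) by (apply Rinv_0_lt_compat; auto).
assert (Hh : forall y, x <= y -> 6 * exp (- y) < h / 2).
{ intros y Hy. apply Rle_lt_trans with (6 * exp (- x)).
  - apply Rmult_le_compat_l; [lra|]. apply exp_le; lra.
  - rewrite exp_Ropp. unfold h. apply Rmult_lt_reg_r with (exp x * INR n').
    + apply Rmult_lt_0_compat; auto. apply exp_pos.
    + replace (6 * / exp x * (exp x * INR n')) with (6 * INR n') by (field; apply Rgt_not_eq, exp_pos).
      replace (/ INR n' / 2 * (exp x * INR n')) with (exp x / 2) by (field; lra). lra. }
assert (Hh1 : h <= 1).
{ unfold h. rewrite <- Rinv_1. apply Rinv_le_contravar; [lra|]. unfold n'. rewrite S_INR. assert (P := pos_INR n). lra. }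
(* The bound on [Re a] lies half a spacing to the left of the next sample point, so the next zero is
   to the right of all earlier ones. *)
assert (Build : forall k, (k <= n')%nat -> exists L, length L = k /\ NoDup L /\
  forall a, In a L -> f a = 0 /\ Cmod a < r /\ Re a < x + INR k * h - h / 2).
{ induction k as [|k IH].
  - intros _. exists nil. repeat split; [constructor|contradiction..].
  - intros Hk. destruct IH as [L [L1 [L2 L3]]]; [lia|].
    assert (Pk := pos_INR k).
    assert (Hkh : 0 <= INR k * h) by nra.
    destruct (HZ (x + INR k * h)) as [z [Z1 [Z2 Z3]]]; [lra|].
    assert (Hz := Hh (x + INR k * h) ltac:(lra)).
    assert (Zr : Rabs (Re z - (x + INR k * h)) < h / 2) by lra. apply Rabs_def2 in Zr.
    rewrite S_INR.
    exists (z :: L). repeat split.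
    + simpl; congruence.
    + constructor; auto. intros Hin. destruct (L3 z Hin) as [_ [_ Q]]. lra.
    + destruct H as [<- |Hin]; [auto|apply L3; auto].
    + destruct H as [<- |Hin]; [|apply L3; auto].
      destruct z as [zx zy]. simpl in *. eapply Rle_lt_trans; [apply Cmod_pair_le|].
      assert (Hkn : INR k * h <= 1).
      { assert (INR k <= INR n') by (apply le_INR; lia).
        apply Rle_trans with (INR n' * h); [apply Rmult_le_compat_r; lra|right; unfold h; apply Rinv_r; lra]. }
      rewrite (Rabs_pos_eq zx) by lra. unfold r. lra.
    + destruct H as [<- |Hin]; [lra|]. destruct (L3 a Hin) as [_ [_ Q]]. lra. }
destruct (Build n' (le_n _)) as [L [L1 [L2 L3]]].
assert (K : INR (length L) <= r ^ N).
{ apply HN; [unfold r; lra|]. intros a Ha. destruct (L3 a Ha) as [F [M _]]. split; auto.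
  (* Each zero is listed once, so only the derivative of order 0 has to vanish. *)
  intros j Hj. assert (Q := proj1 (NoDup_count_occ Ceq_dec L) L2 a).
  assert (j = 0)%nat as -> by lia. exact F. }
rewrite L1 in K. lra.
Qed.

(** * Fourier coefficients of periodic functions *)

Definition period : C := (0, 2 * PI).

Lemma Cexp_period : Cexp period = 1.
Proof.
unfold Cexp, period; simpl. rewrite exp_0, cos_2PI, sin_2PI. apply C_eq; simpl; ring.
Qed.

Lemma Cexp_Z_period (n : Z) : Cexp (n * period) = 1.
Proof.
induction n using Z.peano_ind.
- unfold ZtoC. rewrite Cmult_0_l. apply Cexp_0.
- replace (Z.succ n * period)%C with (n * period + period)%C.
  + rewrite Cexp_plus, IHn, Cexp_period. ring.
  + unfold ZtoC. rewrite succ_IZR, RtoC_plus. ring.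
- replace (Z.pred n * period)%C with (n * period + - period)%C.
  + rewrite Cexp_plus, IHn, Cexp_opp, Cexp_period. field.
  + unfold ZtoC, Z.pred. rewrite plus_IZR, RtoC_plus. change (IZR (-1)) with (- (1)). rewrite RtoC_opp. ring.
Qed.

Lemma Cexp_Z_shift (n : Z) (z : C) : Cexp (n * (z + period)) = Cexp (n * z).
Proof.
replace (n * (z + period))%C with (n * z + n * period)%C by ring.
rewrite Cexp_plus, Cexp_Z_period. ring.
Qed.

Lemma CD_shift (f : C -> C) (z w l : C) : CD f (z + w)%C l -> CD (fun z => f (z + w)%C) z l.
Proof.
intros H. eapply CD_ext_l.
- apply (CD_comp f (fun z => z + w)%C); [exact H|]. apply CD_plus; [apply CD_id|apply CD_const].
- ring.
Qed.

Definition entire (F F1 : C -> C) : Prop := forall z, CD F z (F1 z).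
Definition periodic (F : C -> C) : Prop := forall z, F (z + period)%C = F z.

(** An integral, that is 2 PI times a mean. The lower end [ya] is left free because the asymptotic
    bounds are proved on one particular period strip. *)
Definition vmean (ya : R) (F : C -> C) (x : R) : C :=
  (RInt (fun y => Re (F (x, y))) ya (ya + 2 * PI), RInt (fun y => Im (F (x, y))) ya (ya + 2 * PI)).

Lemma Re_Ci_mult (w : C) : Re (Ci * w)%C = - Im w.
Proof. destruct w; simpl; unfold Re, Im; simpl; ring. Qed.

Lemma Im_Ci_mult (w : C) : Im (Ci * w)%C = Re w.
Proof. destruct w; simpl; unfold Re, Im; simpl; ring. Qed.

Lemma PD_vertical (F F1 : C -> C) (x y : R) : entire F F1 ->
  PD (fun y => F (x, y)) y (Ci * F1 (x, y))%C.
Proof.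
intros H.
assert (Hpt : forall t : R, ((x, 0) + t * Ci)%C = (x, t)) by (intros; apply C_eq; simpl; ring).
assert (P := CD_path F (x, 0) Ci y (F1 (x, y))). rewrite Hpt in P. specialize (P (H _)).
destruct P as [P1 P2]. split.
- eapply is_derive_ext; [|exact P1]. intros t; simpl; rewrite Hpt; reflexivity.
- eapply is_derive_ext; [|exact P2]. intros t; simpl; rewrite Hpt; reflexivity.
Qed.

Lemma PD_horizontal (F F1 : C -> C) (x y : R) : entire F F1 ->
  PD (fun x => F (x, y)) x (F1 (x, y)).
Proof.
intros H.
assert (Hpt : forall t : R, ((0, y) + t * 1)%C = (t, y)) by (intros; apply C_eq; simpl; ring).
assert (P := CD_path F (0, y) 1 x (F1 (x, y))). rewrite Hpt, Cmult_1_l in P. specialize (P (H _)).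
destruct P as [P1 P2]. split.
- eapply is_derive_ext; [|exact P1]. intros t; simpl; rewrite Hpt; reflexivity.
- eapply is_derive_ext; [|exact P2]. intros t; simpl; rewrite Hpt; reflexivity.
Qed.

Lemma continuous_vertical (F F1 : C -> C) (x y : R) : entire F F1 ->
  continuous (fun y => Re (F (x, y))) y /\ continuous (fun y => Im (F (x, y))) y.
Proof.
intros H. destruct (PD_vertical F F1 x y H) as [P1 P2].
split; apply (ex_derive_continuous (K := R_AbsRing) (V := R_NormedModule)); eexists; eassumption.
Qed.

Lemma ex_RInt_vertical (F F1 : C -> C) (x a b : R) : entire F F1 ->
  ex_RInt (fun y => Re (F (x, y))) a b /\ ex_RInt (fun y => Im (F (x, y))) a b.
Proof.
intros H. split; apply (ex_RInt_continuous (V := R_CompleteNormedModule)); intros y _;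
  apply (continuous_vertical F F1 x y H).
Qed.

Lemma vmean_ext (ya : R) (F G : C -> C) (x : R) : (forall z, F z = G z) -> vmean ya F x = vmean ya G x.
Proof. intros H. unfold vmean. f_equal; apply RInt_ext; intros; rewrite H; reflexivity. Qed.

Lemma vmean_plus (ya : R) (F F1 G G1 : C -> C) (x : R) : entire F F1 -> entire G G1 ->
  vmean ya (fun z => F z + G z)%C x = (vmean ya F x + vmean ya G x)%C.
Proof.
intros HF HG. destruct (ex_RInt_vertical F F1 x ya (ya + 2 * PI) HF) as [A1 A2].
destruct (ex_RInt_vertical G G1 x ya (ya + 2 * PI) HG) as [B1 B2].
unfold vmean. apply C_eq; simpl.
- apply (RInt_plus (V := R_CompleteNormedModule)); auto.
- apply (RInt_plus (V := R_CompleteNormedModule)); auto.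
Qed.

Lemma vmean_scal (ya : R) (c : C) (F F1 : C -> C) (x : R) : entire F F1 ->
  vmean ya (fun z => c * F z)%C x = (c * vmean ya F x)%C.
Proof.
intros HF. destruct (ex_RInt_vertical F F1 x ya (ya + 2 * PI) HF) as [A1 A2].
assert (S1 : forall k, ex_RInt (fun y => k * Re (F (x, y))) ya (ya + 2 * PI)).
{ intros k. apply (ex_RInt_scal (V := R_NormedModule)); auto. }
assert (S2 : forall k, ex_RInt (fun y => k * Im (F (x, y))) ya (ya + 2 * PI)).
{ intros k. apply (ex_RInt_scal (V := R_NormedModule)); auto. }
unfold vmean. apply C_eq; simpl.
- transitivity (RInt (fun y => minus (Re c * Re (F (x, y))) (Im c * Im (F (x, y)))) ya (ya + 2 * PI)).
  { apply RInt_ext; intros; reflexivity. }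
  rewrite (RInt_minus (V := R_CompleteNormedModule)) by auto.
  unfold minus, plus, opp; simpl.
  rewrite (RInt_scal (V := R_CompleteNormedModule)) by auto.
  rewrite (RInt_scal (V := R_CompleteNormedModule)) by auto. reflexivity.
- transitivity (RInt (fun y => plus (Re c * Im (F (x, y))) (Im c * Re (F (x, y)))) ya (ya + 2 * PI)).
  { apply RInt_ext; intros; reflexivity. }
  rewrite (RInt_plus (V := R_CompleteNormedModule)) by auto.
  unfold plus; simpl.
  rewrite (RInt_scal (V := R_CompleteNormedModule)) by auto.
  rewrite (RInt_scal (V := R_CompleteNormedModule)) by auto. reflexivity.
Qed.

(** Along a vertical line [Ci * F1] is the derivative of F, so the integral is a difference of
    values of F one period apart. [F2] supplies the continuity of [F1]. *)
Lemma vmean_derivative (ya : R) (F F1 F2 : C -> C) (x : R) : entire F F1 -> entire F1 F2 -> periodic F ->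
  vmean ya F1 x = 0.
Proof.
intros H H1 Hp.
assert (Hper : F (x, ya + 2 * PI) = F (x, ya)).
{ rewrite <- (Hp (x, ya)). f_equal. unfold period. apply C_eq; simpl; ring. }
assert (I2 : is_RInt (fun y => Re (F1 (x, y))) ya (ya + 2 * PI) (minus (Im (F (x, ya + 2 * PI))) (Im (F (x, ya))))).
{ apply (is_RInt_derive (V := R_CompleteNormedModule) (fun y => Im (F (x, y)))).
  - intros y _. destruct (PD_vertical F F1 x y H) as [_ P2]. 
    rewrite Im_Ci_mult in P2. exact P2.
  - intros y _. apply (continuous_vertical F1 F2 x y H1). }
assert (I1 : is_RInt (fun y => - Im (F1 (x, y))) ya (ya + 2 * PI) (minus (Re (F (x, ya + 2 * PI))) (Re (F (x, ya))))).
{ apply (is_RInt_derive (V := R_CompleteNormedModule) (fun y => Re (F (x, y)))).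
  - intros y _. destruct (PD_vertical F F1 x y H) as [P1 _]. 
    rewrite Re_Ci_mult in P1. exact P1.
  - intros y _. apply (continuous_opp (V := R_NormedModule)). apply (continuous_vertical F1 F2 x y H1). }
rewrite Hper in I1, I2.
assert (Z : forall r : R, minus r r = 0) by (intros r; unfold minus, plus, opp; simpl; ring).
rewrite Z in I1, I2.
apply C_eq; simpl.
- apply (is_RInt_unique (V := R_CompleteNormedModule)); exact I2.
- replace (RInt (fun y => Im (F1 (x, y))) ya (ya + 2 * PI)) with (- RInt (fun y => - Im (F1 (x, y))) ya (ya + 2 * PI)).
  + rewrite (is_RInt_unique (V := R_CompleteNormedModule) _ _ _ _ I1). ring.
  + rewrite <- (RInt_opp (V := R_CompleteNormedModule)).
    * apply RInt_ext. intros; unfold opp; simpl. ring.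
    * eexists; exact I1.
Qed.

Lemma CD_continuity_2d_parts (h : C -> C) (x y : R) (l : C) : CD h (x, y) l ->
  continuity_2d_pt (fun a b => Re (h (a, b))) x y /\ continuity_2d_pt (fun a b => Im (h (a, b))) x y.
Proof.
intros H.
assert (K : CD (fun w => h w - h (x, y))%C (x, y) l).
{ eapply CD_ext_l; [apply CD_minus; [exact H|apply CD_const]|]. ring. }
split; intros eps; specialize (CD_continuity_2d_Cmod _ x y _ K eps); intros [d Hd];
  exists d; intros u v Hu Hv; specialize (Hd u v Hu Hv);
  replace (h (x, y) - h (x, y))%C with (RtoC 0) in Hd by ring;
  rewrite Cmod_0, Rminus_0_r, (Rabs_pos_eq (Cmod _)) in Hd by apply Cmod_ge_0;
  (eapply Rle_lt_trans; [|exact Hd]).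
- rewrite <- Re_minus. apply re_le_Cmod.
- rewrite <- Im_minus. apply im_le_Cmod.
Qed.


(** Differentiation under the integral sign gives the vertical mean of [F1], which is 0. This is
    Cauchy's theorem for a rectangle one period high. *)
Lemma vmean_constant (ya : R) (F F1 F2 : C -> C) (x x' : R) : entire F F1 -> entire F1 F2 -> periodic F ->
  vmean ya F x = vmean ya F x'.
Proof.
intros H H1 Hp.
assert (HD : forall u, PD (vmean ya F) u 0).
{ intros u.
  assert (Z := vmean_derivative ya F F1 F2 u H H1 Hp).
  assert (DR : forall a v, Derive (fun x => Re (F (x, v))) a = Re (F1 (a, v))).
  { intros a v. apply is_derive_unique. exact (proj1 (PD_horizontal F F1 a v H)). }
  assert (DI : forall a v, Derive (fun x => Im (F (x, v))) a = Im (F1 (a, v))).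
  { intros a v. apply is_derive_unique. exact (proj2 (PD_horizontal F F1 a v H)). }
  split; simpl.
  - replace 0 with (RInt (fun t => Derive (fun u => Re (F (u, t))) u) ya (ya + 2 * PI)).
    + apply (is_derive_RInt_param (fun u t => Re (F (u, t)))).
      * exists (mkposreal 1 Rlt_0_1). intros a _ t _. exists (Re (F1 (a, t))). apply (PD_horizontal F F1 a t H).
      * intros t _. apply (continuity_2d_pt_ext (fun a b => Re (F1 (a, b)))).
        -- intros a b. symmetry. apply DR.
        -- apply (CD_continuity_2d_parts F1 u t (F2 (u, t))). apply H1.
      * exists (mkposreal 1 Rlt_0_1). intros a _. apply (ex_RInt_vertical F F1 a _ _ H).
    + apply (f_equal Re) in Z. simpl in Z. rewrite <- Z. apply RInt_ext. intros t _. apply DR.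
  - replace 0 with (RInt (fun t => Derive (fun u => Im (F (u, t))) u) ya (ya + 2 * PI)).
    + apply (is_derive_RInt_param (fun u t => Im (F (u, t)))).
      * exists (mkposreal 1 Rlt_0_1). intros a _ t _. exists (Im (F1 (a, t))). apply (PD_horizontal F F1 a t H).
      * intros t _. apply (continuity_2d_pt_ext (fun a b => Im (F1 (a, b)))).
        -- intros a b. symmetry. apply DI.
        -- apply (CD_continuity_2d_parts F1 u t (F2 (u, t))). apply H1.
      * exists (mkposreal 1 Rlt_0_1). intros a _. apply (ex_RInt_vertical F F1 a _ _ H).
    + apply (f_equal Im) in Z. simpl in Z. rewrite <- Z. apply RInt_ext. intros t _. apply DI. }
assert (W : forall u v, u <= v -> vmean ya F v = vmean ya F u).
{ intros u v Huv.
  assert (K : Cmod (vmean ya F v - vmean ya F u) <= 0 - 0).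
  { apply (mean_value_ineq (vmean ya F) (fun _ => RtoC 0) (fun _ => 0) (fun _ => 0)); auto.
    - intros t _. apply (is_derive_const (K := R_AbsRing) (V := R_NormedModule)).
    - intros t _. rewrite Cmod_0; lra. }
  assert (E : (vmean ya F v - vmean ya F u = 0)%C).
  { apply Cmod_eq_0. apply Rle_antisym; [lra|apply Cmod_ge_0]. }
  replace (vmean ya F v) with (vmean ya F v - vmean ya F u + vmean ya F u)%C by ring. rewrite E; ring. }
destruct (Rle_or_lt x x'); [symmetry|]; apply W; lra.
Qed.

(** 4 PI instead of 2 PI, since the two components are bounded separately. *)
Lemma vmean_bound (ya : R) (F F1 : C -> C) (x M : R) : entire F F1 ->
  (forall y, ya <= y <= ya + 2 * PI -> Cmod (F (x, y)) <= M) ->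
  Cmod (vmean ya F x) <= 4 * PI * M.
Proof.
intros H HM. assert (P := PI_RGT_0).
destruct (ex_RInt_vertical F F1 x ya (ya + 2 * PI) H) as [A1 A2].
assert (IM : is_RInt (fun _ => M) ya (ya + 2 * PI) (2 * PI * M)).
{ replace (2 * PI * M) with (scal (ya + 2 * PI - ya) M) by (unfold scal; simpl; unfold mult; simpl; ring).
  apply (is_RInt_const (V := R_NormedModule)). }
assert (B1 : Rabs (RInt (fun y => Re (F (x, y))) ya (ya + 2 * PI)) <= 2 * PI * M).
{ apply (norm_RInt_le (V := R_NormedModule) (fun y => Re (F (x, y))) (fun _ => M) ya (ya + 2 * PI)); [lra| | |exact IM].
  - intros y Hy. eapply Rle_trans; [apply re_le_Cmod|apply HM; auto].
  - apply (RInt_correct (V := R_CompleteNormedModule)); auto. }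
assert (B2 : Rabs (RInt (fun y => Im (F (x, y))) ya (ya + 2 * PI)) <= 2 * PI * M).
{ apply (norm_RInt_le (V := R_NormedModule) (fun y => Im (F (x, y))) (fun _ => M) ya (ya + 2 * PI)); [lra| | |exact IM].
  - intros y Hy. eapply Rle_trans; [apply im_le_Cmod|apply HM; auto].
  - apply (RInt_correct (V := R_CompleteNormedModule)); auto. }
eapply Rle_trans; [apply Cmod_pair_le|]. lra.
Qed.

Lemma vmean_const (ya : R) (c : C) (x : R) : vmean ya (fun _ => c) x = (2 * PI * c)%C.
Proof.
unfold vmean. rewrite !(RInt_const (V := R_CompleteNormedModule)).
unfold scal; simpl; unfold mult; simpl. destruct c as [a b]. apply C_eq; unfold Re, Im; simpl; ring.
Qed.

(** An existential, so that integrals of combinations can be split without writing out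
    derivatives. *)
Definition smooth (F : C -> C) : Prop := exists F1, entire F F1.

Lemma smooth_plus (F G : C -> C) : smooth F -> smooth G -> smooth (fun z => F z + G z)%C.
Proof. intros [F1 HF] [G1 HG]. eexists. intros z. apply CD_plus; [apply HF|apply HG]. Qed.

Lemma smooth_mult (F G : C -> C) : smooth F -> smooth G -> smooth (fun z => F z * G z)%C.
Proof.
intros [F1 HF] [G1 HG]. exists (fun z => F1 z * G z + F z * G1 z)%C. intros z.
apply CD_mult; [apply HF|apply HG].
Qed.

Lemma smooth_scal (c : C) (F : C -> C) : smooth F -> smooth (fun z => c * F z)%C.
Proof. intros H. apply smooth_mult; auto. exists (fun _ => RtoC 0). intros z; apply CD_const. Qed.

Lemma vmean_plus_smooth (ya : R) (F G : C -> C) (x : R) : smooth F -> smooth G ->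
  vmean ya (fun z => F z + G z)%C x = (vmean ya F x + vmean ya G x)%C.
Proof. intros [F1 HF] [G1 HG]. apply (vmean_plus ya F F1 G G1); auto. Qed.

Lemma vmean_scal_smooth (ya : R) (c : C) (F : C -> C) (x : R) : smooth F ->
  vmean ya (fun z => c * F z)%C x = (c * vmean ya F x)%C.
Proof. intros [F1 HF]. apply (vmean_scal ya c F F1); auto. Qed.

Definition mode (n : Z) (z : C) : C := Cexp (- (n * z)).

Lemma CD_mode (n : Z) (z : C) : CD (mode n) z (- n * mode n z)%C.
Proof.
unfold mode. apply (CD_Cexp_comp (fun w => - (n * w))%C). eapply CD_ext_l.
- apply (CD_opp (fun w => n * w)%C). apply (CD_mult (fun _ => n : C) (fun w => w)); [apply CD_const|apply CD_id].
- cbv beta. ring.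
Qed.

Lemma smooth_mode (n : Z) : smooth (mode n).
Proof. eexists. intros z. apply CD_mode. Qed.

Lemma ZtoC_minus (n k : Z) : ZtoC (n - k) = (n - k)%C.
Proof. unfold ZtoC. rewrite minus_IZR, RtoC_minus. reflexivity. Qed.

Lemma ZtoC_plus (n k : Z) : ZtoC (n + k) = (n + k)%C.
Proof. unfold ZtoC. rewrite plus_IZR, RtoC_plus. reflexivity. Qed.

Lemma ZtoC_opp (n : Z) : ZtoC (- n) = (- n)%C.
Proof. unfold ZtoC. rewrite opp_IZR, RtoC_opp. reflexivity. Qed.

Lemma mode_shift (k n : Z) (z : C) : (Cexp (k * z) * mode n z)%C = mode (n - k) z.
Proof. unfold mode. rewrite <- Cexp_plus, ZtoC_minus. f_equal. ring. Qed.

Lemma mode_periodic (n : Z) : periodic (mode n).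
Proof.
intros z. unfold mode.
replace (- (n * (z + period)))%C with ((- n)%Z * (z + period))%C by (rewrite ZtoC_opp; ring).
rewrite Cexp_Z_shift. f_equal. rewrite ZtoC_opp; ring.
Qed.

Lemma Cmod_mode (n : Z) (x y : R) : Cmod (mode n (x, y)) = exp (- (IZR n * x)).
Proof. unfold mode. rewrite Cmod_Cexp. f_equal. unfold ZtoC; simpl. ring. Qed.

(** For periodic entire H this is 2 PI times the coefficient of exp(n z) in the Laurent expansion of
    H in powers of exp z, whatever x is. *)
Definition fcoef (ya : R) (H : C -> C) (n : Z) (x : R) : C := vmean ya (fun z => H z * mode n z)%C x.

Section Fcoef.
Context (ya : R).

(** Integration by parts: the derivative of [H * mode n] has vertical mean 0. *)
Lemma fcoef_derivative (H H1 H2 : C -> C) (n : Z) (x : R) : entire H H1 -> entire H1 H2 -> periodic H ->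
  fcoef ya H1 n x = (n * fcoef ya H n x)%C.
Proof.
intros E1 E2 Hp.
assert (S0 : smooth H) by (exists H1; auto). assert (S1 : smooth H1) by (exists H2; auto).
assert (SF := smooth_plus _ _ (smooth_mult _ _ S1 (smooth_mode n))
  (smooth_scal (- n) _ (smooth_mult _ _ S0 (smooth_mode n)))).
assert (Z : vmean ya (fun z => H1 z * mode n z + (- n) * (H z * mode n z))%C x = 0).
{ destruct SF as [F2 HF2].
  apply (vmean_derivative ya (fun z => H z * mode n z)%C _ F2); auto.
  - intros z. eapply CD_ext_l; [apply CD_mult; [apply E1|apply CD_mode]|]. cbv beta. ring.
  - intros z. rewrite Hp, mode_periodic. reflexivity. }
assert (P1 := smooth_mult _ _ S1 (smooth_mode n)). assert (P0 := smooth_mult _ _ S0 (smooth_mode n)).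
rewrite (vmean_plus_smooth ya _ _ x P1 (smooth_scal _ _ P0)), (vmean_scal_smooth ya _ _ x P0) in Z.
unfold fcoef.
replace (vmean ya (fun z => H1 z * mode n z)%C x) with
  ((vmean ya (fun z => H1 z * mode n z)%C x + - n * vmean ya (fun z => H z * mode n z)%C x)
   + n * vmean ya (fun z => H z * mode n z)%C x)%C by ring.
rewrite Z. ring.
Qed.

Lemma fcoef_constant (H H1 H2 : C -> C) (n : Z) (x x' : R) : entire H H1 -> entire H1 H2 -> periodic H ->
  fcoef ya H n x = fcoef ya H n x'.
Proof.
intros E1 E2 Hp.
assert (S0 : smooth H) by (exists H1; auto). assert (S1 : smooth H1) by (exists H2; auto).
assert (SF := smooth_plus _ _ (smooth_mult _ _ S1 (smooth_mode n))
  (smooth_scal (- n) _ (smooth_mult _ _ S0 (smooth_mode n)))).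
destruct SF as [F2 HF2].
apply (vmean_constant ya (fun z => H z * mode n z)%C (fun z => H1 z * mode n z + (- n) * (H z * mode n z))%C F2); auto.
- intros z. eapply CD_ext_l; [apply CD_mult; [apply E1|apply CD_mode]|]. cbv beta. ring.
- intros z. rewrite Hp, mode_periodic. reflexivity.
Qed.

(** As the coefficient does not depend on x, the factor exp(-n x) lets growth bounds at either end
    of the real axis force it to vanish. *)
Lemma fcoef_bound (H : C -> C) (n : Z) (x M : R) : smooth H ->
  (forall y, ya <= y <= ya + 2 * PI -> Cmod (H (x, y)) <= M) ->
  Cmod (fcoef ya H n x) <= 4 * PI * (M * exp (- (IZR n * x))).
Proof.
intros SH HM. destruct (smooth_mult _ _ SH (smooth_mode n)) as [F1 HF].
apply (vmean_bound ya _ F1 x _ HF). intros y Hy.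
rewrite Cmod_mult, Cmod_mode. apply Rmult_le_compat_r; [left; apply exp_pos|auto].
Qed.
End Fcoef.

(** * Finite sums and Laurent polynomials in exp z *)

Definition csum (u : nat -> C) (n : nat) : C := fold_right Cplus 0 (map u (seq 0 n)).

Lemma fold_right_Cplus (l : list C) (c : C) : fold_right Cplus c l = (fold_right Cplus 0 l + c)%C.
Proof. induction l as [|x l IH]; simpl; [ring|rewrite IH; ring]. Qed.

Lemma csum_S (u : nat -> C) (n : nat) : csum u (S n) = (csum u n + u n)%C.
Proof. unfold csum. rewrite seq_S, map_app, fold_right_app, fold_right_Cplus. simpl. ring. Qed.

Lemma csum_S_l (u : nat -> C) (n : nat) : csum u (S n) = (u O + csum (fun j => u (S j)) n)%C.
Proof.
induction n as [|n IH]; [unfold csum; simpl; ring|]. rewrite csum_S, IH, csum_S. ring.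
Qed.

Lemma csum_ext (u v : nat -> C) (n : nat) : (forall j, (j < n)%nat -> u j = v j) -> csum u n = csum v n.
Proof.
induction n as [|n IH]; intros H; [reflexivity|].
rewrite !csum_S, IH, H; auto.
Qed.

Lemma csum_plus (u v : nat -> C) (n : nat) : (csum u n + csum v n)%C = csum (fun j => u j + v j)%C n.
Proof. induction n as [|n IH]; [unfold csum; simpl; ring|]. rewrite !csum_S, <- IH. ring. Qed.

Lemma csum_scal (c : C) (u : nat -> C) (n : nat) : (c * csum u n)%C = csum (fun j => c * u j)%C n.
Proof. induction n as [|n IH]; [unfold csum; simpl; ring|]. rewrite !csum_S, <- IH. ring. Qed.

Lemma csum_zero (u : nat -> C) (n : nat) : (forall j, (j < n)%nat -> u j = 0) -> csum u n = 0.
Proof.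
induction n as [|n IH]; intros H; [reflexivity|]. rewrite csum_S, IH, H; auto. ring.
Qed.

Lemma csum_single (u : nat -> C) (n j0 : nat) : (j0 < n)%nat ->
  (forall j, j <> j0 -> u j = 0) -> csum u n = u j0.
Proof.
intros Hj H. induction n as [|n IH]; [lia|]. rewrite csum_S.
destruct (Nat.eq_dec j0 n) as [-> |Hne].
- rewrite csum_zero by (intros j Hj'; apply H; lia). ring.
- rewrite IH, (H n) by lia. ring.
Qed.

(** Both sides add up v over the indices -1, ..., n - 1. *)
Lemma csum_pred (v : Z -> C) (n : nat) :
  (csum (fun j => v (Z.of_nat j - 1)%Z) n + v (Z.of_nat n - 1)%Z)%C =
  (csum (fun j => v (Z.of_nat j)) n + v (-1)%Z)%C.
Proof.
induction n as [|n IH]; [reflexivity|]. rewrite !csum_S.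
rewrite IH. replace (Z.of_nat (S n) - 1)%Z with (Z.of_nat n) by lia. ring.
Qed.

Lemma CD_csum (u u1 : nat -> C -> C) (n : nat) (z : C) : (forall j, CD (u j) z (u1 j z)) ->
  CD (fun z => csum (fun j => u j z) n) z (csum (fun j => u1 j z) n).
Proof.
intros H. induction n as [|n IH].
- unfold csum; simpl. apply CD_const.
- rewrite csum_S. apply (CD_ext (fun z => csum (fun j => u j z) n + u n z)%C).
  + intros w. rewrite csum_S. reflexivity.
  + apply CD_plus; auto.
Qed.

Lemma csum_bound (u : nat -> R -> C) (E : R -> R) (n : nat) :
  (forall j, exists B, forall x, 0 <= x -> Cmod (u j x) <= B * E x) ->
  exists B, forall x, 0 <= x -> Cmod (csum (fun j => u j x) n) <= B * E x.
Proof.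
intros H. induction n as [|n [B HB]].
- exists 0. intros x _. unfold csum; simpl. rewrite Cmod_0. lra.
- destruct (H n) as [B' HB']. exists (B + B'). intros x Hx. rewrite csum_S.
  eapply Rle_trans; [apply Cmod_triangle|]. specialize (HB x Hx). specialize (HB' x Hx). lra.
Qed.

(* Laurent polynomial in [Cexp z] with exponents [w0, ..., w0 + n - 1]. *)
Definition laurent (w0 : Z) (n : nat) (c : Z -> C) (z : C) : C :=
  csum (fun j => c (w0 + Z.of_nat j)%Z * Cexp ((w0 + Z.of_nat j)%Z * z))%C n.

Lemma CD_Cexp_Z (n : Z) (z : C) : CD (fun z => Cexp (n * z)) z (n * Cexp (n * z))%C.
Proof. apply CD_Cexp_lin. Qed.

Lemma CD_laurent (w0 : Z) (n : nat) (c : Z -> C) (z : C) :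
  CD (laurent w0 n c) z (laurent w0 n (fun k => k * c k)%C z).
Proof.
unfold laurent. apply (CD_csum (fun j z => c (w0 + Z.of_nat j)%Z * Cexp ((w0 + Z.of_nat j)%Z * z))%C
  (fun j z => (w0 + Z.of_nat j)%Z * c (w0 + Z.of_nat j)%Z * Cexp ((w0 + Z.of_nat j)%Z * z))%C).
intros j. eapply CD_ext_l; [apply CD_mult; [apply CD_const|apply CD_Cexp_Z]|]. cbv beta. ring.
Qed.

Lemma laurent_ext (w0 : Z) (n : nat) (c d : Z -> C) (z : C) : (forall k, c k = d k) ->
  laurent w0 n c z = laurent w0 n d z.
Proof. intros H. apply csum_ext. intros j _. rewrite H. reflexivity. Qed.

Lemma laurent_plus (w0 : Z) (n : nat) (c d : Z -> C) (z : C) :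
  (laurent w0 n c z + laurent w0 n d z)%C = laurent w0 n (fun k => c k + d k)%C z.
Proof. unfold laurent. rewrite csum_plus. apply csum_ext. intros j _. ring. Qed.

Lemma laurent_scal (w0 : Z) (n : nat) (b : C) (c : Z -> C) (z : C) :
  (b * laurent w0 n c z)%C = laurent w0 n (fun k => b * c k)%C z.
Proof. unfold laurent. rewrite csum_scal. apply csum_ext. intros j _. ring. Qed.

Lemma laurent_zero (w0 : Z) (n : nat) (c : Z -> C) (z : C) : (forall k, c k = 0) -> laurent w0 n c z = 0.
Proof. intros H. apply csum_zero. intros j _. rewrite H. ring. Qed.

(** The window of exponents stays fixed while the coefficients move up by one: the coefficient below
    the window would enter, the top one would leave. *)
Lemma laurent_shift (w0 : Z) (n : nat) (c : Z -> C) (z : C) :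
  c (w0 - 1)%Z = 0 -> c (w0 + Z.of_nat n - 1)%Z = 0 ->
  (Cexp z * laurent w0 n c z)%C = laurent w0 n (fun k => c (k - 1)%Z) z.
Proof.
intros H0 H1. unfold laurent. rewrite csum_scal.
set (v := fun k : Z => (Cexp z * (c (w0 + k)%Z * Cexp ((w0 + k)%Z * z)))%C).
assert (P := csum_pred v n).
assert (V0 : v (-1)%Z = 0).
{ unfold v. replace (w0 + -1)%Z with (w0 - 1)%Z by lia. rewrite H0. ring. }
assert (V1 : v (Z.of_nat n - 1)%Z = 0).
{ unfold v. replace (w0 + (Z.of_nat n - 1))%Z with (w0 + Z.of_nat n - 1)%Z by lia. rewrite H1. ring. }
rewrite V0, V1, !Cplus_0_r in P.
transitivity (csum (fun j => v (Z.of_nat j)) n); [reflexivity|]. rewrite <- P.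
apply csum_ext. intros j _. unfold v.
replace (w0 + Z.of_nat j - 1)%Z with (w0 + (Z.of_nat j - 1))%Z by lia.
replace (Cexp ((w0 + Z.of_nat j)%Z * z)) with (Cexp z * Cexp ((w0 + (Z.of_nat j - 1))%Z * z))%C; [ring|].
rewrite <- Cexp_plus. f_equal. rewrite !ZtoC_plus, ZtoC_minus. change (ZtoC 1) with (RtoC 1). ring.
Qed.

Lemma laurent_decay (w0 : Z) (n : nat) (c : Z -> C) (y : R) : (forall k, (0 <= k)%Z -> c k = 0) ->
  exists B, forall x, 0 <= x -> Cmod (laurent w0 n c (x, y)) <= B * exp (- x).
Proof.
intros H. apply (csum_bound (fun j x => c (w0 + Z.of_nat j)%Z * Cexp ((w0 + Z.of_nat j)%Z * (x, y)))%C (fun x => exp (- x))).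
intros j. set (k := (w0 + Z.of_nat j)%Z). exists (Cmod (c k)). intros x Hx.
destruct (Z_le_gt_dec 0 k) as [L|L].
- rewrite H by auto. rewrite Cmult_0_l, Cmod_0. lra.
- rewrite Cmod_mult, Cmod_Cexp. apply Rmult_le_compat_l; [apply Cmod_ge_0|].
  apply exp_le. replace (Re (k * (x, y))%C) with (IZR k * x) by (unfold ZtoC; simpl; ring).
  assert (IZR k <= -1) by (apply IZR_le; lia). nra.
Qed.

Lemma laurent_constant (w0 : Z) (n : nat) (c : Z -> C) (z : C) :
  (w0 <= 0 < w0 + Z.of_nat n)%Z -> (forall k, k <> 0%Z -> c k = 0) -> laurent w0 n c z = c 0%Z.
Proof.
intros Hw H. unfold laurent. rewrite (csum_single _ n (Z.to_nat (- w0))).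
- replace (w0 + Z.of_nat (Z.to_nat (- w0)))%Z with 0%Z by lia.
  unfold ZtoC. rewrite Cmult_0_l, Cexp_0. ring.
- lia.
- intros j Hj. rewrite H by lia. ring.
Qed.

Lemma lowest_index (a : Z -> C) (N : nat) : a 0%Z <> 0 -> (forall n, (n < - Z.of_nat N)%Z -> a n = 0) ->
  exists k : nat, a (- Z.of_nat k)%Z <> 0 /\ forall n, (n < - Z.of_nat k)%Z -> a n = 0.
Proof.
intros H0 HN. induction N as [|N IH].
- exists O. split; auto.
- destruct (classic (a (- Z.of_nat (S N))%Z = 0)) as [E|E].
  + apply IH. intros n Hn. destruct (Z.eq_dec n (- Z.of_nat (S N))) as [-> |Hne]; auto.
    apply HN. lia.
  + exists (S N). split; auto.
Qed.

(** * Asymptotics of the coefficients *)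

Section Wkb.
Context (D : wkb).
Let m := wm D.
Let c1 := wc D.
Let g := wg D.

Definition slope (s : bool) (z : C) : C := (sgn s * (Cexp (m * z) + c1 * Cexp z) + g s)%C.
Definition phase (s : bool) (z : C) : C :=
  (sgn s * (Cexp (m * z) / m + c1 * Cexp z) + g s * z)%C.
Definition defect (s : bool) (z : C) : C := (we1 D s * Cexp z + we0 D s)%C.
Definition gap (s : bool) (z : C) : C := (slope (negb s) z - slope s z)%C.
Definition ratio (s : bool) (z : C) : C := Cexp (phase s z - phase (negb s) z).
Definition solves (f f1 : C -> C) : Prop :=
  forall z, CD f z (f1 z) /\ CD f1 z (wA D z * f z)%C.
(* The coefficient of [Cexp (phase s)] when [f] and [f1] are written in the basis
   [Cexp (phase true)], [Cexp (phase false)] and its formal derivative. *)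
Definition coef (s : bool) (f f1 : C -> C) (z : C) : C :=
  ((slope (negb s) z * f z - f1 z) / gap s z * Cexp (- phase s z))%C.

Lemma wm_pos : 1 <= m <= 2.
Proof. unfold m; destruct (wm_cases D) as [-> | ->]; lra. Qed.

Lemma wm_neq_0 : RtoC m <> 0.
Proof. intros E; apply RtoC_inj in E. assert (H := wm_pos); lra. Qed.

Lemma CD_slope (s : bool) (z : C) :
  CD (slope s) z (sgn s * (m * Cexp (m * z) + c1 * Cexp z))%C.
Proof.
unfold slope. eapply CD_ext_l.
- apply CD_plus; [apply CD_mult; [apply CD_const|]|apply CD_const].
  apply CD_plus; [apply CD_Cexp_lin|apply CD_mult; [apply CD_const|apply CD_Cexp]].
- cbv beta. ring.
Qed.

Lemma CD_phase (s : bool) (z : C) : CD (phase s) z (slope s z).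
Proof.
unfold phase, slope. assert (Hm := wm_neq_0). eapply CD_ext_l.
- apply CD_plus; [apply CD_mult; [apply CD_const|]|apply CD_mult; [apply CD_const|apply CD_id]].
  apply CD_plus; [apply CD_mult; [apply CD_Cexp_lin|apply CD_const]|apply CD_mult; [apply CD_const|apply CD_Cexp]].
- cbv beta. field. auto.
Qed.

Lemma gap_negb (s : bool) (z : C) : gap (negb s) z = (- gap s z)%C.
Proof. unfold gap. rewrite Bool.negb_involutive. ring. Qed.

Lemma ratio_negb (s : bool) (z : C) : ratio (negb s) z = (/ ratio s z)%C.
Proof. unfold ratio. rewrite <- Cexp_opp, Bool.negb_involutive. f_equal; ring. Qed.

Lemma coef_decomp (s : bool) (f f1 : C -> C) (z : C) : gap s z <> 0 ->
  f z = (coef s f f1 z * Cexp (phase s z) + coef (negb s) f f1 z * Cexp (phase (negb s) z))%C.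
Proof.
intros H. unfold coef. rewrite gap_negb, Bool.negb_involutive, !Cexp_opp.
unfold gap in *. field. repeat split; auto using Cexp_neq_0.
Qed.

Lemma coef_decomp_1 (s : bool) (f f1 : C -> C) (z : C) : gap s z <> 0 ->
  f1 z = (coef s f f1 z * slope s z * Cexp (phase s z)
   + coef (negb s) f f1 z * slope (negb s) z * Cexp (phase (negb s) z))%C.
Proof.
intros H. unfold coef. rewrite gap_negb, Bool.negb_involutive, !Cexp_opp.
unfold gap in *. field. repeat split; auto using Cexp_neq_0.
Qed.

Lemma coef_reduced (s : bool) (f f1 : C -> C) (z : C) : gap s z <> 0 ->
  (f z * Cexp (- phase (negb s) z))%C = (coef s f f1 z * ratio s z + coef (negb s) f f1 z)%C.
Proof.
intros H. rewrite (coef_decomp s f f1 z H) at 1. unfold ratio.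
rewrite Cexp_minus, Cexp_opp. field. apply Cexp_neq_0.
Qed.

(** Variation of constants. The Riccati relation replaces slope' + slope^2 by [wA] plus the defect
    for either sign; with f'' = wA f everything cancels except the terms that carry a defect. *)
Lemma CD_coef (s : bool) (f f1 : C -> C) (z : C) : solves f f1 -> gap s z <> 0 ->
  CD (coef s f f1) z
    ((defect s z * coef s f f1 z + defect (negb s) z * coef (negb s) f f1 z / ratio s z) / gap s z)%C.
Proof.
intros Hs Hg. destruct (Hs z) as [H1 H2].
assert (R1 := w_riccati D s z). assert (R2 := w_riccati D (negb s) z).
fold m c1 g in R1, R2.
unfold coef at 1. eapply CD_ext_l.
- apply CD_mult; [apply CD_mult|].
  + apply CD_minus; [apply CD_mult; [apply CD_slope|exact H1]|exact H2].
  + apply (CD_comp Cinv (gap s)); [apply CD_inv; exact Hg|].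
    apply CD_minus; apply CD_slope.
  + apply CD_Cexp_comp. apply CD_opp. apply CD_phase.
- cbv beta.
  set (d := (sgn s * (m * Cexp (m * z) + c1 * Cexp z))%C) in *.
  set (d' := (sgn (negb s) * (m * Cexp (m * z) + c1 * Cexp z))%C) in *.
  fold (slope s z) in R1. fold (slope (negb s) z) in R2.
  fold (defect s z) in R1. fold (defect (negb s) z) in R2.
  assert (E1 : d = (wA D z + defect s z - slope s z * slope s z)%C) by (rewrite <- R1; ring).
  assert (E2 : d' = (wA D z + defect (negb s) z - slope (negb s) z * slope (negb s) z)%C) by (rewrite <- R2; ring).
  clearbody d d'. rewrite E1, E2.
  unfold coef, ratio. rewrite gap_negb, Bool.negb_involutive, Cexp_minus, !Cexp_opp.
  unfold gap in *.
  assert (N1 := Cexp_neq_0 (phase s z)). assert (N2 := Cexp_neq_0 (phase (negb s) z)).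
  field. repeat split; auto.
Qed.

(* For [bulk <= Re z] the leading term of [gap] dominates the others. *)
Definition bulk : R := 2 * Cmod c1 + Cmod (g true - g false) + 1.

Lemma bulk_ge_1 : 1 <= bulk.
Proof. unfold bulk. assert (H := Cmod_ge_0 c1). assert (H2 := Cmod_ge_0 (g true - g false)). lra. Qed.

Lemma Cmod_g (s : bool) : Cmod (g (negb s) - g s) = Cmod (g true - g false).
Proof.
destruct s; simpl; auto.
rewrite <- Cmod_opp. f_equal; ring.
Qed.

Lemma subleading_bound (c : C) (x : R) : c = 0 \/ m = 2 -> 0 <= x ->
  Cmod c * exp x <= Cmod c * exp ((m - 1) * x).
Proof.
intros [-> | E] Hx.
- rewrite Cmod_0; lra.
- rewrite E. replace ((2 - 1) * x) with x by ring. lra.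
Qed.

Lemma gap_ge (s : bool) (z : C) : bulk <= Re z -> exp (m * Re z) <= Cmod (gap s z).
Proof.
intros Hz. assert (Hb := bulk_ge_1).
set (x := Re z) in *.
assert (E : gap s z = (- (2 * sgn s * Cexp (m * z)) - (2 * sgn s * (c1 * Cexp z) - (g (negb s) - g s)))%C).
{ unfold gap, slope. rewrite sgn_negb, RtoC_opp. ring. }
rewrite E. eapply Rle_trans; [|apply Cmod_triangle_rev].
rewrite Cmod_opp, !Cmod_mult, !Cmod_R, Rabs_sgn, (Rabs_pos_eq 2), Cmod_Cexp, Re_RtoC_mult by lra.
fold x.
assert (T := Cmod_triangle (2 * sgn s * (c1 * Cexp z)) (- (g (negb s) - g s))).
rewrite Cmod_opp, !Cmod_mult, !Cmod_R, Rabs_sgn, (Rabs_pos_eq 2), Cmod_Cexp, Cmod_g in T by lra.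
fold x in T.
assert (S := subleading_bound c1 x (wc_cases D) ltac:(lra)).
assert (P : exp (m * x) = exp ((m - 1) * x) * exp x) by (rewrite <- exp_plus; f_equal; ring).
assert (P1 : 1 <= exp ((m - 1) * x)) by (apply exp_ge_1; assert (H := wm_pos); nra).
assert (P2 : bulk <= exp x) by (eapply Rle_trans; [exact Hz|apply exp_ge_id]).
assert (H3 := Cmod_ge_0 c1). assert (H4 := Cmod_ge_0 (g true - g false)).
assert (exp ((m - 1) * x) * bulk <= exp (m * x)) by (rewrite P; apply Rmult_le_compat_l; lra).
assert (H5 : Cmod (g true - g false) <= exp ((m - 1) * x) * Cmod (g true - g false)) by nra.
unfold bulk in H. unfold Cminus in T, H, H5 |- *. lra.
Qed.

Lemma gap_neq_0 (s : bool) (z : C) : bulk <= Re z -> gap s z <> 0.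
Proof.
intros H; apply Cmod_gt_0. eapply Rlt_le_trans; [|apply gap_ge; auto]. apply exp_pos.
Qed.

Definition rate : R := Cmod (we1 D true) + Cmod (we0 D true) + Cmod (we1 D false) + Cmod (we0 D false) + 1.

Lemma rate_ge_1 : 1 <= rate.
Proof.
unfold rate. assert (H1 := Cmod_ge_0 (we1 D true)). assert (H2 := Cmod_ge_0 (we0 D true)).
assert (H3 := Cmod_ge_0 (we1 D false)). assert (H4 := Cmod_ge_0 (we0 D false)). lra.
Qed.

(** The defect is at most [rate] times exp((m-1)x), since its term in exp z is absent when m = 1,
    and the gap is at least exp(m x). *)
Lemma defect_le (s s' : bool) (z : C) : bulk <= Re z ->
  Cmod (defect s z) / Cmod (gap s' z) <= rate * exp (- Re z).
Proof.
intros Hz. assert (Hb := bulk_ge_1). assert (G := gap_ge s' z Hz).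
set (x := Re z) in *.
assert (P : exp (m * x) = exp ((m - 1) * x) * exp x) by (rewrite <- exp_plus; f_equal; ring).
assert (P1 : 1 <= exp ((m - 1) * x)) by (apply exp_ge_1; assert (H := wm_pos); nra).
assert (Px := exp_pos x).
assert (Q : Cmod (defect s z) <= rate * exp ((m - 1) * x)).
{ unfold defect. eapply Rle_trans; [apply Cmod_triangle|]. rewrite Cmod_mult, Cmod_Cexp. fold x.
  assert (S := subleading_bound (we1 D s) x (we1_cases D s) ltac:(lra)).
  unfold rate. assert (H1 := Cmod_ge_0 (we1 D true)). assert (H2 := Cmod_ge_0 (we0 D true)).
  assert (H3 := Cmod_ge_0 (we1 D false)). assert (H4 := Cmod_ge_0 (we0 D false)).
  destruct s; nra. }
rewrite exp_Ropp. assert (Hp : 0 < exp (m * x)) by apply exp_pos.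
apply Rmult_le_reg_r with (Cmod (gap s' z)); [lra|].
unfold Rdiv; rewrite Rmult_assoc, Rinv_l, Rmult_1_r by lra.
eapply Rle_trans; [exact Q|].
apply Rle_trans with (rate * / exp x * exp (m * x)).
- right; rewrite P; field; lra.
- apply Rmult_le_compat_l; auto. apply Rmult_le_pos; [assert (R := rate_ge_1); lra|].
  left; apply Rinv_0_lt_compat; auto.
Qed.

Lemma ratio_neq_0 (s : bool) (z : C) : ratio s z <> 0.
Proof. apply Cexp_neq_0. Qed.

Lemma ratio_pos (s : bool) (z : C) : 0 < Cmod (ratio s z).
Proof. apply Cmod_gt_0, ratio_neq_0. Qed.

Definition coef_der (s : bool) (f f1 : C -> C) (z : C) : C :=
  ((defect s z * coef s f f1 z + defect (negb s) z * coef (negb s) f f1 z / ratio s z) / gap s z)%C.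

Lemma coef_der_le (s : bool) (f f1 : C -> C) (z : C) : bulk <= Re z ->
  Cmod (coef_der s f f1 z) <=
  rate * exp (- Re z) * (Cmod (coef s f f1 z) + Cmod (coef (negb s) f f1 z) / Cmod (ratio s z)).
Proof.
intros Hz. assert (G := gap_neq_0 s z Hz). assert (R := ratio_neq_0 s z).
assert (Rp := ratio_pos s z).
unfold coef_der. rewrite Cmod_div by auto.
set (u := coef s f f1 z). set (v := coef (negb s) f f1 z).
apply Rle_trans with ((Cmod (defect s z) * Cmod u + Cmod (defect (negb s) z) * Cmod v / Cmod (ratio s z)) / Cmod (gap s z)).
- apply Rmult_le_compat_r.
  + left; apply Rinv_0_lt_compat, Cmod_gt_0; auto.
  + eapply Rle_trans; [apply Cmod_triangle|]. rewrite Cmod_div, !Cmod_mult by auto. lra.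
- assert (E1 := defect_le s s z Hz). assert (E2 := defect_le (negb s) s z Hz).
  assert (Gp : 0 < Cmod (gap s z)) by (apply Cmod_gt_0; auto).
  replace ((Cmod (defect s z) * Cmod u + Cmod (defect (negb s) z) * Cmod v / Cmod (ratio s z)) / Cmod (gap s z))
   with (Cmod (defect s z) / Cmod (gap s z) * Cmod u + Cmod (defect (negb s) z) / Cmod (gap s z) * (Cmod v / Cmod (ratio s z))) by (field; lra).
  rewrite Rmult_plus_distr_l. apply Rplus_le_compat; apply Rmult_le_compat_r; auto.
  + apply Cmod_ge_0.
  + apply Rmult_le_pos; [apply Cmod_ge_0|]. left; apply Rinv_0_lt_compat; auto.
Qed.

(** The path has to lead away from the dominance of sign s: [ratio s] may grow along it by at most
    the factor Q. The primitive N of the rate is an exponential on rays and linear on vertical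
    segments. *)
Lemma path_estimate (s : bool) (f f1 : C -> C) (z0 w : C) (N : R -> R) (u v Q K : R) :
  solves f f1 -> Cmod w = 1 -> u <= v -> 0 < K -> 1 <= Q ->
  (forall t, u <= t <= v -> bulk <= Re (z0 + t * w)%C) ->
  (forall a b, u <= a -> a <= b -> b <= v ->
     Cmod (ratio s (z0 + b * w)) <= Q * Cmod (ratio s (z0 + a * w))) ->
  (forall t, u <= t <= v -> is_derive N t (rate * exp (- Re (z0 + t * w)%C))) ->
  Q * (N v - N u) <= / 4 ->
  let M := 2 * (Cmod (coef s f f1 (z0 + u * w)) + Cmod (coef (negb s) f f1 (z0 + v * w)) / K) in
  forall t, u <= t <= v ->
    Cmod (coef s f f1 (z0 + t * w) - coef s f f1 (z0 + u * w)) <=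
      Q * (N v - N u) * M * Rmax 1 (K / Cmod (ratio s (z0 + t * w))) /\
    Cmod (coef (negb s) f f1 (z0 + t * w) - coef (negb s) f f1 (z0 + v * w)) <=
      Q * (N v - N u) * M * Rmax K (Cmod (ratio s (z0 + t * w))).
Proof.
intros Hs Hw Huv HK HQ Hx Hm HN HQN M.
assert (B := rate_ge_1).
apply (dichotomy_estimate
  (fun t => coef s f f1 (z0 + t * w)) (fun t => coef (negb s) f f1 (z0 + t * w))
  (fun t => w * coef_der s f f1 (z0 + t * w))%C (fun t => w * coef_der (negb s) f f1 (z0 + t * w))%C
  (fun t => Cmod (ratio s (z0 + t * w))) N (fun t => rate * exp (- Re (z0 + t * w)%C))); auto.
- intros; apply ratio_pos.
- intros t Ht. apply CD_path, CD_coef; auto. apply gap_neq_0; auto.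
- intros t Ht. apply CD_path, CD_coef; auto. apply gap_neq_0; auto.
- intros t Ht. apply Rmult_le_pos; [lra|left; apply exp_pos].
- intros t Ht. rewrite Cmod_mult, Hw, Rmult_1_l. apply coef_der_le; auto.
- intros t Ht. rewrite Cmod_mult, Hw, Rmult_1_l.
  eapply Rle_trans; [apply coef_der_le; auto|].
  rewrite Bool.negb_involutive, ratio_negb, Cmod_inv by apply ratio_neq_0.
  right. assert (P := ratio_pos s (z0 + t * w)). field. lra.
Qed.

(* The ray [Im z = y0] is the middle of a sector in which [Cexp (phase s)] dominates. *)
Definition center (s : bool) (y0 : R) : Prop := sgn s * cos (m * y0) = 1.

Definition log_ratio (s : bool) (z : C) : R := Re (phase s z - phase (negb s) z)%C.

Lemma ratio_exp (s : bool) (z : C) : Cmod (ratio s z) = exp (log_ratio s z).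
Proof. apply Cmod_Cexp. Qed.

Lemma log_ratio_eq (s : bool) (x y : R) :
  log_ratio s (x, y) = 2 * sgn s * (exp (m * x) * cos (m * y) / m + Re (c1 * Cexp (x, y))%C)
    + Re ((g s - g (negb s)) * (x, y))%C.
Proof.
unfold log_ratio. assert (Hm := wm_pos).
replace (phase s (x, y) - phase (negb s) (x, y))%C with
  (RtoC (2 * sgn s) * (Cexp (m * (x, y)) / m + c1 * Cexp (x, y)) + (g s - g (negb s)) * (x, y))%C.
- replace (Re _) with (Re (RtoC (2 * sgn s) * (Cexp (m * (x, y)) / m + c1 * Cexp (x, y)))%C + Re ((g s - g (negb s)) * (x, y))%C) by reflexivity.
  f_equal. rewrite Re_RtoC_mult. f_equal.
  replace (Re _) with (Re (Cexp (m * (x, y)) / m)%C + Re (c1 * Cexp (x, y))%C) by reflexivity.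
  f_equal. rewrite Re_div_R by lra. unfold Cexp. rewrite Re_RtoC_mult, Im_RtoC_mult. reflexivity.
- unfold phase. rewrite sgn_negb, RtoC_opp, RtoC_mult. ring.
Qed.

(** On a center ray the leading term contributes 2/m times the increase of exp(m x). For m = 1 there
    is no [c1] term; for m = 2 the increase of exp(2x) is that of exp x times exp x1 + exp x0 >= 2
    [bulk]. Either way it outweighs the [c1] and [g] terms with exp x1 - exp x0 to spare. *)
Lemma ray_log_ratio (s : bool) (y0 x0 x1 : R) : center s y0 -> bulk <= x0 -> x0 <= x1 ->
  exp x1 - exp x0 <= log_ratio s (x1, y0) - log_ratio s (x0, y0).
Proof.
intros Hc Hx0 Hx1. rewrite !log_ratio_eq.
set (d := x1 - x0). set (Y := exp x1 - exp x0).
assert (Hd : 0 <= d) by (unfold d; lra).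
assert (HX : bulk <= exp x0) by (eapply Rle_trans; [exact Hx0|apply exp_ge_id]).
assert (Hb := bulk_ge_1).
assert (HY : exp x0 * d <= Y).
{ unfold Y. replace x1 with (x0 + d) by (unfold d; ring). rewrite exp_plus.
  assert (I := exp_ineq1_le d). assert (P := exp_pos x0). nra. }
assert (HY0 : 0 <= Y) by (assert (P := exp_pos x0); nra).
assert (E1 : Rabs (Re (c1 * Cexp (x1, y0))%C - Re (c1 * Cexp (x0, y0))%C) <= Cmod c1 * Y).
{ rewrite <- Re_minus. eapply Rle_trans; [apply re_le_Cmod|].
  rewrite (Cexp_polar x1), (Cexp_polar x0).
  replace (c1 * (RtoC (exp x1) * Cexp (0, y0)) - c1 * (RtoC (exp x0) * Cexp (0, y0)))%C with
    (c1 * (RtoC Y * Cexp (0, y0)))%C by (unfold Y; rewrite RtoC_minus; ring).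
  rewrite !Cmod_mult, Cmod_R, Cmod_Cexp, Rabs_pos_eq by auto. simpl. rewrite exp_0. lra. }
assert (E2 : Rabs (Re ((g s - g (negb s)) * (x1, y0))%C - Re ((g s - g (negb s)) * (x0, y0))%C)
   <= Cmod (g true - g false) * d).
{ rewrite <- Re_minus. eapply Rle_trans; [apply re_le_Cmod|].
  replace ((g s - g (negb s)) * (x1, y0) - (g s - g (negb s)) * (x0, y0))%C with
   (- (g (negb s) - g s) * RtoC d)%C by (unfold d; apply C_eq; simpl; ring).
  rewrite Cmod_mult, Cmod_opp, Cmod_g, Cmod_R, Rabs_pos_eq by auto. lra. }
apply Rabs_le_between in E2.
assert (E1' : Rabs (2 * sgn s * (Re (c1 * Cexp (x1, y0))%C - Re (c1 * Cexp (x0, y0))%C)) <= 2 * (Cmod c1 * Y)).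
{ rewrite Rabs_mult, Rabs_mult, Rabs_sgn, (Rabs_pos_eq 2) by lra. lra. }
apply Rabs_le_between in E1'.
assert (Main : 2 * Cmod c1 * Y + Cmod (g true - g false) * d + Y <= 2 / m * (exp (m * x1) - exp (m * x0))).
{ unfold bulk in Hb, HX.
  assert (G0 := Cmod_ge_0 (g true - g false)). assert (C0 := Cmod_ge_0 c1).
  assert (Hdd : Cmod (g true - g false) * d <= Cmod (g true - g false) * Y).
  { apply Rmult_le_compat_l; auto. assert (1 <= exp x0) by lra. nra. }
  assert (H2 : (2 * Cmod c1 + Cmod (g true - g false) + 1) * d <= Y).
  { eapply Rle_trans; [|exact HY]. apply Rmult_le_compat_r; auto. }
  unfold m. destruct (wm_cases D) as [E|E]; rewrite E.
  - destruct (wc_cases D) as [F|F]; [|lra]. fold c1 in F. rewrite F, Cmod_0 in *.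
    rewrite !Rmult_1_l. fold Y. replace (2 / 1 * Y) with (2 * Y) by field. nra.
  - replace (2 / 2 * (exp (2 * x1) - exp (2 * x0))) with (Y * (exp x1 + exp x0)).
    2: { replace (2 * x1) with (x1 + x1) by ring. replace (2 * x0) with (x0 + x0) by ring.
         rewrite !exp_plus. unfold Y; field. }
    assert (exp x0 <= exp x1) by (unfold Y in HY0; lra).
    assert (Y * (2 * (2 * Cmod c1 + Cmod (g true - g false) + 1)) <= Y * (exp x1 + exp x0)) by (apply Rmult_le_compat_l; lra).
    nra. }
assert (Hm := wm_pos). red in Hc.
replace (2 * sgn s * (exp (m * x1) * cos (m * y0) / m + Re (c1 * Cexp (x1, y0))%C) +
  Re ((g s - g (negb s)) * (x1, y0))%C - (2 * sgn s * (exp (m * x0) * cos (m * y0) / m + Re (c1 * Cexp (x0, y0))%C) +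
  Re ((g s - g (negb s)) * (x0, y0))%C)) with
 (2 / m * (exp (m * x1) - exp (m * x0)) * (sgn s * cos (m * y0)) +
  2 * sgn s * (Re (c1 * Cexp (x1, y0))%C - Re (c1 * Cexp (x0, y0))%C) +
  (Re ((g s - g (negb s)) * (x1, y0))%C - Re ((g s - g (negb s)) * (x0, y0))%C)) by (field; lra).
rewrite Hc. lra.
Qed.

(* On vertical segments the term in [Cexp z] may destroy the monotonicity of [ratio], but
   completing the square in [cos] bounds the loss by a factor independent of [Re z]. *)
Definition vertical_const : R := exp ((bulk * exp 4) * (bulk * exp 4) * 18).

Lemma vertical_const_ge_1 : 1 <= vertical_const.
Proof. apply exp_ge_1. nra. Qed.

Lemma center_sin (s : bool) (y0 : R) : center s y0 -> sin (m * y0) = 0.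
Proof.
unfold center. intros H. assert (S := sin2_cos2 (m * y0)). unfold Rsqr in S.
destruct s; simpl in H; nra.
Qed.

Lemma vertical_log_ratio (s : bool) (y0 e x a b : R) : center s y0 ->
  e = 1 \/ e = -1 -> 0 <= x -> 0 <= a -> a <= b -> b <= PI / m ->
  log_ratio s (x, y0 + e * b) <= log_ratio s (x, y0 + e * a) + (bulk * exp 4) * (bulk * exp 4) * 18.
Proof.
intros Hc He Hx Ha Hab Hb. rewrite !log_ratio_eq.
set (ya := y0 + e * a). set (yb := y0 + e * b).
assert (Hm := wm_pos).
assert (Hcos : forall t, sgn s * cos (m * (y0 + e * t)) = cos (m * t)).
{ intros t. assert (S := center_sin _ _ Hc). red in Hc.
  replace (m * (y0 + e * t)) with (m * y0 + e * (m * t)) by ring.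
  rewrite cos_plus, S.
  replace (cos (e * (m * t))) with (cos (m * t)).
  - replace (sgn s * (cos (m * y0) * cos (m * t) - 0 * sin (e * (m * t)))) with (sgn s * cos (m * y0) * cos (m * t)) by ring.
    rewrite Hc; ring.
  - destruct He as [-> | ->]; [f_equal; ring|]. rewrite <- cos_neg. f_equal; ring. }
set (d := b - a). assert (Hd : 0 <= d) by (unfold d; lra).
assert (Hmb : m * b <= PI).
{ apply Rle_trans with (m * (PI / m)); [apply Rmult_le_compat_l; lra|right; field; lra]. }
assert (Hpi := PI_4).
assert (Hd4 : d <= 4) by (unfold d; nra).
assert (HC := cos_sub_ge (m * a) (m * b) ltac:(nra) ltac:(nra) Hmb).
assert (He1 : Rabs e = 1) by (destruct He as [-> | ->]; [apply Rabs_R1|rewrite Rabs_left; lra]).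
assert (E1 : Rabs (Re (c1 * Cexp (x, yb))%C - Re (c1 * Cexp (x, ya))%C) <= Cmod c1 * exp x * (d * exp 4)).
{ rewrite <- Re_minus. eapply Rle_trans; [apply re_le_Cmod|].
  replace (x, yb) with ((x, ya) + Ci * RtoC (e * d))%C by (unfold d, ya, yb; apply C_eq; simpl; ring).
  rewrite Cexp_plus.
  replace (c1 * (Cexp (x, ya) * Cexp (Ci * (e * d)%R)) - c1 * Cexp (x, ya))%C with
    (c1 * Cexp (x, ya) * (Cexp (RtoC 1 * (Ci * (e * d)%R)) - 1))%C by (rewrite Cmult_1_l; ring).
  rewrite !Cmod_mult, Cmod_Cexp. apply Rmult_le_compat_l.
  - apply Rmult_le_pos; [apply Cmod_ge_0|left; apply exp_pos].
  - eapply Rle_trans; [apply Cexp_sub_1; lra|].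
    rewrite Cmod_mult, Cmod_Ci, Cmod_R, Rabs_mult, He1, !Rmult_1_l, Rabs_pos_eq by auto.
    apply Rmult_le_compat_l; auto. apply exp_le; auto. }
assert (E2 : Rabs (Re ((g s - g (negb s)) * (x, yb))%C - Re ((g s - g (negb s)) * (x, ya))%C)
   <= Cmod (g true - g false) * d).
{ rewrite <- Re_minus. eapply Rle_trans; [apply re_le_Cmod|].
  replace ((g s - g (negb s)) * (x, yb) - (g s - g (negb s)) * (x, ya))%C with
   (- (g (negb s) - g s) * (Ci * RtoC (e * d)))%C by (unfold d, ya, yb; apply C_eq; simpl; ring).
  rewrite Cmod_mult, Cmod_opp, Cmod_g, Cmod_mult, Cmod_Ci, Cmod_R, Rabs_mult, He1, (Rabs_pos_eq d) by auto. lra. }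
apply Rabs_le_between in E2.
assert (E1' : Rabs (2 * sgn s * (Re (c1 * Cexp (x, yb))%C - Re (c1 * Cexp (x, ya))%C)) <= 2 * (Cmod c1 * exp x * (d * exp 4))).
{ rewrite Rabs_mult, Rabs_mult, Rabs_sgn, (Rabs_pos_eq 2) by lra. lra. }
apply Rabs_le_between in E1'.
(* P^2 <= exp(m x) because m <= 2. So with T = P d, d being the length of the segment, the leading
   term drops by at least T^2 / 18 while the others gain at most a constant times T. *)
set (P := exp ((m - 1) * x)).
assert (P1 : 1 <= P) by (apply exp_ge_1; nra).
assert (PP : P * P <= exp (m * x)).
{ unfold P. rewrite <- exp_plus. apply exp_le. nra. }
assert (S := subleading_bound c1 x (wc_cases D) Hx). fold m P in S.
assert (X4 : 1 <= exp 4) by (apply exp_ge_1; lra).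
assert (Main : 2 * (Cmod c1 * exp x * (d * exp 4)) + Cmod (g true - g false) * d
   <= (bulk * exp 4) * (P * d)).
{ unfold bulk.
  assert (G0 := Cmod_ge_0 (g true - g false)). assert (C0 := Cmod_ge_0 c1).
  assert (Q0 : 0 <= d * exp 4) by nra.
  assert (Q1 : Cmod c1 * exp x * (d * exp 4) <= Cmod c1 * P * (d * exp 4)) by (apply Rmult_le_compat_r; auto).
  assert (Q2 : 1 <= exp 4 * P) by (apply Rle_trans with (1 * 1); [lra|apply Rmult_le_compat; lra]).
  assert (Q3 : 0 <= Cmod (g true - g false) * d) by (apply Rmult_le_pos; auto).
  assert (Q4 : Cmod (g true - g false) * d * 1 <= Cmod (g true - g false) * d * (exp 4 * P)) by (apply Rmult_le_compat_l; auto).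
  assert (Q5 : 0 <= exp 4 * P * d) by (apply Rmult_le_pos; lra).
  lra. }
assert (Lead : 2 / m * exp (m * x) * (cos (m * b) - cos (m * a)) <= - (P * d * (P * d)) / 18).
{ assert (Q : m * d * (m * d) / 18 <= cos (m * a) - cos (m * b)) by (unfold d; eapply Rle_trans; [|exact HC]; right; field).
  assert (Q1 : 2 / m * (m * d * (m * d) / 18) <= 2 / m * (cos (m * a) - cos (m * b))).
  { apply Rmult_le_compat_l; auto. left; apply Rdiv_lt_0_compat; lra. }
  replace (2 / m * (m * d * (m * d) / 18)) with (m * (d * d) / 9) in Q1 by (field; lra).
  assert (Q2 : d * d / 18 <= 2 / m * (cos (m * a) - cos (m * b))) by (eapply Rle_trans; [|exact Q1]; nra).
  assert (Q3 : P * P * (d * d / 18) <= exp (m * x) * (2 / m * (cos (m * a) - cos (m * b)))).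
  { apply Rmult_le_compat; auto; nra. }
  replace (2 / m * exp (m * x) * (cos (m * b) - cos (m * a))) with (- (exp (m * x) * (2 / m * (cos (m * a) - cos (m * b))))) by ring.
  replace (- (P * d * (P * d)) / 18) with (- (P * P * (d * d / 18))) by field. lra. }
(* The maximum of B T - T^2 / 18 over T is 9 B^2 / 2, attained at T = 9 B; the factor 18 leaves
   slack. *)
assert (Young : (bulk * exp 4) * (P * d) - P * d * (P * d) / 18 <= (bulk * exp 4) * (bulk * exp 4) * 18).
{ set (B := bulk * exp 4). set (T := P * d).
  assert (0 <= (T - 9 * B) ^ 2) by apply pow2_ge_0.
  assert (0 <= B * B) by apply Rle_0_sqr.
  lra. }
assert (EqA : 2 * sgn s * (exp (m * x) * cos (m * (ya)) / m + Re (c1 * Cexp (x, ya))%C)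
  = 2 / m * exp (m * x) * cos (m * a) + 2 * sgn s * Re (c1 * Cexp (x, ya))%C).
{ rewrite <- (Hcos a). fold ya. field; lra. }
assert (EqB : 2 * sgn s * (exp (m * x) * cos (m * (yb)) / m + Re (c1 * Cexp (x, yb))%C)
  = 2 / m * exp (m * x) * cos (m * b) + 2 * sgn s * Re (c1 * Cexp (x, yb))%C).
{ rewrite <- (Hcos b). fold yb. field; lra. }
rewrite EqA, EqB. lra.
Qed.

Lemma vertical_ratio (s : bool) (y0 e x a b : R) : center s y0 ->
  e = 1 \/ e = -1 -> 0 <= x -> 0 <= a -> a <= b -> b <= PI / m ->
  Cmod (ratio s (x, y0 + e * b)) <= vertical_const * Cmod (ratio s (x, y0 + e * a)).
Proof.
intros. rewrite !ratio_exp. unfold vertical_const. rewrite <- exp_plus. apply exp_le.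
eapply Rle_trans; [apply (vertical_log_ratio s y0 e x a b); assumption|].
rewrite Rplus_comm. apply Rle_refl.
Qed.

Lemma ray_ratio (s : bool) (y0 x0 x1 : R) : center s y0 -> bulk <= x0 -> x0 <= x1 ->
  Cmod (ratio s (x0, y0)) <= Cmod (ratio s (x1, y0)).
Proof.
intros Hc H0 H1. rewrite !ratio_exp. apply exp_le.
assert (H := ray_log_ratio s y0 x0 x1 Hc H0 H1). assert (E := exp_le _ _ H1). lra.
Qed.

(** The record leaves [wA] abstract; its regularity is read off from the Riccati relation. *)
Lemma ex_CD_wA (z : C) : exists l, CD (wA D) z l.
Proof.
eexists. apply (CD_ext (fun z => (slope true z * slope true z
   + sgn true * (m * Cexp (m * z) + c1 * Cexp z) - defect true z)%C)).
- intros w. assert (R := w_riccati D true w). fold m c1 g in R.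
  unfold slope. rewrite R. unfold defect. ring.
- apply CD_minus; [apply CD_plus; [apply CD_mult; apply CD_slope|]|].
  + apply CD_mult; [apply CD_const|]. apply CD_plus; (apply CD_mult; [apply CD_const|]).
    * apply CD_Cexp_lin.
    * apply CD_Cexp.
  + unfold defect. apply CD_plus; [apply CD_mult; [apply CD_const|apply CD_Cexp]|apply CD_const].
Qed.

Lemma wA_bounded_segment (z0 w : C) : exists B, 0 <= B /\
  forall t : R, 0 <= t <= 1 -> Cmod (wA D (z0 + t * w)) <= B.
Proof.
destruct (ex_CD_wA z0) as [l0 _].
assert (H : forall t : R, exists l, PD (fun t : R => wA D (z0 + t * w)%C) t l).
{ intros t. destruct (ex_CD_wA (z0 + t * w)%C) as [l Hl]. exists (w * l)%C. apply CD_path; auto. }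
destruct (continuity_ab_maj (fun t : R => Cmod (wA D (z0 + t * w)%C)) 0 1 ltac:(lra)) as [x [Hx _]].
- intros c _. destruct (H c) as [l Hl]. apply (PD_cont _ c l Hl).
- exists (Cmod (wA D (z0 + x * w))). split; [apply Cmod_ge_0|]. intros t Ht. apply Hx; auto.
Qed.

(** Uniqueness for the initial value problem, by Gronwall on the segment from z0 to z. *)
Lemma solution_zero (f f1 : C -> C) (z0 : C) : solves f f1 ->
  f z0 = 0 -> f1 z0 = 0 -> forall z, f z = 0.
Proof.
intros Hs E0 E1 z. set (w := (z - z0)%C).
destruct (wA_bounded_segment z0 w) as [B [HB0 HB]].
set (c := Cmod w * (1 + B)).
assert (Hw := Cmod_ge_0 w).
assert (Hc : 0 <= c) by (unfold c; nra).
assert (G := gronwall (fun t : R => f (z0 + t * w)%C) (fun t : R => w * f1 (z0 + t * w))%C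
  (fun t : R => f1 (z0 + t * w)%C) (fun t : R => w * (wA D (z0 + t * w) * f (z0 + t * w)))%C c 1).
cbv beta in G.
rewrite Cmult_0_l, Cplus_0_r, E0, E1, Cmod_0, Cmult_1_l in G.
replace (z0 + w)%C with z in G by (unfold w; ring).
assert (K : Cmod (f z) ^ 2 + Cmod (f1 z) ^ 2 <= 0).
{ eapply Rle_trans; [apply G|right; ring]; try lra.
  - intros t _. apply CD_path. apply Hs.
  - intros t _. apply CD_path. apply Hs.
  - intros t _. rewrite Cmod_mult. apply Rmult_le_compat_r; [apply Cmod_ge_0|]. unfold c; nra.
  - intros t Ht. rewrite !Cmod_mult. unfold c. rewrite Rmult_assoc.
    apply Rmult_le_compat_l; auto. apply Rmult_le_compat_r; [apply Cmod_ge_0|].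
    specialize (HB t Ht). lra. }
apply Cmod_eq_0. assert (P := pow2_ge_0 (Cmod (f1 z))). assert (Q := Cmod_ge_0 (f z)). nra.
Qed.

(** * Limits of the coefficients along rays *)

Definition base : R := bulk + 8 * rate.

Lemma base_ge : bulk <= base /\ 0 <= base.
Proof. unfold base. assert (B := bulk_ge_1). assert (R := rate_ge_1). lra. Qed.

Lemma rate_small (x : R) : base <= x -> 0 <= rate * exp (- x) <= / 8.
Proof.
intros H. assert (R := rate_ge_1). assert (P := exp_pos (- x)). split; [nra|].
rewrite exp_Ropp. assert (E := exp_ge_id x). unfold base in H. assert (B := bulk_ge_1).
apply Rmult_le_reg_r with (exp x); [apply exp_pos|].
rewrite Rmult_assoc, Rinv_l by (apply Rgt_not_eq, exp_pos). lra.
Qed.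

(** [ratio s] increases with x on the ray, so the ray is run from right to left with t = - x. Hence
    the dominant coefficient has its datum at the far end [x1], the other one at [x0]. The weight K
    stays free; it will be the ratio at [x0] or at [x1]. *)
Lemma ray_estimate (s : bool) (f f1 : C -> C) (y0 x0 x1 K : R) :
  solves f f1 -> center s y0 -> base <= x0 -> x0 <= x1 -> 0 < K ->
  let M := 2 * (Cmod (coef s f f1 (x1, y0)) + Cmod (coef (negb s) f f1 (x0, y0)) / K) in
  forall x, x0 <= x <= x1 ->
    Cmod (coef s f f1 (x, y0) - coef s f f1 (x1, y0)) <=
      rate * exp (- x0) * M * Rmax 1 (K / Cmod (ratio s (x, y0))) /\
    Cmod (coef (negb s) f f1 (x, y0) - coef (negb s) f f1 (x0, y0)) <=
      rate * exp (- x0) * M * Rmax K (Cmod (ratio s (x, y0))).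
Proof.
intros Hs Hc Hx0 Hx1 HK M x Hx.
assert (Hpt : forall t : R, ((0, y0) + t * (-1)%R)%C = (- t, y0)) by (intros; apply C_eq; simpl; ring).
assert (Hb := base_ge). assert (Hr := rate_small x0 Hx0).
assert (R1 := rate_ge_1).
assert (E := path_estimate s f f1 (0, y0) (-1)%R (fun t => rate * exp t) (- x1) (- x0) 1 K Hs).
assert (HM : 0 <= M).
{ unfold M. assert (P := Cmod_ge_0 (coef s f f1 (x1, y0))). assert (P2 := Cmod_ge_0 (coef (negb s) f f1 (x0, y0))).
  assert (0 < / K) by (apply Rinv_0_lt_compat; auto). unfold Rdiv. nra. }
specialize (E ltac:(rewrite Cmod_R, Rabs_left; lra) ltac:(lra) HK ltac:(lra)).
assert (EE : 1 * (rate * exp (- x0) - rate * exp (- x1)) <= rate * exp (- x0)).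
{ assert (P := exp_pos (- x1)). nra. }
destruct E with (t := - x) as [E1 E2].
- intros t Ht. rewrite Hpt. simpl. lra.
- intros a b Ha Hab Hb'. rewrite !Hpt, Rmult_1_l. apply ray_ratio; auto; lra.
- intros t Ht. rewrite Hpt. simpl. rewrite Ropp_involutive. auto_derive; auto; ring.
- lra.
- lra.
- rewrite !Hpt, !Ropp_involutive in E1, E2. fold M in E1, E2. split.
  + eapply Rle_trans; [exact E1|]. apply Rmult_le_compat_r; [apply Rle_trans with 1; [lra|apply Rmax_l]|].
    apply Rmult_le_compat_r; auto.
  + eapply Rle_trans; [exact E2|]. apply Rmult_le_compat_r; [apply Rle_trans with K; [lra|apply Rmax_l]|].
    apply Rmult_le_compat_r; auto.
Qed.

Section Ray.
Context (s : bool) (f f1 : C -> C) (y0 : R).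
Context (Hs : solves f f1) (Hc : center s y0).
Let al (x : R) := coef s f f1 (x, y0).
Let be (x : R) := coef (negb s) f f1 (x, y0).
Let rho (x : R) := Cmod (ratio s (x, y0)).

(** Taken with K = [rho x0], which makes [al] and [be / rho] the two comparable quantities. *)
Lemma ray_dominant_step (x0 x1 : R) : base <= x0 -> x0 <= x1 ->
  Cmod (al x0 - al x1) <= rate * exp (- x0) * (2 * (Cmod (al x1) + Cmod (be x0) / rho x0)) /\
  Cmod (be x1) / rho x1 <= Cmod (be x0) / rho x0 + rate * exp (- x0) * (2 * (Cmod (al x1) + Cmod (be x0) / rho x0)).
Proof.
intros H0 H1. assert (Hb := base_ge).
assert (P0 : 0 < rho x0) by apply ratio_pos. assert (P1 : 0 < rho x1) by apply ratio_pos.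
assert (Mo : rho x0 <= rho x1) by (apply ray_ratio; auto; lra).
destruct (ray_estimate s f f1 y0 x0 x1 (rho x0) Hs Hc H0 H1 P0 x0 ltac:(lra)) as [A _].
destruct (ray_estimate s f f1 y0 x0 x1 (rho x0) Hs Hc H0 H1 P0 x1 ltac:(lra)) as [_ B].
fold (al x0) (al x1) (be x0) (rho x0) in A. fold (al x1) (be x0) (be x1) (rho x1) in B.
split.
- replace (rho x0 / rho x0) with 1 in A by (field; lra). rewrite Rmax_left in A by lra. lra.
- rewrite Rmax_right in B by auto.
  assert (T := Cmod_triangle (be x0) (be x1 - be x0)).
  replace (be x0 + (be x1 - be x0))%C with (be x1) in T by ring.
  apply Rmult_le_reg_r with (rho x1); auto.
  unfold Rdiv at 1. rewrite Rmult_assoc, Rinv_l, Rmult_1_r by lra.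
  rewrite Rmult_plus_distr_r.
  apply Rle_trans with (1 := T). apply Rplus_le_compat; auto.
  apply Rmult_le_reg_r with (rho x0); auto.
  replace (Cmod (be x0) / rho x0 * rho x1 * rho x0) with (Cmod (be x0) * rho x1) by (field; lra).
  apply Rmult_le_compat_l; auto. apply Cmod_ge_0.
Qed.

(** In the step from [base] to x the unknown |al x| reappears on the right with factor at most 1/4
    and is absorbed. *)
Lemma ray_bounded : exists B, 0 <= B /\ forall x, base <= x -> Cmod (al x) <= B /\ Cmod (be x) / rho x <= B.
Proof.
set (a := Cmod (al base)). set (b := Cmod (be base) / rho base).
assert (Ha : 0 <= a) by apply Cmod_ge_0.
assert (Hb : 0 <= b).
{ apply Rmult_le_pos; [apply Cmod_ge_0|]. left; apply Rinv_0_lt_compat, ratio_pos. }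
exists (2 * a + 2 * b). split; [lra|]. intros x Hx.
destruct (ray_dominant_step base x (Rle_refl _) Hx) as [A B].
fold b in A, B. assert (R := rate_small base (Rle_refl _)).
set (d := rate * exp (- base)) in *.
assert (T := Cmod_triangle_rev (al x) (al base)). fold a in T.
replace (al x - al base)%C with (- (al base - al x))%C in T by ring. rewrite Cmod_opp in T.
assert (Px := Cmod_ge_0 (al x)).
assert (d * (2 * (Cmod (al x) + b)) <= / 8 * (2 * (Cmod (al x) + b))) by (apply Rmult_le_compat_r; lra).
lra.
Qed.

Lemma ray_limit : exists L B, forall x, base <= x -> Cmod (al x - L) <= B * exp (- x).
Proof.
destruct ray_bounded as [B [HB H]]. assert (R := rate_ge_1).
destruct (exp_cauchy al base (rate * (2 * (B + B)))) as [L HL].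
- intros x0 x1 H0 H1.
  destruct (ray_dominant_step x0 x1 H0 H1) as [A _].
  destruct (H x0 H0) as [_ H3]. destruct (H x1 ltac:(lra)) as [H2 _].
  eapply Rle_trans; [exact A|]. assert (P := exp_pos (- x0)).
  replace (rate * (2 * (B + B)) * exp (- x0)) with (rate * exp (- x0) * (2 * (B + B))) by ring.
  apply Rmult_le_compat_l; [nra|]. lra.
- exists L, (2 * (rate * (2 * (B + B)))). exact HL.
Qed.

Section Subdominant.
Context (B0 : R) (HL : forall x, base <= x -> Cmod (al x) <= B0 * exp (- x)).

(* As [y] tends to infinity the boundary datum [al y] in the estimate on [x, y] drops out. *)
Lemma subdominant_small (x : R) : base <= x ->
  Cmod (al x) * rho x <= 2 * (rate * exp (- x)) * Cmod (be x).
Proof.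
intros Hx. assert (P : 0 < rho x) by apply ratio_pos.
assert (R := rate_small x Hx). set (d := rate * exp (- x)) in *.
assert (K : Cmod (al x) <= d * (2 * (Cmod (be x) / rho x))).
{ apply (decay_le _ _ ((2 * d + 1) * B0) x). intros y Hy.
  destruct (ray_dominant_step x y Hx Hy) as [A _]. fold d in A.
  assert (T := Cmod_triangle (al x - al y) (al y)).
  replace (al x - al y + al y)%C with (al x) in T by ring.
  specialize (HL y ltac:(lra)).
  assert (2 * d * Cmod (al y) <= 2 * d * (B0 * exp (- y))) by (apply Rmult_le_compat_l; lra).
  lra. }
apply Rmult_le_compat_r with (r := rho x) in K; [|lra].
replace (d * (2 * (Cmod (be x) / rho x)) * rho x) with (2 * d * Cmod (be x)) in K by (field; lra).
exact K.
Qed.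

(** Here K = [rho x1], so that [be] itself is estimated; the product [al x1 * rho x1] that appears
    is bounded by [subdominant_small]. *)
Lemma subdominant_step (x0 x1 : R) : base <= x0 -> x0 <= x1 ->
  Cmod (be x1 - be x0) <= rate * exp (- x0) * (2 * (2 * (rate * exp (- x0)) * Cmod (be x1) + Cmod (be x0))).
Proof.
intros H0 H1. assert (P1 : 0 < rho x1) by apply ratio_pos.
destruct (ray_estimate s f f1 y0 x0 x1 (rho x1) Hs Hc H0 H1 P1 x1 ltac:(lra)) as [_ B].
fold (al x1) (be x0) (be x1) (rho x1) in B. rewrite Rmax_left in B by lra.
eapply Rle_trans; [exact B|].
assert (S := subdominant_small x1 ltac:(lra)).
assert (R := rate_small x0 H0).
assert (E : rate * exp (- x1) <= rate * exp (- x0)).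
{ assert (R1 := rate_ge_1). apply Rmult_le_compat_l; [lra|]. apply exp_le; lra. }
replace (rate * exp (- x0) * (2 * (Cmod (al x1) + Cmod (be x0) / rho x1)) * rho x1) with
  (rate * exp (- x0) * (2 * (Cmod (al x1) * rho x1 + Cmod (be x0)))) by (field; lra).
apply Rmult_le_compat_l; [lra|]. apply Rmult_le_compat_l; [lra|].
apply Rplus_le_compat_r. eapply Rle_trans; [exact S|].
apply Rmult_le_compat_r; [apply Cmod_ge_0|]. lra.
Qed.

(** If L = 0, letting x tend to infinity in the step from [base] gives |be base| <= |be base| / 4.
    Then both coefficients vanish at [base], hence f and f' do. *)
Lemma subdominant_limit : exists L B, (forall x, base <= x -> Cmod (be x - L) <= B * exp (- x)) /\
  (L = 0 -> forall z, f z = 0).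
Proof.
assert (Bd : forall x, base <= x -> Cmod (be x) <= 2 * Cmod (be base)).
{ intros x Hx. assert (S := subdominant_step base x (Rle_refl _) Hx).
  assert (R := rate_small base (Rle_refl _)). set (d := rate * exp (- base)) in *.
  assert (T := Cmod_triangle_rev (be x) (be base)).
  assert (P := Cmod_ge_0 (be x)). assert (P0 := Cmod_ge_0 (be base)).
  assert (d * (2 * (2 * d * Cmod (be x) + Cmod (be base))) <= / 8 * (2 * (2 * / 8 * Cmod (be x) + Cmod (be base)))).
  { apply Rmult_le_compat; try lra; nra. }
  lra. }
assert (R1 := rate_ge_1). assert (P0 := Cmod_ge_0 (be base)).
destruct (exp_cauchy be base (rate * (2 * (3 * Cmod (be base))))) as [L HLim].
- intros x0 x1 H0 H1. assert (S := subdominant_step x0 x1 H0 H1).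
  replace (be x0 - be x1)%C with (- (be x1 - be x0))%C by ring. rewrite Cmod_opp.
  eapply Rle_trans; [exact S|]. assert (R := rate_small x0 H0).
  assert (B1 := Bd x1 ltac:(lra)). assert (B2 := Bd x0 H0).
  replace (rate * (2 * (3 * Cmod (be base))) * exp (- x0)) with (rate * exp (- x0) * (2 * (3 * Cmod (be base)))) by ring.
  apply Rmult_le_compat_l; [lra|]. apply Rmult_le_compat_l; [lra|].
  assert (P := Cmod_ge_0 (be x1)).
  assert (2 * (rate * exp (- x0)) * Cmod (be x1) <= 2 * / 8 * Cmod (be x1)) by (apply Rmult_le_compat_r; lra).
  lra.
- exists L, (2 * (rate * (2 * (3 * Cmod (be base))))). split; [exact HLim|]. intros HL0.
  assert (Z : be base = 0).
  { apply Cmod_eq_0. apply Rle_antisym; auto.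
    assert (R := rate_small base (Rle_refl _)). set (d := rate * exp (- base)) in *.
    assert (K : Cmod (be base) <= / 4 * Cmod (be base)).
    { apply (decay_le _ _ (2 * (2 * (rate * (2 * (3 * Cmod (be base)))))) base). intros x Hx.
      assert (S := subdominant_step base x (Rle_refl _) Hx). fold d in S.
      specialize (HLim x Hx). rewrite HL0 in HLim. replace (be x - 0)%C with (be x) in HLim by ring.
      assert (T := Cmod_triangle_rev (be base) (be x)).
      replace (be base - be x)%C with (- (be x - be base))%C in T by ring. rewrite Cmod_opp in T.
      assert (P := Cmod_ge_0 (be x)).
      assert (d * (2 * (2 * d * Cmod (be x) + Cmod (be base))) <= / 8 * (2 * (2 * / 8 * Cmod (be x) + Cmod (be base)))).
      { apply Rmult_le_compat; try lra; nra. }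
      lra. }
    lra. }
  assert (Za : al base = 0).
  { assert (S := subdominant_small base (Rle_refl _)). rewrite Z, Cmod_0 in S.
    apply Cmod_eq_0. assert (P := ratio_pos s (base, y0)). fold (rho base) in P.
    assert (Q := Cmod_ge_0 (al base)). nra. }
  assert (G : gap s (base, y0) <> 0) by (apply gap_neq_0; simpl; apply base_ge).
  apply (solution_zero f f1 (base, y0) Hs).
  + rewrite (coef_decomp s f f1 _ G). fold (al base) (be base). rewrite Z, Za. ring.
  + rewrite (coef_decomp_1 s f f1 _ G). fold (al base) (be base). rewrite Z, Za. ring.
Qed.
End Subdominant.
End Ray.

(** * From a ray to the strip around it *)

Lemma vertical_estimate (s : bool) (f f1 : C -> C) (y0 e x K : R) :
  solves f f1 -> center s y0 -> e = 1 \/ e = -1 -> bulk <= x -> 0 < K ->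
  let d := vertical_const * (rate * exp (- x) * (PI / m)) in
  d <= / 4 ->
  let M := 2 * (Cmod (coef s f f1 (x, y0)) + Cmod (coef (negb s) f f1 (x, y0 + e * (PI / m))) / K) in
  forall t, 0 <= t <= PI / m ->
    Cmod (coef s f f1 (x, y0 + e * t) - coef s f f1 (x, y0)) <=
      d * M * Rmax 1 (K / Cmod (ratio s (x, y0 + e * t))) /\
    Cmod (coef (negb s) f f1 (x, y0 + e * t) - coef (negb s) f f1 (x, y0 + e * (PI / m))) <=
      d * M * Rmax K (Cmod (ratio s (x, y0 + e * t))).
Proof.
intros Hs Hc He Hx HK d Hd M t Ht.
assert (Hm := wm_pos).
assert (Hpt : forall t : R, ((x, y0) + t * (0, e))%C = (x, y0 + e * t)) by (intros; apply C_eq; simpl; ring).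
assert (Hb := bulk_ge_1). assert (R1 := rate_ge_1).
assert (Hpm : 0 < PI / m) by (apply Rdiv_lt_0_compat; [apply PI_RGT_0|lra]).
assert (E := path_estimate s f f1 (x, y0) (0, e) (fun t => rate * exp (- x) * t) 0 (PI / m) (vertical_const) K Hs).
assert (Ed : vertical_const * (rate * exp (- x) * (PI / m) - rate * exp (- x) * 0) = d) by (unfold d; ring).
cbv beta in E. rewrite Ed in E.
destruct E with (t := t) as [E1 E2]; auto.
- unfold Cmod; simpl. replace (0 * (0 * 1) + e * (e * 1)) with 1; [apply sqrt_1|].
  destruct He as [-> | ->]; ring.
- lra.
- apply vertical_const_ge_1.
- intros u _. rewrite Hpt. simpl; lra.
- intros a b Ha Hab Hb'. rewrite !Hpt. apply vertical_ratio; auto; lra.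
- intros u _. rewrite Hpt. simpl. auto_derive; auto; ring.
- rewrite !Hpt in E1, E2. replace (y0 + e * 0) with y0 in E1, E2 by ring. auto.
Qed.

(** One factor [vertical_const] comes from the estimate on the segment, the other from comparing the
    ratio at a point of the strip with that on the central ray. *)
Definition vrate : R := vertical_const * vertical_const * (rate * (PI / m)).
Definition vbase : R := base + 8 * vrate.

Lemma vrate_pos : 0 < vrate.
Proof.
unfold vrate. assert (Q := vertical_const_ge_1). assert (R := rate_ge_1).
assert (Hm := wm_pos).
assert (0 < PI / m) by (apply Rdiv_lt_0_compat; [apply PI_RGT_0|lra]).
apply Rmult_lt_0_compat; [nra|]. apply Rmult_lt_0_compat; lra.
Qed.

Lemma vbase_ge : base <= vbase.
Proof. unfold vbase. assert (H := vrate_pos). lra. Qed.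

Lemma vrate_small (x : R) : vbase <= x -> 0 <= vrate * exp (- x) <= / 8.
Proof.
intros H. assert (R := vrate_pos). assert (P := exp_pos (- x)). split; [nra|].
rewrite exp_Ropp. assert (E := exp_ge_id x). unfold vbase in H.
assert (B := proj2 (base_ge)).
apply Rmult_le_reg_r with (exp x); [apply exp_pos|].
rewrite Rmult_assoc, Rinv_l by (apply Rgt_not_eq, exp_pos). lra.
Qed.

(** K is the ratio on the central ray, up to [vertical_const] the largest in the strip. The datum of
    sign s there is bounded by [subdominant_small], the datum of the other sign on the adjacent ray
    by the estimate itself. Thus f follows the exponential [negb s] on both sides of a ray where the
    exponential s would dominate. *)
Lemma subdominant_strip (s : bool) (f f1 : C -> C) (y0 B0 : R) :
  solves f f1 -> center s y0 ->
  (forall x, base <= x -> Cmod (coef s f f1 (x, y0)) <= B0 * exp (- x)) ->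
  exists (L : C) (B : R), (L = 0 -> forall z, f z = 0) /\
    forall x e t, vbase <= x -> e = 1 \/ e = -1 -> 0 <= t <= PI / m ->
      Cmod (coef s f f1 (x, y0 + e * t)) * Cmod (ratio s (x, y0 + e * t)) <= B * exp (- x) /\
      Cmod (coef (negb s) f f1 (x, y0 + e * t) - L) <= B * exp (- x).
Proof.
intros Hs Hc HB.
destruct (subdominant_limit s f f1 y0 Hs Hc B0 HB) as [L [B1 [HL HL0]]].
set (be := fun x => Cmod (coef (negb s) f f1 (x, y0))) in *.
set (Bb := Cmod L + Rabs B1).
assert (Hbe : forall x, base <= x -> be x <= Bb).
{ intros x Hx. specialize (HL x Hx). unfold be, Bb.
  assert (T := Cmod_triangle_rev (coef (negb s) f f1 (x, y0)) L).
  assert (exp (- x) <= 1).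
  { rewrite <- exp_0. apply exp_le. assert (Q := proj2 (base_ge)). lra. }
  assert (P := exp_pos (- x)). assert (A := Rle_abs B1). assert (A' := Rabs_pos B1). nra. }
(* The first bound uses 6 + 2 multiples of [vrate * Bb], the second 6 + 6 and the error on the
   central ray. *)
exists L, (14 * vrate * Bb + Rabs B1). split; auto.
intros x e t Hx He Ht.
assert (V := vbase_ge). assert (Hxb : base <= x) by lra.
assert (Hbk := base_ge).
assert (VS := vrate_small x Hx). assert (VP := vrate_pos).
assert (Q1 := vertical_const_ge_1). assert (R1 := rate_ge_1).
assert (Hm := wm_pos).
assert (Hpm : 0 < PI / m) by (apply Rdiv_lt_0_compat; [apply PI_RGT_0|lra]).
assert (Hpm1 : 1 <= PI / m).
{ assert (P3 := PI2_1). apply Rmult_le_reg_r with m; [lra|]. unfold Rdiv; rewrite Rmult_assoc, Rinv_l; lra. }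
assert (Pe := exp_pos (- x)).
set (Q := vertical_const) in *. set (rho0 := Cmod (ratio s (x, y0))).
assert (Hr0 : 0 < rho0) by apply ratio_pos.
set (d := Q * (rate * exp (- x) * (PI / m))).
assert (Hd : Q * d = vrate * exp (- x)) by (unfold d, vrate; fold Q; ring).
assert (Hd0 : 0 <= d) by (unfold d; apply Rmult_le_pos; [lra|]; apply Rmult_le_pos; [nra|lra]).
assert (HdQ : d <= Q * d) by nra.
assert (V4 := vertical_estimate s f f1 y0 e x rho0 Hs Hc He ltac:(lra) Hr0).
cbv zeta in V4. fold m Q in V4. fold d in V4. specialize (V4 ltac:(lra)).
cbv beta in HL. set (a0 := Cmod (coef s f f1 (x, y0))) in *.
set (bR := Cmod (coef (negb s) f f1 (x, (y0 + e * (PI / m))%R))) in *.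
assert (Sub := subdominant_small s f f1 y0 Hs Hc B0 HB x Hxb).
cbv beta in Sub. fold a0 rho0 in Sub. change (Cmod (coef (negb s) f f1 (x, y0))) with (be x) in Sub.
assert (RS := rate_small x Hxb).
assert (Pb : 0 <= be x) by apply Cmod_ge_0. assert (Pa : 0 <= a0) by apply Cmod_ge_0.
assert (PR : 0 <= bR) by apply Cmod_ge_0.
assert (Sub1 : a0 * rho0 <= be x).
{ assert (2 * (rate * exp (- x)) * be x <= 2 * / 8 * be x) by (apply Rmult_le_compat_r; lra). lra. }
assert (HM : d * (2 * (a0 + bR / rho0)) * (Q * rho0) = vrate * exp (- x) * (2 * (a0 * rho0 + bR))).
{ rewrite <- Hd. field. lra. }
assert (HM0 : 0 <= d * (2 * (a0 + bR / rho0))).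
{ apply Rmult_le_pos; auto. apply Rmult_le_pos; [lra|]. apply Rplus_le_le_0_compat; auto.
  apply Rmult_le_pos; auto. left; apply Rinv_0_lt_compat; auto. }
assert (Hmax : forall t, 0 <= t <= PI / m -> Cmod (ratio s (x, (y0 + e * t)%R)) <= Q * rho0).
{ intros u Hu. assert (E := vertical_ratio s y0 e x 0 u Hc He ltac:(lra) ltac:(lra) ltac:(lra) ltac:(apply Hu)).
  replace (y0 + e * 0) with y0 in E by ring. exact E. }
assert (HQr : rho0 <= Q * rho0).
{ rewrite <- (Rmult_1_l rho0) at 1. apply Rmult_le_compat_r; lra. }
assert (Est : forall t, 0 <= t <= PI / m ->
  Cmod (coef (negb s) f f1 (x, (y0 + e * t)%R) - coef (negb s) f f1 (x, (y0 + e * (PI / m))%R)) <=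
   vrate * exp (- x) * (2 * (be x + bR))).
{ intros u Hu. destruct (V4 u Hu) as [_ E]. eapply Rle_trans; [exact E|].
  eapply Rle_trans; [apply Rmult_le_compat_l; [exact HM0|]; apply Rmax_lub; [exact HQr|apply Hmax; auto]|].
  rewrite HM. apply Rmult_le_compat_l; lra. }
(* At u = 0 the estimate compares the two ends: |be - bR| <= (be + bR) / 4, so the unknown [bR] is
   absorbed. *)
assert (BR : bR <= 2 * be x).
{ assert (E := Est 0 ltac:(lra)). replace (y0 + e * 0) with y0 in E by ring.
  assert (T := Cmod_triangle_rev (coef (negb s) f f1 (x, (y0 + e * (PI / m))%R)) (coef (negb s) f f1 (x, y0))).
  replace (coef (negb s) f f1 (x, (y0 + e * (PI / m))%R) - coef (negb s) f f1 (x, y0))%C with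
   (- (coef (negb s) f f1 (x, y0) - coef (negb s) f f1 (x, (y0 + e * (PI / m))%R)))%C in T by ring.
  rewrite Cmod_opp in T. fold bR in T. change (Cmod (coef (negb s) f f1 (x, y0))) with (be x) in T.
  assert (vrate * exp (- x) * (2 * (be x + bR)) <= / 8 * (2 * (be x + bR))) by (apply Rmult_le_compat_r; lra).
  lra. }
assert (Hbx := Hbe x Hxb).
assert (Fin : vrate * exp (- x) * (2 * (be x + bR)) <= 6 * vrate * Bb * exp (- x)).
{ replace (6 * vrate * Bb * exp (- x)) with (vrate * exp (- x) * (6 * Bb)) by ring.
  apply Rmult_le_compat_l; lra. }
assert (Hrv : Q * rate <= vrate).
{ unfold vrate. fold Q. assert (0 <= Q * rate) by nra.
  replace (Q * Q * (rate * (PI / m))) with ((Q * rate) * (Q * (PI / m))) by ring.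
  rewrite <- (Rmult_1_r (Q * rate)) at 1. apply Rmult_le_compat_l; auto. nra. }
assert (PB1 := Rabs_pos B1).
assert (PBb : 0 <= Bb) by lra.
assert (PBe : 0 <= vrate * Bb * exp (- x)) by (apply Rmult_le_pos; [nra|lra]).
assert (PBf : 0 <= Rabs B1 * exp (- x)) by nra.
split.
- destruct (V4 t Ht) as [E _]. set (r := Cmod (ratio s (x, (y0 + e * t)%R))) in *.
  assert (Hr : 0 < r) by apply ratio_pos.
  assert (T := Cmod_triangle (coef s f f1 (x, (y0 + e * t)%R) - coef s f f1 (x, y0)) (coef s f f1 (x, y0))).
  replace (coef s f f1 (x, (y0 + e * t)%R) - coef s f f1 (x, y0) + coef s f f1 (x, y0))%C with (coef s f f1 (x, (y0 + e * t)%R)) in T by ring.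
  fold a0 in T.
  apply Rle_trans with ((d * (2 * (a0 + bR / rho0)) * Rmax 1 (rho0 / r) + a0) * r).
  + apply Rmult_le_compat_r; lra.
  + rewrite Rmult_plus_distr_r, Rmult_assoc.
    replace (Rmax 1 (rho0 / r) * r) with (Rmax r rho0).
    2: { rewrite (Rmult_comm _ r), <- RmaxRmult by lra. f_equal; field; lra. }
    assert (U1 : d * (2 * (a0 + bR / rho0)) * Rmax r rho0 <= 6 * vrate * Bb * exp (- x)).
    { eapply Rle_trans; [apply Rmult_le_compat_l; [exact HM0|]; apply Rmax_lub; [apply Hmax; auto|exact HQr]|].
      rewrite HM. eapply Rle_trans; [|exact Fin]. apply Rmult_le_compat_l; lra. }
    assert (U2 : a0 * r <= 2 * vrate * Bb * exp (- x)).
    { apply Rle_trans with (Q * (a0 * rho0)).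
      - replace (Q * (a0 * rho0)) with (a0 * (Q * rho0)) by ring. apply Rmult_le_compat_l; auto. apply Hmax; auto.
      - apply Rle_trans with (Q * (2 * (rate * exp (- x)) * be x)); [apply Rmult_le_compat_l; lra|].
        replace (Q * (2 * (rate * exp (- x)) * be x)) with (2 * exp (- x) * ((Q * rate) * be x)) by ring.
        replace (2 * vrate * Bb * exp (- x)) with (2 * exp (- x) * (vrate * Bb)) by ring.
        apply Rmult_le_compat_l; [lra|]. apply Rmult_le_compat; auto. nra. }
    lra.
- specialize (HL x Hxb).
  replace (coef (negb s) f f1 (x, (y0 + e * t)%R) - L)%C with
   ((coef (negb s) f f1 (x, (y0 + e * t)%R) - coef (negb s) f f1 (x, (y0 + e * (PI / m))%R))
   + ((- (coef (negb s) f f1 (x, y0) - coef (negb s) f f1 (x, (y0 + e * (PI / m))%R)))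
    + (coef (negb s) f f1 (x, y0) - L)))%C by ring.
  eapply Rle_trans; [apply Cmod_triangle|].
  eapply Rle_trans; [apply Rplus_le_compat_l, Cmod_triangle|]. rewrite Cmod_opp.
  assert (E1 := Est t Ht). assert (E0 := Est 0 ltac:(lra)).
  replace (y0 + e * 0) with y0 in E0 by ring.
  assert (A := Rle_abs B1).
  assert (B1 * exp (- x) <= Rabs B1 * exp (- x)) by (apply Rmult_le_compat_r; lra).
  lra.
Qed.

(** * Zeros between two dominant rays *)

Definition phase_diff (s : bool) (z : C) : C := (phase s z - phase (negb s) z)%C.
Definition taylor_const : R := 4 * exp 2 + 2 * Cmod c1 * exp 1.

(** The derivative of [phase_diff s] is - [gap s], so this is its first-order Taylor formula with a
    remainder of the size of the gap times |w|^2. *)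
Lemma phase_diff_taylor (s : bool) (z w : C) : 0 <= Re z -> Cmod w <= 1 ->
  Cmod (phase_diff s (z + w) - phase_diff s z + gap s z * w) <=
    taylor_const * exp (m * Re z) * (Cmod w * Cmod w).
Proof.
intros Hz Hw. assert (Hm := wm_pos). assert (Hm0 := wm_neq_0).
replace (phase_diff s (z + w)%C - phase_diff s z + gap s z * w)%C with
 (RtoC (2 * sgn s) * (Cexp (m * z) / m * (Cexp (m * w) - 1 - m * w) + c1 * Cexp z * (Cexp w - 1 - w)))%C.
2: { unfold phase_diff, phase, gap, slope.
  replace (m * (z + w))%C with (m * z + m * w)%C by ring. rewrite !Cexp_plus, sgn_negb, RtoC_opp, RtoC_mult.
  field. auto. }
rewrite Cmod_mult, Cmod_R, Rabs_mult, Rabs_sgn, (Rabs_pos_eq 2) by lra.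
assert (Pw := Cmod_ge_0 w).
set (W := Cmod w * Cmod w). assert (PW : 0 <= W) by (unfold W; nra).
set (X := exp (m * Re z)). assert (PX : 0 < X) by apply exp_pos.
assert (E1 : Cmod (Cexp (m * z) / m * (Cexp (m * w) - 1 - m * w)) <= 2 * exp 2 * X * W).
{ rewrite Cmod_mult, Cmod_div, Cmod_Cexp, Re_RtoC_mult, Cmod_R, Rabs_pos_eq by (auto; lra). fold X.
  assert (T := Cexp_sub_1_sub_id (m * w)). rewrite Cmod_mult, Cmod_R, Rabs_pos_eq in T by lra.
  assert (Ex : exp (m * Cmod w) <= exp 2) by (apply exp_le; nra).
  apply Rle_trans with (X / m * (m * Cmod w * (m * Cmod w) * exp 2)).
  - apply Rmult_le_compat_l; [left; apply Rdiv_lt_0_compat; lra|].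
    eapply Rle_trans; [exact T|]. apply Rmult_le_compat_l; auto.
    assert (0 <= m * Cmod w) by nra. nra.
  - replace (X / m * (m * Cmod w * (m * Cmod w) * exp 2)) with (m * (exp 2 * X * W)) by (unfold W; field; lra).
    replace (2 * exp 2 * X * W) with (2 * (exp 2 * X * W)) by ring.
    apply Rmult_le_compat_r; [|lra]. assert (P := exp_pos 2).
    apply Rmult_le_pos; auto. nra. }
assert (E2 : Cmod (c1 * Cexp z * (Cexp w - 1 - w)) <= Cmod c1 * exp 1 * X * W).
{ rewrite !Cmod_mult, Cmod_Cexp. assert (T := Cexp_sub_1_sub_id w). fold W in T.
  assert (Ex : exp (Cmod w) <= exp 1) by (apply exp_le; auto).
  assert (Ez : exp (Re z) <= X) by (apply exp_le; nra).
  replace (Cmod c1 * exp 1 * X * W) with (Cmod c1 * X * (W * exp 1)) by ring.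
  apply Rmult_le_compat; try apply Cmod_ge_0.
  - apply Rmult_le_pos; [apply Cmod_ge_0|left; apply exp_pos].
  - apply Rmult_le_compat_l; auto. apply Cmod_ge_0.
  - eapply Rle_trans; [exact T|]. apply Rmult_le_compat_l; auto. }
assert (T := Cmod_triangle (Cexp (m * z) / m * (Cexp (m * w) - 1 - m * w)) (c1 * Cexp z * (Cexp w - 1 - w))).
unfold taylor_const. fold X. nra.
Qed.

Lemma ray_ratio_large (s : bool) (y0 B : R) : center s y0 ->
  exists X, forall x, X <= x -> B < Cmod (ratio s (x, y0)).
Proof.
intros Hc. set (x0 := base). assert (Hb := base_ge). fold x0 in Hb.
exists (Rmax x0 (B - log_ratio s (x0, y0) + exp x0)).
intros x Hx. assert (H1 := Rle_trans _ _ _ (Rmax_l _ _) Hx). assert (H2 := Rle_trans _ _ _ (Rmax_r _ _) Hx).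
rewrite ratio_exp.
assert (L := ray_log_ratio s y0 x0 x Hc ltac:(lra) H1).
assert (E := exp_ineq1_le x). assert (E2 := exp_ineq1_le (log_ratio s (x, y0))). lra.
Qed.

Lemma reduced_CD (s : bool) (f f1 : C -> C) (z : C) : solves f f1 ->
  CD (fun z => f z * Cexp (- phase s z))%C z ((f1 z - slope s z * f z) * Cexp (- phase s z))%C.
Proof.
intros Hs. eapply CD_ext_l.
- apply CD_mult; [exact (proj1 (Hs z))|]. apply CD_Cexp_comp. apply CD_opp. apply CD_phase.
- cbv beta. ring.
Qed.

(* [th] is the phase defect at [z1]: up to small errors [f / Cexp (phase (negb s))] equals
   [Lb * (1 - Cexp (a, b))] in the local coordinate [(a, b)]. *)
Lemma local_zero (s : bool) (f f1 : C -> C) (La Lb z1 : C) (th eta R1 ep : R) :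
  solves f f1 -> bulk <= Re z1 ->
  (La * ratio s z1 = - (Lb * Cexp (Ci * th)))%C ->
  0 <= ep <= 1 -> 0 <= eta ->
  (forall a b, -1 <= a <= 1 -> -1 <= b <= 1 ->
     let w := (- ((a, b) - Ci * th) / gap s z1)%C in
     bulk <= Re (z1 + w)%C /\
     Cmod (coef s f f1 (z1 + w) - La) <= eta /\
     Cmod (coef (negb s) f f1 (z1 + w) - Lb) <= eta /\
     Cmod (ratio s (z1 + w)) <= R1 /\
     Cmod (phase_diff s (z1 + w) - phase_diff s z1 + gap s z1 * w) <= ep) ->
  eta < Cmod La ->
  eta * (R1 + 1) + Cmod Lb * exp 2 * ep < Cmod Lb / 18 ->
  exists a b, -1 <= a <= 1 /\ -1 <= b <= 1 /\
    f (z1 + - ((a, b) - Ci * th) / gap s z1)%C = 0.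
Proof.
intros Hs Hz1 Hq Hep Heta H HLa Hsmall.
assert (Hg := gap_neq_0 s z1 Hz1). set (gp := gap s z1) in *.
set (G := fun z => (f z * Cexp (- phase (negb s) z))%C).
(* Dividing by - [gap] straightens the phase difference, and the shift by [Ci * th] moves the zero
   of the model to u = 0. *)
set (zz := fun u : C => (z1 + - (u - Ci * th) / gp)%C).
assert (Czz : forall u, CD zz u (- / gp)%C).
{ intros u. unfold zz. eapply CD_ext_l.
  - apply CD_plus; [apply CD_const|]. apply CD_mult; [|apply CD_const].
    apply CD_opp, CD_minus; [apply CD_id|apply CD_const].
  - cbv beta. ring. }
assert (Hne : Lb <> 0).
{ intros E. rewrite E, Cmod_0 in Hsmall. 
  destruct (H 0 0 ltac:(lra) ltac:(lra)) as [_ [_ [_ [K _]]]].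
  assert (Q := Cmod_ge_0 (ratio s (z1 + - ((0, 0) - Ci * th) / gp))). nra. }
assert (PLb : 0 < Cmod Lb) by (apply Cmod_gt_0; auto).
set (eta' := eta * (R1 + 1) + Cmod Lb * exp 2 * ep) in *.
assert (Approx : forall a b, -1 <= a <= 1 -> -1 <= b <= 1 ->
  Cmod (G (zz (a, b)) - Lb * (1 - Cexp (a, b))) <= eta').
{ intros a b Ha Hb. destruct (H a b Ha Hb) as [H1 [H2 [H3 [H4 H5]]]].
  set (w := (- ((a, b) - Ci * th) / gp)%C) in *.
  change (zz (a, b)) with (z1 + w)%C. set (z := (z1 + w)%C) in *.
  unfold G. rewrite (coef_reduced s f f1 z (gap_neq_0 s z H1)).
  set (err := (phase_diff s z - phase_diff s z1 + gp * w)%C) in *.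
  assert (ER : ratio s z = (ratio s z1 * (Cexp (a, b) * Cexp (- (Ci * th)) * Cexp err))%C).
  { unfold ratio. rewrite <- !Cexp_plus. f_equal. unfold err, phase_diff, w. field. auto. }
  replace (coef s f f1 z * ratio s z + coef (negb s) f f1 z - Lb * (1 - Cexp (a, b)))%C with
   ((coef s f f1 z - La) * ratio s z + (coef (negb s) f f1 z - Lb) + (La * ratio s z + Lb * Cexp (a, b)))%C by ring.
  replace (La * ratio s z + Lb * Cexp (a, b))%C with (- (Lb * Cexp (a, b) * (Cexp err - 1)))%C.
  2: { rewrite ER. rewrite Cmult_assoc. rewrite Hq, Cexp_opp. field. apply Cexp_neq_0. }
  eapply Rle_trans; [apply Cmod_triangle|].
  eapply Rle_trans; [apply Rplus_le_compat_r, Cmod_triangle|].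
  rewrite Cmod_opp, !Cmod_mult, Cmod_Cexp. simpl (Re (a, b)).
  assert (Er : Cmod (Cexp err - 1) <= ep * exp 1).
  { replace (Cexp err - 1)%C with (Cexp (RtoC 1 * err) - 1)%C by (rewrite Cmult_1_l; ring).
    eapply Rle_trans; [apply Cexp_sub_1; lra|]. rewrite Rmult_1_l.
    apply Rmult_le_compat; auto; [apply Cmod_ge_0|left; apply exp_pos|]. apply exp_le; lra. }
  assert (Ea : exp a <= exp 1) by (apply exp_le; lra).
  assert (E2 : exp 2 = exp 1 * exp 1) by (rewrite <- exp_plus; f_equal; ring).
  unfold eta'. rewrite E2.
  assert (F1 : Cmod (coef s f f1 z - La) * Cmod (ratio s z) <= eta * R1).
  { apply Rmult_le_compat; auto; apply Cmod_ge_0. }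
  assert (F2 : Cmod Lb * exp a * Cmod (Cexp err - 1) <= Cmod Lb * exp 1 * (ep * exp 1)).
  { apply Rmult_le_compat; auto; [|apply Cmod_ge_0|apply Rmult_le_compat_l; lra].
    apply Rmult_le_pos; [lra|left; apply exp_pos]. }
  lra. }
destruct (min_modulus (fun u => G (zz u))
  (fun u => (- / gp * ((f1 (zz u) - slope (negb s) (zz u) * f (zz u)) * Cexp (- phase (negb s) (zz u))))%C))
  as [a [b [Ha [Hb Hz]]]].
- intros u. apply (CD_comp G zz); [apply reduced_CD; auto|apply Czz].
(* The derivative of G is a nonzero multiple of [coef s], which stays within [eta] of La and so does
   not vanish. *)
- intros a b Ha Hb. destruct (H a b Ha Hb) as [H1 [H2 _]].
  change (z1 + - ((a, b) - Ci * th) / gp)%C with (zz (a, b)) in *. set (z := zz (a, b)) in *.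
  assert (Gz := gap_neq_0 s z H1).
  assert (Na : coef s f f1 z <> 0).
  { intros E. rewrite E in H2. replace (0 - La)%C with (- La)%C in H2 by ring. rewrite Cmod_opp in H2. lra. }
  intros E. apply Na. unfold coef.
  assert (N1 := Cexp_neq_0 (- phase (negb s) z)).
  assert (E1 : (f1 z - slope (negb s) z * f z = 0)%C).
  { replace (f1 z - slope (negb s) z * f z)%C with
     ((- / gp * ((f1 z - slope (negb s) z * f z) * Cexp (- phase (negb s) z))) * (- gp / Cexp (- phase (negb s) z)))%C by (field; auto).
    rewrite E. ring. }
  replace (slope (negb s) z * f z - f1 z)%C with (- (f1 z - slope (negb s) z * f z))%C by ring.
  rewrite E1. unfold Cdiv; ring.
(* At the origin |G| <= eta', on the boundary |G| >= |Lb| / 9 - eta'; hence the requirement eta' <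
   |Lb| / 18. *)
- intros a b Ha Hb Hbd.
  assert (A0 := Approx 0 0 ltac:(lra) ltac:(lra)).
  change (0, 0) with (RtoC 0) in A0. rewrite Cexp_0 in A0.
  replace (G (zz 0) - Lb * (1 - 1))%C with (G (zz 0)) in A0 by ring.
  assert (A := Approx a b Ha Hb). assert (Bd := one_minus_Cexp_boundary a b Ha Hb Hbd).
  assert (T := Cmod_triangle_rev (Lb * (1 - Cexp (a, b))) (Lb * (1 - Cexp (a, b)) - G (zz (a, b)))).
  replace (Lb * (1 - Cexp (a, b)) - (Lb * (1 - Cexp (a, b)) - G (zz (a, b))))%C with (G (zz (a, b))) in T by ring.
  replace (Lb * (1 - Cexp (a, b)) - G (zz (a, b)))%C with (- (G (zz (a, b)) - Lb * (1 - Cexp (a, b))))%C in T by ring.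
  rewrite Cmod_opp, Cmod_mult in T.
  assert (Cmod Lb * / 9 <= Cmod Lb * Cmod (1 - Cexp (a, b))) by (apply Rmult_le_compat_l; lra).
  lra.
- exists a, b. split; auto. split; auto.
  change (f (zz (a, b)) = 0). unfold G in Hz.
  replace (f (zz (a, b))) with (f (zz (a, b)) * Cexp (- phase (negb s) (zz (a, b))) / Cexp (- phase (negb s) (zz (a, b))))%C
    by (field; apply Cexp_neq_0).
  rewrite Hz. unfold Cdiv; ring.
Qed.

Lemma half_period_pos : 0 < PI / m.
Proof. assert (Hm := wm_pos). apply Rdiv_lt_0_compat; [apply PI_RGT_0|lra]. Qed.

Lemma center_next (s : bool) (y0 : R) : center s y0 -> center (negb s) (y0 + PI / m).
Proof.
unfold center. intros H. assert (Hm := wm_pos).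
replace (m * (y0 + PI / m)) with (m * y0 + PI) by (field; lra).
rewrite neg_cos, sgn_negb. lra.
Qed.

Section Zeros.
Context (s : bool) (f f1 : C -> C) (y0 B : R) (La Lb : C).
Context (Hs : solves f f1) (Hc : center s y0).
Context (HA : forall x, base <= x -> Cmod (coef s f f1 (x, y0) - La) <= B * exp (- x)).
Context (HB : forall x, base <= x -> Cmod (coef (negb s) f f1 (x, y0 + PI / m) - Lb) <= B * exp (- x)).

(** Data are given on both rays and K = 1 treats the two signs alike. The bounds are good where the
    ratio is neither large nor small, which is where the exponentials balance. *)
Lemma dominant_strip : exists B', 0 <= B' /\ forall x t, vbase <= x -> 0 <= t <= PI / m ->
  Cmod (coef s f f1 (x, y0 + t) - La) <= B' * exp (- x) * Rmax 1 (/ Cmod (ratio s (x, y0 + t))) /\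
  Cmod (coef (negb s) f f1 (x, y0 + t) - Lb) <= B' * exp (- x) * Rmax 1 (Cmod (ratio s (x, y0 + t))).
Proof.
assert (VP := vrate_pos). assert (PB := Rabs_pos B).
assert (PLa := Cmod_ge_0 La). assert (PLb := Cmod_ge_0 Lb).
set (M0 := 2 * (Cmod La + Rabs B + (Cmod Lb + Rabs B))).
assert (HM0 : 0 <= M0) by (unfold M0; lra).
exists (vrate * M0 + Rabs B). split; [nra|].
intros x t Hx Ht. assert (V := vbase_ge). assert (Hbk := base_ge).
assert (VS := vrate_small x Hx).
assert (Q1 := vertical_const_ge_1). assert (R1 := rate_ge_1). assert (Hpm := half_period_pos).
assert (Pe := exp_pos (- x)).
assert (E1 : exp (- x) <= 1) by (rewrite <- exp_0; apply exp_le; lra).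
assert (V4 := vertical_estimate s f f1 y0 1 x 1 Hs Hc (or_introl eq_refl) ltac:(lra) Rlt_0_1).
cbv zeta in V4.
set (d := vertical_const * (rate * exp (- x) * (PI / m))) in *.
assert (Hd : d <= vrate * exp (- x)).
{ unfold vrate, d. set (Q := vertical_const) in *.
  assert (0 <= rate * exp (- x) * (PI / m)) by (apply Rmult_le_pos; [nra|lra]).
  replace (Q * Q * (rate * (PI / m)) * exp (- x)) with (Q * (Q * (rate * exp (- x) * (PI / m)))) by ring.
  apply Rmult_le_compat_l; [lra|]. nra. }
assert (Hd0 : 0 <= d).
{ unfold d. apply Rmult_le_pos; [lra|]. apply Rmult_le_pos; [nra|lra]. }
specialize (V4 ltac:(lra)). destruct (V4 t Ht) as [E E'].
replace (y0 + 1 * t) with (y0 + t) in E, E' by ring.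
replace (y0 + 1 * (PI / m)) with (y0 + PI / m) in E, E' by ring.
assert (A0 := HA x ltac:(lra)). assert (B0 := HB x ltac:(lra)).
assert (AB := Rle_abs B).
assert (BB : B * exp (- x) <= Rabs B * exp (- x)) by (apply Rmult_le_compat_r; lra).
assert (BB1 : Rabs B * exp (- x) <= Rabs B) by nra.
assert (T1 := Cmod_triangle_rev (coef s f f1 (x, y0)) La).
assert (T2 := Cmod_triangle_rev (coef (negb s) f f1 (x, y0 + PI / m)) Lb).
set (M := 2 * (Cmod (coef s f f1 (x, y0)) + Cmod (coef (negb s) f f1 (x, y0 + PI / m)) / 1)) in *.
assert (HM : M <= M0) by (unfold M, M0; lra).
assert (HMp : 0 <= M).
{ unfold M. assert (U1 := Cmod_ge_0 (coef s f f1 (x, y0))). assert (U2 := Cmod_ge_0 (coef (negb s) f f1 (x, y0 + PI / m))). lra. }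
assert (dM : d * M <= vrate * M0 * exp (- x)).
{ replace (vrate * M0 * exp (- x)) with (vrate * exp (- x) * M0) by ring. apply Rmult_le_compat; auto. }
split.
- set (r := Rmax 1 (/ Cmod (ratio s (x, y0 + t)))). 
  assert (Hr : 1 <= r) by apply Rmax_l.
  replace (1 / Cmod (ratio s (x, y0 + t))) with (/ Cmod (ratio s (x, y0 + t))) in E by (unfold Rdiv; ring).
  fold r in E.
  replace (coef s f f1 (x, (y0 + t)%R) - La)%C with
    ((coef s f f1 (x, (y0 + t)%R) - coef s f f1 (x, y0)) + (coef s f f1 (x, y0) - La))%C by ring.
  eapply Rle_trans; [apply Cmod_triangle|].
  apply Rle_trans with (vrate * M0 * exp (- x) * r + Rabs B * exp (- x) * r); [|right; ring].
  apply Rplus_le_compat.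
  + eapply Rle_trans; [exact E|]. apply Rmult_le_compat_r; lra.
  + eapply Rle_trans; [exact A0|]. assert (0 <= Rabs B * exp (- x)) by nra. nra.
- set (r := Rmax 1 (Cmod (ratio s (x, y0 + t)))) in *.
  assert (Hr : 1 <= r) by apply Rmax_l.
  replace (coef (negb s) f f1 (x, (y0 + t)%R) - Lb)%C with
    ((coef (negb s) f f1 (x, (y0 + t)%R) - coef (negb s) f f1 (x, (y0 + PI / m)%R))
      + (coef (negb s) f f1 (x, (y0 + PI / m)%R) - Lb))%C by ring.
  eapply Rle_trans; [apply Cmod_triangle|].
  apply Rle_trans with (vrate * M0 * exp (- x) * r + Rabs B * exp (- x) * r); [|right; ring].
  apply Rplus_le_compat.
  + eapply Rle_trans; [exact E'|]. apply Rmult_le_compat_r; lra.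
  + eapply Rle_trans; [exact B0|]. assert (0 <= Rabs B * exp (- x)) by nra. nra.
Qed.

Lemma level_point (x R0 : R) : R0 < Cmod (ratio s (x, y0)) ->
  Cmod (ratio s (x, y0 + PI / m)) < R0 ->
  exists t, 0 <= t <= PI / m /\ Cmod (ratio s (x, y0 + t)) = R0.
Proof.
intros H0 H1. assert (Hpm := half_period_pos).
assert (Hpt : forall t : R, ((x, y0) + t * Ci)%C = (x, y0 + t)) by (intros; apply C_eq; simpl; ring).
set (F := fun t : R => R0 - Cmod (ratio s ((x, y0) + t * Ci))).
assert (CF : continuity F).
{ intros t. apply continuity_pt_minus; [apply continuity_pt_const; intros ? ?; reflexivity|].
  eapply PD_cont. apply (CD_path (ratio s) (x, y0) Ci t). unfold ratio.
  apply CD_Cexp_comp. apply CD_minus; apply CD_phase. }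
destruct (IVT F 0 (PI / m) CF Hpm) as [t [Ht E]].
- unfold F. rewrite Hpt, Rplus_0_r. lra.
- unfold F. rewrite Hpt. lra.
- exists t. split; auto. unfold F in E. rewrite Hpt in E. lra.
Qed.

(** At [z1], found by the intermediate value theorem, the terms La [ratio] and Lb have equal
    modulus; [th] is the phase by which they fail to cancel. *)
Lemma zeros_near : La <> 0 -> Lb <> 0 -> exists X, forall x, X <= x -> exists z, f z = 0 /\
  Rabs (Re z - x) <= 6 * exp (- x) /\ y0 <= Im z <= y0 + PI / m.
Proof.
intros HLa HLb.
assert (PLa : 0 < Cmod La) by (apply Cmod_gt_0; auto).
assert (PLb : 0 < Cmod Lb) by (apply Cmod_gt_0; auto).
set (R0 := Cmod Lb / Cmod La). assert (HR0 : 0 < R0) by (apply Rdiv_lt_0_compat; auto).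
destruct dominant_strip as [B' [HB' Est]].
assert (Hpm := half_period_pos). assert (Hm := wm_pos).
assert (E7 := exp_pos 7).
(* The local variable has modulus at most 2 + PI <= 6 and the Taylor error is below 1, so near [z1]
   the ratio changes by a factor between exp(-7) and exp 7. The 36 below is 6 squared. *)
destruct (ray_ratio_large s y0 (R0 * exp 7) Hc) as [X1 HX1].
destruct (ray_ratio_large (negb s) (y0 + PI / m) (exp 7 / R0) (center_next _ _ Hc)) as [X2 HX2].
destruct (decay_lt 6 1 Rlt_0_1) as [X3 HX3].
assert (CT : 0 <= taylor_const).
{ unfold taylor_const. assert (P := exp_pos 2). assert (P1 := exp_pos 1). assert (Q := Cmod_ge_0 c1). nra. }
destruct (decay_lt (36 * taylor_const) 1 Rlt_0_1) as [X4 HX4].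
set (K0 := 1 + exp 7 / R0 + R0 * exp 7).
assert (HK0 : 1 <= K0).
{ unfold K0. assert (0 < exp 7 / R0) by (apply Rdiv_lt_0_compat; auto). assert (0 < R0 * exp 7) by (apply Rmult_lt_0_compat; auto). lra. }
set (ec := B' * exp 1 * K0).
destruct (decay_lt ec (Cmod La) PLa) as [X5 HX5].
destruct (decay_lt (ec * (R0 * exp 7 + 1) + Cmod Lb * exp 2 * (36 * taylor_const)) (Cmod Lb / 18)) as [X6 HX6]; [lra|].
exists (Rmax (Rmax (Rmax X1 X2 + 1) (Rmax X3 X4)) (Rmax (Rmax X5 X6) (vbase + 1))).
intros x Hx.
assert (L1 := Rle_trans _ _ _ (Rmax_l _ _) Hx). assert (L2 := Rle_trans _ _ _ (Rmax_r _ _) Hx).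
assert (L11 := Rle_trans _ _ _ (Rmax_l _ _) L1). assert (L12 := Rle_trans _ _ _ (Rmax_r _ _) L1).
assert (L21 := Rle_trans _ _ _ (Rmax_l _ _) L2). assert (L22 := Rle_trans _ _ _ (Rmax_r _ _) L2).
assert (M1 := Rmax_l X1 X2). assert (M2 := Rmax_r X1 X2).
assert (HX3' := HX3 x (Rle_trans _ _ _ (Rmax_l _ _) L12)).
assert (HX4' := HX4 x (Rle_trans _ _ _ (Rmax_r _ _) L12)).
assert (HX5' := HX5 x (Rle_trans _ _ _ (Rmax_l _ _) L21)).
assert (HX6' := HX6 x (Rle_trans _ _ _ (Rmax_r _ _) L21)).
assert (V := vbase_ge). assert (Hbk := base_ge).
assert (G1 : forall x', x - 1 <= x' -> R0 * exp 7 < Cmod (ratio s (x', y0))) by (intros; apply HX1; lra).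
assert (G2 : forall x', x - 1 <= x' -> Cmod (ratio s (x', y0 + PI / m)) < R0 / exp 7).
{ intros x' Hx'. assert (H := HX2 x' ltac:(lra)). rewrite ratio_negb, Cmod_inv in H by apply ratio_neq_0.
  assert (P := ratio_pos s (x', y0 + PI / m)). set (r := Cmod (ratio s (x', y0 + PI / m))) in *.
  apply Rmult_lt_reg_r with (/ r * (exp 7 / R0)).
  - apply Rmult_lt_0_compat; [apply Rinv_0_lt_compat; auto|apply Rdiv_lt_0_compat; auto].
  - replace (r * (/ r * (exp 7 / R0))) with (exp 7 / R0) by (field; lra).
    replace (R0 / exp 7 * (/ r * (exp 7 / R0))) with (/ r) by (field; lra). exact H. }
assert (E71 : 1 <= exp 7) by (apply exp_ge_1; lra).
destruct (level_point x R0) as [t0 [Ht0 HR]].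
{ assert (U := G1 x ltac:(lra)). nra. }
{ eapply Rlt_le_trans; [apply G2; lra|]. apply Rmult_le_reg_r with (exp 7); auto.
  replace (R0 / exp 7 * exp 7) with R0 by (field; lra). nra. }
set (z1 := (x, y0 + t0) : C) in *.
destruct (unit_polar (- (La * ratio s z1 / Lb))%C) as [th [Hth Hq]].
{ rewrite Cmod_opp, Cmod_div, Cmod_mult, HR by auto. unfold R0. field. lra. }
assert (Hg := gap_neq_0 s z1 ltac:(simpl; lra)). set (gp := gap s z1) in *.
assert (Hgl : exp x <= Cmod gp).
{ apply Rle_trans with (exp (m * x)); [apply exp_le; nra|]. apply (gap_ge s z1). simpl. lra. }
assert (Hgl2 : exp (m * x) <= Cmod gp) by (apply (gap_ge s z1); simpl; lra).
assert (Pgp : 0 < Cmod gp) by (apply Cmod_gt_0; auto).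
assert (Pex := exp_pos x).
assert (Near : forall w, Cmod (gp * w) <= 6 -> Cmod w <= 6 * exp (- x) /\
   Cmod (phase_diff s (z1 + w) - phase_diff s z1 + gp * w) <= 36 * taylor_const * exp (- x) /\
   R0 / exp 7 <= Cmod (ratio s (z1 + w)) <= R0 * exp 7).
{ intros w Hw. rewrite Cmod_mult in Hw. assert (Pw := Cmod_ge_0 w).
  assert (W1 : Cmod w <= 6 * exp (- x)).
  { rewrite exp_Ropp. apply Rmult_le_reg_r with (exp x); auto.
    rewrite Rmult_assoc, Rinv_l by lra. nra. }
  assert (W2 : Cmod (phase_diff s (z1 + w) - phase_diff s z1 + gp * w) <= 36 * taylor_const * exp (- x)).
  { eapply Rle_trans; [apply phase_diff_taylor; simpl; lra|]. simpl (Re z1).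
    apply Rle_trans with (taylor_const * (Cmod gp * (Cmod w * Cmod w))).
    - rewrite Rmult_assoc. apply Rmult_le_compat_l; auto. apply Rmult_le_compat_r; auto. nra.
    - replace (36 * taylor_const * exp (- x)) with (taylor_const * (6 * (6 * exp (- x)))) by ring.
      apply Rmult_le_compat_l; auto. rewrite <- Rmult_assoc. apply Rmult_le_compat; auto. nra. }
  split; auto. split; auto.
  set (er := (phase_diff s (z1 + w) - phase_diff s z1 + gp * w)%C) in *.
  assert (ER : ratio s (z1 + w) = (ratio s z1 * Cexp (er - gp * w))%C).
  { unfold ratio. rewrite <- Cexp_plus. f_equal. unfold er, phase_diff. ring. }
  rewrite ER, Cmod_mult, HR, Cmod_Cexp.
  assert (Re7 : Rabs (Re (er - gp * w)%C) <= 7).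
  { eapply Rle_trans; [apply re_le_Cmod|]. unfold Cminus. eapply Rle_trans; [apply Cmod_triangle|].
    rewrite Cmod_opp, Cmod_mult. lra. }
  apply Rabs_le_between in Re7. split.
  - unfold Rdiv. rewrite <- exp_Ropp. apply Rmult_le_compat_l; [lra|]. apply exp_le; lra.
  - apply Rmult_le_compat_l; [lra|]. apply exp_le; lra. }
(* If z1 + w lay outside the strip, the segment from z1 would meet a bounding ray, where the ratio
   is above R0 exp 7 or below R0 exp(-7), against [Near]. *)
assert (InStrip : forall w, Cmod (gp * w) <= 6 -> y0 <= Im (z1 + w)%C <= y0 + PI / m).
{ intros w Hw.
  assert (Sc : forall tau, 0 <= tau <= 1 -> Cmod (gp * (tau * w)) <= 6).
  { intros tau Htau. rewrite !Cmod_mult in *. rewrite Cmod_R, Rabs_pos_eq by lra.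
    assert (Pw := Cmod_ge_0 w). assert (0 <= Cmod gp * Cmod w) by nra. nra. }
  assert (Sx : forall tau, 0 <= tau <= 1 -> x - 1 <= x + tau * Re w).
  { intros tau Htau. destruct (Near w Hw) as [W _]. assert (Q := re_le_Cmod w).
    assert (Q2 : Rabs (Re w) <= 1) by lra. apply Rabs_le_between in Q2. nra. }
  change (Im (z1 + w)%C) with (y0 + t0 + Im w).
  split; apply Rnot_lt_le; intros L.
  - set (tau := t0 / - Im w).
    assert (Htau : 0 <= tau <= 1).
    { unfold tau. split.
      - apply Rmult_le_pos; [lra|]. left; apply Rinv_0_lt_compat; lra.
      - apply Rmult_le_reg_r with (- Im w); [lra|]. unfold Rdiv; rewrite Rmult_assoc, Rinv_l; lra. }
    destruct (Near (tau * w)%C (Sc tau Htau)) as [_ [_ [_ U]]].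
    replace (z1 + tau * w)%C with ((x + tau * Re w, y0) : C) in U.
    + assert (U2 := G1 (x + tau * Re w) (Sx tau Htau)). lra.
    + apply C_eq; unfold z1, tau; simpl; unfold Re, Im in *; field; lra.
  - set (tau := (PI / m - t0) / Im w).
    assert (Htau : 0 <= tau <= 1).
    { unfold tau. split.
      - apply Rmult_le_pos; [lra|]. left; apply Rinv_0_lt_compat; lra.
      - apply Rmult_le_reg_r with (Im w); [lra|]. unfold Rdiv at 1; rewrite Rmult_assoc, Rinv_l; lra. }
    destruct (Near (tau * w)%C (Sc tau Htau)) as [_ [_ [U _]]].
    replace (z1 + tau * w)%C with ((x + tau * Re w, y0 + PI / m) : C) in U.
    + assert (U2 := G2 (x + tau * Re w) (Sx tau Htau)). lra.
    + apply C_eq; unfold z1, tau; simpl; unfold Re, Im in *; field; lra. }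
assert (Hw6 : forall a b, -1 <= a <= 1 -> -1 <= b <= 1 ->
   Cmod (gp * (- ((a, b) - Ci * th) / gp)) <= 6).
{ intros a b Ha Hb.
  replace (gp * (- ((a, b) - Ci * th) / gp))%C with (Ci * th - (a, b))%C by (field; auto).
  unfold Cminus. eapply Rle_trans; [apply Cmod_triangle|].
  rewrite Cmod_opp, Cmod_mult, Cmod_Ci, Cmod_R.
  assert (T := Cmod_pair_le a b). assert (P4 := PI_4).
  assert (Rabs a <= 1) by (apply Rabs_le; lra). assert (Rabs b <= 1) by (apply Rabs_le; lra).
  assert (Rabs th <= PI) by (apply Rabs_le; lra). lra. }
assert (Pen := exp_pos (- x)).
destruct (local_zero s f f1 La Lb z1 th (ec * exp (- x)) (R0 * exp 7) (36 * taylor_const * exp (- x)))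
  as [a [b [Ha [Hb Hz]]]]; auto.
- simpl; lra.
- rewrite <- Hq. field. auto.
- split; [|lra]. apply Rmult_le_pos; lra.
- unfold ec. apply Rmult_le_pos; [|lra]. apply Rmult_le_pos; [|lra]. assert (P := exp_pos 1). nra.
- intros a b Ha Hb w. fold gp in w. assert (W6 := Hw6 a b Ha Hb). fold w in W6.
  destruct (Near w W6) as [N1 [N2 [N3 N4]]]. assert (IS := InStrip w W6).
  assert (Rw : x - 1 <= Re (z1 + w)%C).
  { change (Re (z1 + w)%C) with (x + Re w). assert (Q := re_le_Cmod w).
    assert (Q2 : Rabs (Re w) <= 1) by lra. apply Rabs_le_between in Q2. lra. }
  set (x' := Re (z1 + w)%C) in *. set (t := Im (z1 + w)%C - y0).
  assert (Ez : (z1 + w)%C = (x', y0 + t)) by (apply C_eq; unfold x', t; simpl; ring).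
  destruct (Est x' t) as [S1 S2]; [lra|unfold t; lra|].
  rewrite <- Ez in S1, S2. set (r := Cmod (ratio s (z1 + w))) in *.
  assert (Pr : 0 < r) by apply ratio_pos.
  assert (Ex : exp (- x') <= exp 1 * exp (- x)) by (rewrite <- exp_plus; apply exp_le; lra).
  assert (Pex' := exp_pos (- x')).
  assert (Hk1 : Rmax 1 (/ r) <= K0).
  { unfold K0. apply Rmax_lub.
    - assert (0 < exp 7 / R0) by (apply Rdiv_lt_0_compat; auto). nra.
    - apply Rle_trans with (exp 7 / R0); [|nra].
      replace (exp 7 / R0) with (/ (R0 / exp 7)) by (field; lra).
      apply Rinv_le_contravar; auto. apply Rdiv_lt_0_compat; auto. }
  assert (Hk2 : Rmax 1 r <= K0).
  { unfold K0. assert (0 < exp 7 / R0) by (apply Rdiv_lt_0_compat; auto).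
    apply Rmax_lub; nra. }
  assert (HBe : B' * exp (- x') <= B' * (exp 1 * exp (- x))) by (apply Rmult_le_compat_l; auto).
  assert (HBe0 : 0 <= B' * exp (- x')) by nra.
  assert (Rk1 := Rmax_l 1 (/ r)). assert (Rk2 := Rmax_l 1 r).
  split; [lra|]. repeat split; auto.
  + eapply Rle_trans; [exact S1|]. unfold ec.
    replace (B' * exp 1 * K0 * exp (- x)) with (B' * (exp 1 * exp (- x)) * K0) by ring.
    apply Rmult_le_compat; auto; lra.
  + eapply Rle_trans; [exact S2|]. unfold ec.
    replace (B' * exp 1 * K0 * exp (- x)) with (B' * (exp 1 * exp (- x)) * K0) by ring.
    apply Rmult_le_compat; auto; lra.
- eapply Rle_lt_trans; [|exact HX6']. right; ring.
- exists (z1 + - ((a, b) - Ci * th) / gp)%C. split; [exact Hz|].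
  assert (W6 := Hw6 a b Ha Hb). destruct (Near _ W6) as [N1 _].
  split; [|apply InStrip; auto].
  eapply Rle_trans; [|exact N1]. eapply Rle_trans; [|apply re_le_Cmod].
  right. f_equal. change (Re (z1 + - ((a, b) - Ci * th) / gp)%C) with (x + Re (- ((a, b) - Ci * th) / gp)%C). ring.
Qed.
End Zeros.

(** * The Floquet multiplier *)

Lemma wm_Z : exists n : Z, m = IZR n.
Proof. unfold m; destruct (wm_cases D) as [-> | ->]; [exists 1%Z|exists 2%Z]; reflexivity. Qed.

Lemma Cexp_m_shift (z : C) : Cexp (m * (z + period)) = Cexp (m * z).
Proof. destruct wm_Z as [n ->]. apply (Cexp_Z_shift n). Qed.

Lemma Cexp_shift (z : C) : Cexp (z + period) = Cexp z.
Proof. rewrite Cexp_plus, Cexp_period. ring. Qed.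

Lemma slope_shift (s : bool) (z : C) : slope s (z + period) = slope s z.
Proof. unfold slope. rewrite Cexp_m_shift, Cexp_shift. reflexivity. Qed.

Lemma gap_shift (s : bool) (z : C) : gap s (z + period) = gap s z.
Proof. unfold gap. rewrite !slope_shift. reflexivity. Qed.

Lemma phase_shift (s : bool) (z : C) : phase s (z + period) = (phase s z + g s * period)%C.
Proof. unfold phase. rewrite Cexp_m_shift, Cexp_shift. ring. Qed.

Lemma wA_shift (z : C) : wA D (z + period) = wA D z.
Proof.
assert (R1 := w_riccati D true z). assert (R2 := w_riccati D true (z + period)).
fold m in R1, R2. rewrite Cexp_m_shift, Cexp_shift in R2. rewrite R1 in R2.
assert (E : (wA D z = wA D z + (we1 D true * Cexp z + we0 D true) - (we1 D true * Cexp z + we0 D true))%C) by ring.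
rewrite E, R2. ring.
Qed.

Lemma solves_shift (f f1 : C -> C) : solves f f1 ->
  solves (fun z => f (z + period)%C) (fun z => f1 (z + period)%C).
Proof.
intros H z. destruct (H (z + period)%C) as [H1 H2]. split.
- apply CD_shift; auto.
- rewrite <- wA_shift. apply CD_shift. exact H2.
Qed.

Lemma solves_sub (f f1 h h1 : C -> C) (mu : C) : solves f f1 -> solves h h1 ->
  solves (fun z => f z - mu * h z)%C (fun z => f1 z - mu * h1 z)%C.
Proof.
intros H K z. destruct (H z) as [H1 H2]. destruct (K z) as [K1 K2]. split.
- eapply CD_ext_l; [apply CD_minus; [exact H1|apply CD_mult; [apply CD_const|exact K1]]|]. cbv beta; ring.
- eapply CD_ext_l; [apply CD_minus; [exact H2|apply CD_mult; [apply CD_const|exact K2]]|]. cbv beta; ring.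
Qed.

Lemma coef_sub (s : bool) (f f1 h h1 : C -> C) (mu z : C) :
  coef s (fun z => f z - mu * h z)%C (fun z => f1 z - mu * h1 z)%C z =
  (coef s f f1 z - mu * coef s h h1 z)%C.
Proof. unfold coef, Cdiv. ring. Qed.

Lemma coef_shift (s : bool) (f f1 : C -> C) (z : C) :
  coef s (fun z => f (z + period)%C) (fun z => f1 (z + period)%C) z =
  (Cexp (g s * period) * coef s f f1 (z + period))%C.
Proof.
unfold coef. rewrite slope_shift, gap_shift, phase_shift.
replace (- (phase s z + g s * period))%C with (- phase s z + - (g s * period))%C by ring.
rewrite Cexp_plus, (Cexp_opp (g s * period)). unfold Cdiv. generalize (Cinv (gap s z)). intros u. field. apply Cexp_neq_0.
Qed.

(** Decay of the first coefficient gives the second a limit that vanishes only for f = 0, and decay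
    of the second makes that limit 0. One ray thus determines a solution, the tool for both the
    Floquet relation and the final identification. *)
Lemma subdominant_unique (s : bool) (f f1 : C -> C) (y0 B0 B1 X : R) :
  solves f f1 -> center s y0 ->
  (forall x, base <= x -> Cmod (coef s f f1 (x, y0)) <= B0 * exp (- x)) ->
  (forall x, X <= x -> Cmod (coef (negb s) f f1 (x, y0)) <= B1 * exp (- x)) ->
  forall z, f z = 0.
Proof.
intros Hs Hc H0 H1. destruct (subdominant_strip s f f1 y0 B0 Hs Hc H0) as [L [B [HL HB]]].
apply HL. apply Cmod_eq_0. apply Rle_antisym; [|apply Cmod_ge_0].
apply (decay_le _ _ (B + B1) (Rmax X vbase)). intros x Hx.
assert (L1 := Rle_trans _ _ _ (Rmax_l _ _) Hx). assert (L2 := Rle_trans _ _ _ (Rmax_r _ _) Hx).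
specialize (H1 x L1).
assert (Hp := half_period_pos).
destruct (HB x 1 0 L2 (or_introl eq_refl) ltac:(lra)) as [_ E].
replace (y0 + 1 * 0) with y0 in E by ring.
assert (T := Cmod_triangle_rev L (L - coef (negb s) f f1 (x, y0))).
replace (L - (L - coef (negb s) f f1 (x, y0)))%C with (coef (negb s) f f1 (x, y0)) in T by ring.
replace (L - coef (negb s) f f1 (x, y0))%C with (- (coef (negb s) f f1 (x, y0) - L))%C in T by ring.
rewrite Cmod_opp in T. lra.
Qed.

Section Finite.
Context (f f1 : C -> C) (Hs : solves f f1).
Context (Hne : exists z, f z <> 0) (Hfin : Rbar_lt (exponent_of_convergence f) p_infty).

(** The exponential s is the larger one on this ray, but its coefficient in f tends to 0. *)
Definition subdominant (s : bool) (y0 : R) : Prop :=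
  center s y0 /\ exists B0, forall x, base <= x -> Cmod (coef s f f1 (x, y0)) <= B0 * exp (- x).

(** [e] selects the upper or the lower half of the strip of half-width PI / m around the ray. *)
Definition strip_limit (s : bool) (y0 : R) (L : C) : Prop :=
  exists B, forall x e t, vbase <= x -> e = 1 \/ e = -1 -> 0 <= t <= PI / m ->
      Cmod (coef s f f1 (x, y0 + e * t)) * Cmod (ratio s (x, y0 + e * t)) <= B * exp (- x) /\
      Cmod (coef (negb s) f f1 (x, y0 + e * t) - L) <= B * exp (- x).

Lemma subdominant_limit_exists (s : bool) (y0 : R) : subdominant s y0 ->
  exists L : C, L <> 0 /\ strip_limit s y0 L.
Proof.
intros [Hc [B0 HB]]. destruct (subdominant_strip s f f1 y0 B0 Hs Hc HB) as [L [B [HL H]]].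
exists L. split; [|exists B; exact H].
intros E. destruct Hne as [z Hz]. apply Hz, HL, E.
Qed.

Lemma no_two_dominant (s : bool) (y0 B : R) (La Lb : C) : center s y0 ->
  (forall x, base <= x -> Cmod (coef s f f1 (x, y0) - La) <= B * exp (- x)) ->
  (forall x, base <= x -> Cmod (coef (negb s) f f1 (x, y0 + PI / m) - Lb) <= B * exp (- x)) ->
  La = 0 \/ Lb = 0.
Proof.
intros Hc HA HB. apply NNPP. intros N.
destruct (zeros_near s f f1 y0 B La Lb Hs Hc HA HB) as [X HX]; [tauto|tauto|].
apply (zeros_along_strip_infinite_order f X (Rabs y0 + PI / m)); auto.
intros x Hx. destruct (HX x Hx) as [z [Z1 [Z2 Z3]]]. exists z. split; auto. split; auto.
assert (Hp := half_period_pos).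
assert (A := Rle_abs y0). assert (A' := Rle_abs (- y0)). rewrite Rabs_Ropp in A'.
apply Rabs_le; lra.
Qed.

(** On the adjacent rays at heights 0 and PI / m both dominant coefficients have limits, and the
    zero count excludes that both are nonzero. *)
Lemma subdominant_exists : exists s y0, subdominant s y0.
Proof.
assert (C0 : center true 0).
{ unfold center. rewrite Rmult_0_r, cos_0. simpl. ring. }
assert (C1 := center_next true 0 C0).
destruct (ray_limit true f f1 0 Hs C0) as [La [Ba HA]].
destruct (ray_limit false f f1 (0 + PI / m) Hs C1) as [Lb [Bb HB]].
destruct (common_limit_bound _ _ _ _ _ _ _ (proj2 (base_ge)) HA HB) as [HA' HB'].
destruct (no_two_dominant true 0 (Rmax Ba Bb) La Lb C0 HA' HB') as [E|E].
- exists true, 0. split; auto. exists Ba. apply (limit_bound _ La Ba _ E HA).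
- exists false, (0 + PI / m). split; auto. exists Bb. apply (limit_bound _ Lb Bb _ E HB).
Qed.

(** On the ray PI / m higher the sign [negb s] dominates with limit L, which is nonzero, so one ray
    further the coefficient of sign s must tend to 0. The two strips share the middle ray, hence
    have the same L. *)
Lemma subdominant_next (s : bool) (y0 : R) (L : C) : subdominant s y0 -> strip_limit s y0 L -> L <> 0 ->
  subdominant s (y0 + 2 * (PI / m)) /\ strip_limit s (y0 + 2 * (PI / m)) L.
Proof.
intros [Hc HB] [B HL] HL0.
assert (C1 := center_next s y0 Hc).
assert (C2 := center_next (negb s) _ C1). rewrite Bool.negb_involutive in C2.
replace (y0 + PI / m + PI / m) with (y0 + 2 * (PI / m)) in C2 by ring.
assert (Hp := half_period_pos).
destruct (ray_limit (negb s) f f1 _ Hs C1) as [La [Ba HA]].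
assert (E : La = L).
{ apply (limit_unique _ La L Ba B base vbase HA). intros x Hx.
  destruct (HL x 1 (PI / m) Hx (or_introl eq_refl) ltac:(lra)) as [_ E].
  replace (y0 + 1 * (PI / m)) with (y0 + PI / m) in E by ring. exact E. }
subst La.
destruct (ray_limit s f f1 _ Hs C2) as [Lb [Bb HB2]].
destruct (common_limit_bound _ _ _ _ _ _ _ (proj2 (base_ge)) HA HB2) as [HA' HB'].
assert (N := no_two_dominant (negb s) (y0 + PI / m) (Rmax Ba Bb) L Lb C1 HA').
rewrite Bool.negb_involutive in N.
replace (y0 + PI / m + PI / m) with (y0 + 2 * (PI / m)) in N by ring.
destruct (N HB') as [Z|Z]; [contradiction|].
assert (Sub : subdominant s (y0 + 2 * (PI / m))).
{ split; auto. exists Bb. apply (limit_bound _ Lb Bb _ Z HB2). }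
split; auto.
destruct (subdominant_limit_exists s _ Sub) as [L' [_ [B' HL']]].
assert (E : L' = L).
{ apply (limit_unique (fun x => coef (negb s) f f1 (x, y0 + PI / m)) L' L B' B vbase vbase).
  - intros x Hx. destruct (HL' x (-1) (PI / m) Hx (or_intror eq_refl) ltac:(lra)) as [_ E].
    replace (y0 + 2 * (PI / m) + -1 * (PI / m)) with (y0 + PI / m) in E by ring. exact E.
  - intros x Hx. destruct (HL x 1 (PI / m) Hx (or_introl eq_refl) ltac:(lra)) as [_ E].
    replace (y0 + 1 * (PI / m)) with (y0 + PI / m) in E by ring. exact E. }
subst L'. exists B'. exact HL'.
Qed.

Lemma strip_limit_reduced (s : bool) (y0 : R) (L : C) : strip_limit s y0 L ->
  exists B, forall x y, vbase <= x -> y0 - PI / m <= y <= y0 + PI / m ->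
    Cmod (f (x, y) * Cexp (- phase (negb s) (x, y)) - L) <= B * exp (- x).
Proof.
intros [B HB]. exists (B + B). intros x y Hx Hy.
assert (V := vbase_ge). assert (Hb := base_ge).
assert (G := gap_neq_0 s (x, y) ltac:(simpl; lra)).
rewrite (coef_reduced s f f1 (x, y) G).
assert (K : Cmod (coef s f f1 (x, y)) * Cmod (ratio s (x, y)) <= B * exp (- x) /\
      Cmod (coef (negb s) f f1 (x, y) - L) <= B * exp (- x)).
{ destruct (Rle_or_lt y0 y) as [H|H].
  - assert (K := HB x 1 (y - y0) Hx (or_introl eq_refl) ltac:(lra)).
    replace (y0 + 1 * (y - y0)) with y in K by ring. exact K.
  - assert (K := HB x (-1) (y0 - y) Hx (or_intror eq_refl) ltac:(lra)).
    replace (y0 + -1 * (y0 - y)) with y in K by ring. exact K. }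
destruct K as [K1 K2].
replace (coef s f f1 (x, y) * ratio s (x, y) + coef (negb s) f f1 (x, y) - L)%C with
  (coef s f f1 (x, y) * ratio s (x, y) + (coef (negb s) f f1 (x, y) - L))%C by ring.
eapply Rle_trans; [apply Cmod_triangle|]. rewrite Cmod_mult. lra.
Qed.

Lemma asymptotics : exists s y0 ya (L : C) B B0,
  L <> 0 /\ center s y0 /\
  (forall x, base <= x -> Cmod (coef s f f1 (x, y0)) <= B0 * exp (- x)) /\
  (forall x, vbase <= x -> Cmod (coef (negb s) f f1 (x, y0) - L) <= B * exp (- x)) /\
  (forall x y, vbase <= x -> ya <= y <= ya + 2 * PI ->
    Cmod (f (x, y) * Cexp (- phase (negb s) (x, y)) - L) <= B * exp (- x)) /\
  (forall z, f (z + period)%C = (Cexp (g (negb s) * period) * f z)%C).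
Proof.
destruct subdominant_exists as [s [y0 H0]].
destruct (subdominant_limit_exists s y0 H0) as [L [HL H0L]].
assert (Hp := half_period_pos).
destruct (subdominant_next s y0 L H0 H0L HL) as [H1 H1L].
assert (Full : subdominant s (y0 + 2 * PI) /\ strip_limit s (y0 + 2 * PI) L /\
  exists B, forall x y, vbase <= x -> y0 - PI / m <= y <= y0 - PI / m + 2 * PI ->
    Cmod (f (x, y) * Cexp (- phase (negb s) (x, y)) - L) <= B * exp (- x)).
{ destruct (strip_limit_reduced s y0 L H0L) as [B HB].
  (* A strip has width 2 PI / m: for m = 1 it is a full period, for m = 2 two consecutive strips are
     joined. *)
  destruct (wm_cases D) as [E|E]; fold m in E.
  - rewrite E in *. replace (PI / 1) with PI in * by field.
    split; [exact H1|]. split; [exact H1L|]. exists B. intros x y Hx Hy. apply HB; lra.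
  - destruct (subdominant_next s _ L H1 H1L HL) as [H2 H2L].
    destruct (strip_limit_reduced s _ L H1L) as [B' HB'].
    rewrite E in *.
    replace (y0 + 2 * (PI / 2) + 2 * (PI / 2)) with (y0 + 2 * PI) in H2, H2L by field.
    split; [exact H2|]. split; [exact H2L|]. exists (Rmax B B'). intros x y Hx Hy.
    assert (Pe := exp_pos (- x)).
    destruct (Rle_or_lt y (y0 + PI / 2)) as [Q|Q].
    + eapply Rle_trans; [apply HB; auto; lra|]. apply Rmult_le_compat_r; [lra|apply Rmax_l].
    + eapply Rle_trans; [apply HB'; auto; lra|]. apply Rmult_le_compat_r; [lra|apply Rmax_r]. }
destruct Full as [[_ [B2 HB2]] [[B3 HB3] [B4 HB4]]].
destruct H0 as [Hc [B0 HB0]]. destruct H0L as [B1 HB1].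
assert (Ray0 : forall x, vbase <= x -> Cmod (coef (negb s) f f1 (x, y0) - L) <= B1 * exp (- x)).
{ intros x Hx. destruct (HB1 x 1 0 Hx (or_introl eq_refl) ltac:(lra)) as [_ E].
  replace (y0 + 1 * 0) with y0 in E by ring. exact E. }
assert (Ray1 : forall x, vbase <= x -> Cmod (coef (negb s) f f1 (x, y0 + 2 * PI) - L) <= B3 * exp (- x)).
{ intros x Hx. destruct (HB3 x 1 0 Hx (or_introl eq_refl) ltac:(lra)) as [_ E].
  replace (y0 + 2 * PI + 1 * 0) with (y0 + 2 * PI) in E by ring. exact E. }
assert (Hpt : forall x, ((x, y0) + period)%C = (x, y0 + 2 * PI)).
{ intros x. unfold period. apply C_eq; simpl; ring. }
(* The difference is again a solution. On the ray y0 its coefficient of sign s decays, as y0 and y0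
   + 2 PI are both subdominant; its other coefficient decays because both limits equal L and the
   multiplier is the one that [Cexp (phase (negb s))] acquires over a period. *)
assert (Fl : forall z, (f (z + period) - Cexp (g (negb s) * period) * f z = 0)%C).
{ set (mu := Cexp (g (negb s) * period)). set (nu := Cexp (g s * period)).
  assert (Pmu := Cmod_ge_0 mu). assert (Pnu := Cmod_ge_0 nu).
  apply (subdominant_unique s (fun z => f (z + period) - mu * f z)%C (fun z => f1 (z + period) - mu * f1 z)%C
    y0 (Cmod nu * B2 + Cmod mu * B0) (Cmod mu * B3 + Cmod mu * B1) vbase); auto.
  - apply (solves_sub (fun z => f (z + period)%C) (fun z => f1 (z + period)%C)); auto.
    apply solves_shift; auto.
  - intros x Hx. rewrite (coef_sub s (fun z => f (z + period)%C) (fun z => f1 (z + period)%C)).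
    rewrite coef_shift, Hpt. fold nu. unfold Cminus. eapply Rle_trans; [apply Cmod_triangle|].
    rewrite Cmod_opp, !Cmod_mult, Rmult_plus_distr_r, !Rmult_assoc.
    apply Rplus_le_compat; apply Rmult_le_compat_l; auto.
  - intros x Hx. rewrite (coef_sub (negb s) (fun z => f (z + period)%C) (fun z => f1 (z + period)%C)).
    rewrite coef_shift, Hpt. fold mu.
    replace (mu * coef (negb s) f f1 (x, (y0 + 2 * PI)%R) - mu * coef (negb s) f f1 (x, y0))%C with
      (mu * (coef (negb s) f f1 (x, (y0 + 2 * PI)%R) - L) + - (mu * (coef (negb s) f f1 (x, y0) - L)))%C by ring.
    eapply Rle_trans; [apply Cmod_triangle|].
    rewrite Cmod_opp, !Cmod_mult, Rmult_plus_distr_r, !Rmult_assoc.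
    apply Rplus_le_compat; apply Rmult_le_compat_l; auto. }
exists s, y0, (y0 - PI / m), L, (Rmax B1 B4), B0.
repeat split; auto.
- intros x Hx. eapply Rle_trans; [apply Ray0; auto|]. apply Rmult_le_compat_r; [left; apply exp_pos|apply Rmax_l].
- intros x y Hx Hy. eapply Rle_trans; [apply HB4; auto|]. apply Rmult_le_compat_r; [left; apply exp_pos|apply Rmax_r].
- intros z. specialize (Fl z).
  replace (f (z + period)%C) with (f (z + period) - Cexp (g (negb s) * period) * f z + Cexp (g (negb s) * period) * f z)%C by ring.
  rewrite Fl. ring.
Qed.
End Finite.

(** * The Fourier representation of the solution *)

Section Reduced.

Context (M : Z) (HM : m = IZR M).
Context (f f1 : C -> C) (Hs : solves f f1) (s : bool).
Context (Hper : forall z, f (z + period)%C = (Cexp (g s * period) * f z)%C).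

(** In this section s is the sign of the exponential that f follows, hence the negation of the sign
    that is subdominant above. *)
Definition red (z : C) : C := (f z * Cexp (- phase s z))%C.
Definition red1 (z : C) : C := ((f1 z - slope s z * f z) * Cexp (- phase s z))%C.
Definition red2 (z : C) : C := (- (2 * slope s z * red1 z + defect s z * red z))%C.

Lemma entire_red : entire red red1.
Proof. intros z. apply reduced_CD; auto. Qed.

Lemma entire_red1 : entire red1 red2.
Proof.
intros z. destruct (Hs z) as [H1 H2]. assert (R := w_riccati D s z). fold m c1 g in R.
eapply CD_ext_l.
- apply CD_mult.
  + apply CD_minus; [exact H2|apply CD_mult; [apply CD_slope|exact H1]].
  + apply CD_Cexp_comp, CD_opp, CD_phase.
- cbv beta. unfold red2, red1, red, defect.
  fold (slope s z) in R.
  set (d := (sgn s * (m * Cexp (m * z) + c1 * Cexp z))%C) in *.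
  assert (E : wA D z = (slope s z * slope s z + d - (we1 D s * Cexp z + we0 D s))%C).
  { change (sgn s * (Cexp (m * z) + c1 * Cexp z) + g s)%C with (slope s z) in R. rewrite R. ring. }
  rewrite E. ring.
Qed.

Lemma smooth_slope : smooth (slope s).
Proof. eexists. intros z. apply CD_slope. Qed.

Lemma smooth_defect : smooth (defect s).
Proof.
unfold defect. apply smooth_plus; [apply smooth_scal; eexists; intros z; apply CD_Cexp|].
exists (fun _ => RtoC 0). intros z; apply CD_const.
Qed.

Lemma smooth_red : smooth red. Proof. eexists; apply entire_red. Qed.
Lemma smooth_red1 : smooth red1. Proof. eexists; apply entire_red1. Qed.

Lemma smooth_red2 : smooth red2.
Proof.
destruct (smooth_scal (- (1))%C _ (smooth_plus _ _ (smooth_scal 2 _ (smooth_mult _ _ smooth_slope smooth_red1))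
   (smooth_mult _ _ smooth_defect smooth_red))) as [F HF].
exists F. intros z. eapply CD_ext; [|apply HF]. intros w. unfold red2. simpl. ring.
Qed.

Lemma red_periodic : periodic red.
Proof.
intros z. unfold red. rewrite Hper, phase_shift.
replace (- (phase s z + g s * period))%C with (- phase s z + - (g s * period))%C by ring.
rewrite Cexp_plus, (Cexp_opp (g s * period)). field. apply Cexp_neq_0.
Qed.

Lemma f1_shift (z : C) : f1 (z + period)%C = (Cexp (g s * period) * f1 z)%C.
Proof.
destruct (Hs (z + period)%C) as [H1 _]. destruct (Hs z) as [H2 _].
assert (K1 := CD_shift f z period _ H1).
assert (K2 : CD (fun z => f (z + period)%C) z (Cexp (g s * period) * f1 z)%C).
{ apply (CD_ext (fun z => Cexp (g s * period) * f z)%C); [intros; symmetry; apply Hper|].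
  eapply CD_ext_l; [apply CD_mult; [apply CD_const|exact H2]|]. cbv beta; ring. }
rewrite <- (is_C_derive_unique _ _ _ K1). apply (is_C_derive_unique _ _ _ K2).
Qed.

Lemma red1_periodic : periodic red1.
Proof.
intros z. unfold red1. rewrite Hper, f1_shift, phase_shift, slope_shift.
replace (- (phase s z + g s * period))%C with (- phase s z + - (g s * period))%C by ring.
rewrite Cexp_plus, (Cexp_opp (g s * period)). field. apply Cexp_neq_0.
Qed.

(** This is the n-th Fourier coefficient of red'' + 2 slope red' + defect red = 0: differentiation
    multiplies by the index, and the factors exp(m z) and exp z lower it by M and by 1. *)
Lemma fcoef_recurrence (ya : R) (n : Z) (x : R) :
  ((n * n + 2 * g s * n + we0 D s) * fcoef ya red n x
   + (2 * sgn s * c1 * (n - 1) + we1 D s) * fcoef ya red (n - 1) x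
   + 2 * sgn s * (n - M) * fcoef ya red (n - M) x = 0)%C.
Proof.
assert (D1 : forall k, fcoef ya red1 k x = (k * fcoef ya red k x)%C).
{ intros k. apply (fcoef_derivative ya red red1 red2); [apply entire_red|apply entire_red1|apply red_periodic]. }
assert (D2 : fcoef ya red2 n x = (n * fcoef ya red1 n x)%C).
{ destruct smooth_red2 as [r3 Hr3].
  apply (fcoef_derivative ya red1 red2 r3); [apply entire_red1|exact Hr3|apply red1_periodic]. }
assert (S0 := smooth_red). assert (S1 := smooth_red1).
assert (SM := smooth_mode).
assert (D3 : fcoef ya red2 n x =
  (- (2 * sgn s) * fcoef ya red1 (n - M) x + (- (2 * sgn s * c1) * fcoef ya red1 (n - 1) x
   + (- (2 * g s) * fcoef ya red1 n x + (- we1 D s * fcoef ya red (n - 1) x + - we0 D s * fcoef ya red n x))))%C).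
{ unfold fcoef.
  rewrite (vmean_ext ya _ (fun z => (- (2 * sgn s)) * (red1 z * mode (n - M) z) + ((- (2 * sgn s * c1)) * (red1 z * mode (n - 1) z)
   + ((- (2 * g s)) * (red1 z * mode n z) + ((- we1 D s) * (red z * mode (n - 1) z) + (- we0 D s) * (red z * mode n z)))))%C).
  - assert (A1 := fun k => smooth_mult _ _ S1 (SM k)). assert (A0 := fun k => smooth_mult _ _ S0 (SM k)).
    assert (B5 := smooth_scal (- we0 D s) _ (A0 n)). assert (B4 := smooth_scal (- we1 D s) _ (A0 (n - 1)%Z)).
    assert (B3 := smooth_scal (- (2 * g s)) _ (A1 n)). assert (B2 := smooth_scal (- (2 * sgn s * c1)) _ (A1 (n - 1)%Z)).
    assert (B1 := smooth_scal (- (2 * sgn s)) _ (A1 (n - M)%Z)).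
    assert (C4 := smooth_plus _ _ B4 B5). assert (C3 := smooth_plus _ _ B3 C4). assert (C2 := smooth_plus _ _ B2 C3).
    rewrite (vmean_plus_smooth ya _ _ x B1 C2), (vmean_plus_smooth ya _ _ x B2 C3), (vmean_plus_smooth ya _ _ x B3 C4), (vmean_plus_smooth ya _ _ x B4 B5).
    rewrite (vmean_scal_smooth ya _ _ x (A0 n)), (vmean_scal_smooth ya _ _ x (A0 (n - 1)%Z)), (vmean_scal_smooth ya _ _ x (A1 n)),
      (vmean_scal_smooth ya _ _ x (A1 (n - 1)%Z)), (vmean_scal_smooth ya _ _ x (A1 (n - M)%Z)). reflexivity.
  - intros z. rewrite <- !mode_shift. unfold red2, slope, defect. rewrite HM.
    change (RtoC (IZR M)) with (ZtoC M). change (ZtoC 1) with (RtoC 1). rewrite Cmult_1_l. ring. }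
rewrite D2, !D1 in D3. rewrite !ZtoC_minus in D3. change (ZtoC 1) with (RtoC 1) in D3.
set (a := fcoef ya red n x) in *. set (b := fcoef ya red (n - 1) x) in *. set (c := fcoef ya red (n - M) x) in *.
replace ((n * n + 2 * g s * n + we0 D s) * a + (2 * sgn s * c1 * (n - 1) + we1 D s) * b + 2 * sgn s * (n - M) * c)%C
 with (n * (n * a) - (- (2 * sgn s) * ((n - M) * c) + (- (2 * sgn s * c1) * ((n - 1) * b) + (- (2 * g s) * (n * a)
   + (- we1 D s * b + - we0 D s * a)))))%C by ring.
rewrite D3. ring.
Qed.
End Reduced.

Lemma wA_left_bounded : exists BA, 0 <= BA /\ forall z, Re z <= 0 -> Cmod (wA D z) <= BA.
Proof.
assert (Hm := wm_pos).
set (P := 1 + Cmod c1 + Cmod (g true)).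
assert (Q1 := Cmod_ge_0 c1). assert (Q2 := Cmod_ge_0 (g true)).
assert (Q3 := Cmod_ge_0 (we1 D true)). assert (Q4 := Cmod_ge_0 (we0 D true)).
exists (P * P + (2 + Cmod c1) + (Cmod (we1 D true) + Cmod (we0 D true))).
split; [unfold P; nra|]. intros z Hz.
assert (R := w_riccati D true z). fold m c1 g in R. simpl sgn in R.
assert (E1 : Cmod (Cexp z) <= 1) by (rewrite Cmod_Cexp, <- exp_0; apply exp_le; auto).
assert (E2 : Cmod (Cexp (m * z)) <= 1).
{ rewrite Cmod_Cexp, <- exp_0. apply exp_le. rewrite Re_RtoC_mult. nra. }
set (e := Cexp z) in *. set (em := Cexp (m * z)) in *.
assert (Ce : Cmod (c1 * e) <= Cmod c1).
{ rewrite Cmod_mult. rewrite <- (Rmult_1_r (Cmod c1)) at 2. apply Rmult_le_compat_l; auto. }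
assert (Sl : Cmod (1 * (em + c1 * e) + g true) <= P).
{ rewrite Cmult_1_l. unfold P. eapply Rle_trans; [apply Cmod_triangle|]. apply Rplus_le_compat_r.
  eapply Rle_trans; [apply Cmod_triangle|]. lra. }
set (p := (1 * (em + c1 * e) + g true)%C) in *.
assert (Dp : Cmod (1 * (m * em + c1 * e)) <= 2 + Cmod c1).
{ rewrite Cmult_1_l. eapply Rle_trans; [apply Cmod_triangle|]. rewrite Cmod_mult, Cmod_R, Rabs_pos_eq by lra.
  assert (Pm := Cmod_ge_0 em). nra. }
set (dp := (1 * (m * em + c1 * e))%C) in *.
assert (De : Cmod (we1 D true * e + we0 D true) <= Cmod (we1 D true) + Cmod (we0 D true)).
{ eapply Rle_trans; [apply Cmod_triangle|]. rewrite Cmod_mult. nra. }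
replace (wA D z) with (p * p + dp + - (we1 D true * e + we0 D true))%C by (rewrite R; ring).
eapply Rle_trans; [apply Cmod_triangle|]. rewrite Cmod_opp.
apply Rplus_le_compat; auto. eapply Rle_trans; [apply Cmod_triangle|]. rewrite Cmod_mult.
apply Rplus_le_compat; auto. apply Rmult_le_compat; auto; apply Cmod_ge_0.
Qed.

Lemma segment_growth (f f1 : C -> C) (z0 w : C) (T BA : R) : solves f f1 -> Cmod w = 1 -> 0 <= T -> 0 <= BA ->
  (forall t : R, 0 <= t <= T -> Cmod (wA D (z0 + t * w)) <= BA) ->
  Cmod (f (z0 + T * w)%C) ^ 2 + Cmod (f1 (z0 + T * w)%C) ^ 2 <=
  (Cmod (f z0) ^ 2 + Cmod (f1 z0) ^ 2) * exp (2 * (1 + BA) * T).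
Proof.
intros Hs Hw HT HB HA.
assert (G := gronwall (fun t : R => f (z0 + t * w)%C) (fun t : R => w * f1 (z0 + t * w))%C
  (fun t : R => f1 (z0 + t * w)%C) (fun t : R => w * (wA D (z0 + t * w) * f (z0 + t * w)))%C (1 + BA) T HT ltac:(lra)).
cbv beta in G. rewrite Cmult_0_l, Cplus_0_r in G. apply G.
- intros t _. apply CD_path, Hs.
- intros t _. apply CD_path, Hs.
- intros t _. rewrite Cmod_mult, Hw. assert (P := Cmod_ge_0 (f1 (z0 + t * w)%C)). nra.
- intros t Ht. rewrite !Cmod_mult, Hw, Rmult_1_l. apply Rmult_le_compat_r; [apply Cmod_ge_0|].
  specialize (HA t Ht). lra.
Qed.

(** [wA] is bounded for Re z <= 0, so Gronwall applies first along the imaginary axis over one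
    period and then leftwards; the phase contributes at most linear growth to the exponent. *)
Lemma red_left_growth (f f1 : C -> C) (s : bool) (ya : R) : solves f f1 ->
  exists (N : nat) (K : R), forall x y, x <= 0 -> ya <= y <= ya + 2 * PI ->
    Cmod (red f s (x, y)) <= K * exp (INR N * - x).
Proof.
intros Hs. destruct wA_left_bounded as [BA [HB HA]]. assert (Ppi := PI_RGT_0).
set (c := 1 + BA). set (E0 := Cmod (f (0, ya)) ^ 2 + Cmod (f1 (0, ya)) ^ 2).
assert (HE0 : 0 <= E0).
{ unfold E0. assert (U1 := pow2_ge_0 (Cmod (f (0, ya)))). assert (U2 := pow2_ge_0 (Cmod (f1 (0, ya)))). lra. }
(* The added 1 gives K1 <= K1^2, so that the bound on |f|^2 yields one on |f| without a square
   root. *)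
set (K1 := E0 * exp (2 * c * (2 * PI)) + 1).
assert (HK1 : 1 <= K1).
{ unfold K1. assert (P := exp_pos (2 * c * (2 * PI))). nra. }
assert (GF : forall x y, x <= 0 -> ya <= y <= ya + 2 * PI -> Cmod (f (x, y)) <= K1 * exp (c * - x)).
{ intros x y Hx Hy.
  assert (V := segment_growth f f1 (0, ya) Ci (y - ya) BA Hs Cmod_Ci ltac:(lra) HB).
  replace ((0, ya) + (y - ya)%R * Ci)%C with ((0, y) : C) in V by (apply C_eq; simpl; ring).
  assert (V' : Cmod (f (0, y)) ^ 2 + Cmod (f1 (0, y)) ^ 2 <= K1).
  { eapply Rle_trans; [apply V; intros t _; apply HA; simpl; lra|]. fold E0 c. unfold K1.
    assert (exp (2 * c * (y - ya)) <= exp (2 * c * (2 * PI))) by (apply exp_le; unfold c; nra). nra. }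
  assert (H := segment_growth f f1 (0, y) (-1)%R (- x) BA Hs ltac:(rewrite Cmod_R, Rabs_left; lra) ltac:(lra) HB).
  replace ((0, y) + (- x)%R * (-1)%R)%C with ((x, y) : C) in H by (apply C_eq; simpl; ring).
  assert (H' : Cmod (f (x, y)) ^ 2 + Cmod (f1 (x, y)) ^ 2 <= K1 * exp (2 * c * - x)).
  { eapply Rle_trans; [apply H; intros t Ht; apply HA; simpl; lra|]. fold c.
    apply Rmult_le_compat_r; [left; apply exp_pos|auto]. }
  assert (Pe := exp_pos (c * - x)).
  apply Rsqr_incr_0; [|apply Cmod_ge_0|nra]. unfold Rsqr.
  assert (E2 : exp (2 * c * - x) = exp (c * - x) * exp (c * - x)) by (rewrite <- exp_plus; f_equal; ring).
  rewrite E2 in H'. assert (U := pow2_ge_0 (Cmod (f1 (x, y)))).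
  assert (U2 : K1 * (exp (c * - x) * exp (c * - x)) <= K1 * exp (c * - x) * (K1 * exp (c * - x))).
  { replace (K1 * exp (c * - x) * (K1 * exp (c * - x))) with (K1 * (exp (c * - x) * exp (c * - x)) * K1) by ring.
    assert (0 <= exp (c * - x) * exp (c * - x)) by nra.
    rewrite <- (Rmult_1_r (K1 * (exp (c * - x) * exp (c * - x)))) at 1.
    apply Rmult_le_compat_l; nra. }
  simpl in H', U. lra. }
set (b := Cmod (g s)). assert (Hb : 0 <= b) by apply Cmod_ge_0.
set (K2 := exp (1 + Cmod c1 + b * (Rabs ya + 2 * PI))).
destruct (nfloor_ex (c + b)) as [N [_ HN]]; [unfold c; lra|].
exists (S N), (K1 * K2). intros x y Hx Hy. unfold red. rewrite Cmod_mult, Cmod_Cexp.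
assert (Hm := wm_pos).
assert (Ph : Re (- phase s (x, y))%C <= 1 + Cmod c1 + b * (Rabs ya + 2 * PI) + b * - x).
{ eapply Rle_trans; [apply Rle_abs|]. eapply Rle_trans; [apply re_le_Cmod|]. rewrite Cmod_opp.
  unfold phase. eapply Rle_trans; [apply Cmod_triangle|].
  rewrite !Cmod_mult, Cmod_R, Rabs_sgn, Rmult_1_l. fold b.
  assert (T1 : Cmod (Cexp (m * (x, y)) / m + c1 * Cexp (x, y)) <= 1 + Cmod c1).
  { eapply Rle_trans; [apply Cmod_triangle|]. rewrite Cmod_mult, Cmod_div, !Cmod_Cexp, Cmod_R, Rabs_pos_eq by (try apply (wm_neq_0); lra).
    rewrite Re_RtoC_mult. simpl Re.
    assert (exp (m * x) <= 1) by (rewrite <- exp_0; apply exp_le; nra).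
    assert (exp x <= 1) by (rewrite <- exp_0; apply exp_le; lra).
    apply Rplus_le_compat.
    - apply Rmult_le_reg_r with m; [lra|]. unfold Rdiv; rewrite Rmult_assoc, Rinv_l by lra. lra.
    - rewrite <- (Rmult_1_r (Cmod c1)) at 2. apply Rmult_le_compat_l; auto. apply Cmod_ge_0. }
  assert (T2 : Cmod (x, y) <= - x + (Rabs ya + 2 * PI)).
  { eapply Rle_trans; [apply Cmod_pair_le|]. rewrite Rabs_left1 by auto. apply Rplus_le_compat_l.
    assert (A := Rle_abs ya). assert (A' := Rle_abs (- ya)). rewrite Rabs_Ropp in A'.
    apply Rabs_le; lra. }
  assert (b * Cmod (x, y) <= b * (- x + (Rabs ya + 2 * PI))) by (apply Rmult_le_compat_l; auto).
  lra. }
apply Rle_trans with (K1 * exp (c * - x) * (K2 * exp (b * - x))).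
- apply Rmult_le_compat; [apply Cmod_ge_0|left; apply exp_pos|apply GF; auto|].
  unfold K2. rewrite <- exp_plus. apply exp_le; auto.
- replace (K1 * exp (c * - x) * (K2 * exp (b * - x))) with (K1 * K2 * (exp (c * - x) * exp (b * - x))) by ring.
  rewrite <- exp_plus. apply Rmult_le_compat_l.
  + assert (P := exp_pos (1 + Cmod c1 + b * (Rabs ya + 2 * PI))). fold K2 in P. nra.
  + apply exp_le. rewrite S_INR. nra.
Qed.

Section Representation.

Context (M : Z) (HM : wm D = IZR M).

Definition recurrence (r : bool) (a : Z -> C) : Prop := forall n : Z,
  ((n * n + 2 * g r * n + we0 D r) * a n
   + (2 * sgn r * c1 * (n - 1) + we1 D r) * a (n - 1)%Z
   + 2 * sgn r * (n - M) * a (n - M)%Z = 0)%C.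

Section Laurent.
Context (r : bool) (k : nat) (a : Z -> C).
Context (Hsupp : forall n, (0 < n \/ n < - Z.of_nat k)%Z -> a n = 0) (Hrec : recurrence r a).
(** The window -k-2, ..., 2 leaves a margin of two around the support -k, ..., 0: two
    multiplications by exp z lose no term, and after a shift by k it starts at the index -2 of the
    final sums. *)
Let w0 := (- Z.of_nat k - 2)%Z.
Let n0 := (k + 5)%nat.
Let S0 := laurent w0 n0 a.
Let S1 := laurent w0 n0 (fun n => n * a n)%C.
Let S2 := laurent w0 n0 (fun n => n * (n * a n))%C.

Lemma M_cases : M = 1%Z \/ M = 2%Z.
Proof.
destruct (wm_cases D) as [E|E]; rewrite E in HM; [left|right]; apply eq_IZR; rewrite <- HM; reflexivity.
Qed.

Lemma laurent_shift_M (z : C) :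
  (Cexp (m * z) * S1 z)%C = laurent w0 n0 (fun n => (n - M)%Z * a (n - M)%Z)%C z.
Proof.
unfold m. rewrite HM. unfold S1.
assert (A : forall n, (0 < n \/ n < - Z.of_nat k)%Z -> (n * a n)%C = 0) by (intros n Hn; rewrite Hsupp by auto; ring).
destruct M_cases as [-> | ->].
- rewrite Cmult_1_l. apply (laurent_shift w0 n0 (fun n => n * a n)%C); apply A; unfold w0, n0; lia.
- replace (Cexp (2%R * z)) with (Cexp z * Cexp z)%C by (rewrite <- Cexp_plus; f_equal; ring).
  rewrite <- Cmult_assoc.
  rewrite (laurent_shift w0 n0 (fun n => n * a n)%C) by (apply A; unfold w0, n0; lia).
  rewrite (laurent_shift w0 n0 (fun n => (n - 1)%Z * a (n - 1)%Z)%C) by (apply A; unfold w0, n0; lia).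
  apply laurent_ext. intros n. replace (n - 1 - 1)%Z with (n - 2)%Z by lia. reflexivity.
Qed.

Lemma laurent_ode (z : C) : (S2 z + 2 * slope r z * S1 z + defect r z * S0 z)%C = 0.
Proof.
assert (A : forall n, (0 < n \/ n < - Z.of_nat k)%Z -> (n * a n)%C = 0) by (intros n Hn; rewrite Hsupp by auto; ring).
assert (X1 : (Cexp z * S1 z)%C = laurent w0 n0 (fun n => (n - 1)%Z * a (n - 1)%Z)%C z).
{ apply (laurent_shift w0 n0 (fun n => n * a n)%C); apply A; unfold w0, n0; lia. }
assert (X0 : (Cexp z * S0 z)%C = laurent w0 n0 (fun n => a (n - 1)%Z)%C z).
{ apply (laurent_shift w0 n0 a); apply Hsupp; unfold w0, n0; lia. }
transitivity (S2 z + (2 * sgn r * (Cexp (m * z) * S1 z) + (2 * sgn r * c1 * (Cexp z * S1 z)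
  + (2 * g r * S1 z + (we1 D r * (Cexp z * S0 z) + we0 D r * S0 z)))))%C.
{ unfold slope, defect. ring. }
rewrite X1, X0, laurent_shift_M. unfold S0, S1, S2.
rewrite !laurent_scal, !laurent_plus. apply laurent_zero. intros n. cbv beta.
rewrite <- (Hrec n). rewrite !ZtoC_minus. change (ZtoC 1) with (RtoC 1). ring.
Qed.

Definition wave (z : C) : C := (S0 z * Cexp (phase r z))%C.
Definition wave1 (z : C) : C := ((S1 z + S0 z * slope r z) * Cexp (phase r z))%C.

Lemma wave_solves : solves wave wave1.
Proof.
intros z. assert (R := w_riccati D r z). fold m c1 g in R.
assert (E0 : CD S0 z (S1 z)) by apply CD_laurent.
assert (E1 : CD S1 z (S2 z)) by apply (CD_laurent w0 n0 (fun n => n * a n)%C).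
assert (O := laurent_ode z).
assert (EP : CD (fun z => Cexp (phase r z)) z (slope r z * Cexp (phase r z))%C).
{ apply (CD_Cexp_comp (phase r)). apply CD_phase. }
split.
- eapply CD_ext_l; [apply CD_mult; [exact E0|exact EP]|]. unfold wave1. ring.
- eapply CD_ext_l.
  + apply CD_mult; [|exact EP]. apply CD_plus; [exact E1|apply CD_mult; [exact E0|apply CD_slope]].
  + cbv beta. unfold wave.
    set (d := (sgn r * (m * Cexp (m * z) + c1 * Cexp z))%C) in *.
    assert (E : wA D z = (slope r z * slope r z + d - defect r z)%C).
    { unfold defect. change (sgn r * (Cexp (m * z) + c1 * Cexp z) + g r)%C with (slope r z) in R. rewrite R. ring. }
    rewrite E.
    transitivity ((S2 z + 2 * slope r z * S1 z + defect r z * S0 z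
      + S0 z * (slope r z * slope r z + d - defect r z)) * Cexp (phase r z))%C; [ring|].
    rewrite O. ring.
Qed.

Lemma coef_wave_other (z : C) : gap (negb r) z <> 0 ->
  coef (negb r) wave wave1 z = (- (S1 z / gap (negb r) z) / ratio (negb r) z)%C.
Proof.
intros H. unfold coef, ratio. rewrite Bool.negb_involutive, Cexp_minus, Cexp_opp. unfold wave, wave1.
field. repeat split; auto using Cexp_neq_0.
Qed.

Lemma coef_wave_self (z : C) : gap r z <> 0 -> coef r wave wave1 z = (S0 z - S1 z / gap r z)%C.
Proof.
intros H. unfold coef. rewrite Cexp_opp. unfold wave, wave1. unfold gap in *.
field. split; auto using Cexp_neq_0.
Qed.

(** The coefficients n a_n of [S1] vanish for n >= 0, so [S1] decays and [S0] tends to a_0. Dividing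
    by the gap loses nothing, and dividing by the increasing ratio helps further. *)
Lemma wave_coef_bounds (y0 : R) : center (negb r) y0 ->
  exists B, (forall x, base <= x -> Cmod (coef (negb r) wave wave1 (x, y0)) <= B * exp (- x)) /\
    (forall x, base <= x -> Cmod (coef r wave wave1 (x, y0) - a 0%Z) <= B * exp (- x)).
Proof.
intros Hc.
destruct (laurent_decay w0 n0 (fun n => n * a n)%C y0) as [B1 HB1].
{ intros n Hn. destruct (Z.eq_dec n 0) as [-> |Hne].
  - unfold ZtoC. ring.
  - rewrite Hsupp by lia. ring. }
set (a' := fun n : Z => if Z.eq_dec n 0 then RtoC 0 else a n).
set (a0 := fun n : Z => if Z.eq_dec n 0 then a n else RtoC 0).
destruct (laurent_decay w0 n0 a' y0) as [B2 HB2].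
{ intros n Hn. unfold a'. destruct (Z.eq_dec n 0) as [E|Hne]; auto. apply Hsupp; lia. }
assert (HS0 : forall z, (S0 z - a 0%Z)%C = laurent w0 n0 a' z).
{ intros z. unfold S0. rewrite (laurent_ext w0 n0 a (fun n => a0 n + a' n)%C).
  - rewrite <- laurent_plus. rewrite (laurent_constant w0 n0 a0).
    + unfold a0. destruct (Z.eq_dec 0 0); [ring|congruence].
    + unfold w0, n0; lia.
    + intros n Hn. unfold a0. destruct (Z.eq_dec n 0); [congruence|auto].
  - intros n. unfold a0, a'. destruct (Z.eq_dec n 0); ring. }
assert (Hb := base_ge). assert (Hbk := bulk_ge_1). assert (Hm := wm_pos).
set (rb := Cmod (ratio (negb r) (base, y0))). assert (Prb : 0 < rb) by apply ratio_pos.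
assert (Gp : forall s x, base <= x -> gap s (x, y0) <> 0) by (intros; apply gap_neq_0; simpl; lra).
assert (Gl : forall s x, base <= x -> Cmod (S1 (x, y0) / gap s (x, y0)) <= B1 * exp (- x)).
{ intros s x Hx. specialize (HB1 x ltac:(lra)). fold S1 in HB1.
  rewrite Cmod_div by auto. assert (G := gap_ge s (x, y0) ltac:(simpl; lra)). simpl Re in G.
  assert (1 <= exp (m * x)) by (apply exp_ge_1; nra).
  assert (P := Cmod_ge_0 (S1 (x, y0))).
  apply Rmult_le_reg_r with (Cmod (gap s (x, y0))); [lra|].
  unfold Rdiv; rewrite Rmult_assoc, Rinv_l by lra.
  assert (0 <= B1 * exp (- x)) by lra. nra. }
assert (PB1 : 0 <= Rabs B1) by apply Rabs_pos.
exists (Rmax (B1 / rb) (B1 + B2)). split; intros x Hx; assert (Pe := exp_pos (- x)).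
- rewrite coef_wave_other by auto. rewrite Cmod_div by apply ratio_neq_0. rewrite Cmod_opp.
  assert (Mo : rb <= Cmod (ratio (negb r) (x, y0))) by (apply (ray_ratio); auto; lra).
  specialize (Gl (negb r) x Hx). assert (P := Cmod_ge_0 (S1 (x, y0) / gap (negb r) (x, y0))).
  apply Rle_trans with (B1 / rb * exp (- x)); [|apply Rmult_le_compat_r; [lra|apply Rmax_l]].
  replace (B1 / rb * exp (- x)) with (B1 * exp (- x) * / rb) by (field; lra).
  apply Rmult_le_compat; auto.
  + left; apply Rinv_0_lt_compat; lra.
  + apply Rinv_le_contravar; auto.
- rewrite coef_wave_self by auto.
  replace (S0 (x, y0) - S1 (x, y0) / gap r (x, y0) - a 0%Z)%C with
   ((S0 (x, y0) - a 0%Z) + - (S1 (x, y0) / gap r (x, y0)))%C by ring.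
  eapply Rle_trans; [apply Cmod_triangle|]. rewrite Cmod_opp, HS0.
  specialize (Gl r x Hx). specialize (HB2 x ltac:(lra)).
  apply Rle_trans with ((B1 + B2) * exp (- x)); [lra|]. apply Rmult_le_compat_r; [lra|apply Rmax_r].
Qed.
End Laurent.

Theorem representation (f f1 : C -> C) : solves f f1 -> (exists z, f z <> 0) ->
  Rbar_lt (exponent_of_convergence f) p_infty ->
  exists (r : bool) (k : nat) (a : Z -> C),
    a 0%Z <> 0 /\ a (- Z.of_nat k)%Z <> 0 /\
    (forall n, (0 < n \/ n < - Z.of_nat k)%Z -> a n = 0) /\
    recurrence r a /\
    forall z, f z = (laurent (- Z.of_nat k - 2) (k + 5) a z * Cexp (phase r z))%C.
Proof.
intros Hs Hne Hfin.
destruct (asymptotics f f1 Hs Hne Hfin) as [s [y0 [ya [L [B [B0 [HL [Hc [HA [HB [HG Hper]]]]]]]]]]].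
set (r := negb s) in *.
assert (Er : s = negb r) by (unfold r; rewrite Bool.negb_involutive; reflexivity).
assert (Ppi := PI_RGT_0).
set (G := red f r).
assert (EG := entire_red f f1 Hs r). assert (EG1 := entire_red1 f f1 Hs r).
assert (PG := red_periodic f r Hper). fold G in EG, PG.
assert (SG : smooth G) by (eexists; exact EG).
set (j := fcoef ya G).
assert (Jc : forall n x x', j n x = j n x') by (intros; apply (fcoef_constant ya G _ _ n x x' EG EG1 PG)).
assert (V := vbase_ge). assert (Hb := base_ge).
assert (Jpos : forall n x, (0 < n)%Z -> j n x = 0).
{ intros n x Hn. apply Cmod_eq_0. apply Rle_antisym; [|apply Cmod_ge_0].
  apply (decay_le _ _ (4 * PI * (Cmod L + Rabs B)) (vbase)). intros t Ht.
  rewrite (Jc n x t). rewrite Rplus_0_l.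
  assert (Bd := fcoef_bound ya G n t (Cmod L + Rabs B) SG). fold j in Bd.
  eapply Rle_trans; [apply Bd|].
  - intros y Hy. specialize (HG t y Ht Hy). fold (red f r (t, y)) in HG. fold G in HG.
    assert (T := Cmod_triangle_rev (G (t, y)) L).
    assert (exp (- t) <= 1) by (rewrite <- exp_0; apply exp_le; lra).
    assert (P := exp_pos (- t)). assert (AB := Rle_abs B). assert (AB' := Rabs_pos B).
    assert (B * exp (- t) <= Rabs B) by nra. lra.
  - rewrite <- Rmult_assoc. apply Rmult_le_compat_l.
    + assert (P1 := Cmod_ge_0 L). assert (P2 := Rabs_pos B). nra.
    + apply exp_le. assert (1 <= IZR n) by (apply IZR_le; lia). nra. }
(* Index 0 carries no weight, so the coefficient is 2 PI times the limit of G. As L is nonzero, the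
   leading coefficient of the sum is nonzero. *)
assert (J0 : forall x, j 0%Z x = (2 * PI * L)%C).
{ intros x. assert (E : (j 0%Z x - 2 * PI * L = 0)%C).
  { apply Cmod_eq_0. apply Rle_antisym; [|apply Cmod_ge_0].
    apply (decay_le _ _ (4 * PI * B) (vbase)). intros t Ht.
    rewrite (Jc 0%Z x t). rewrite Rplus_0_l.
    assert (SC : smooth (fun _ : C => (- L)%C)) by (exists (fun _ => RtoC 0); intros z; apply CD_const).
    assert (S' := smooth_plus _ _ (smooth_mult _ _ SG (smooth_mode 0)) SC).
    assert (Ev : (j 0%Z t - 2 * PI * L)%C = vmean ya (fun z => G z * mode 0 z + - L)%C t).
    { rewrite (vmean_plus_smooth ya _ _ t (smooth_mult _ _ SG (smooth_mode 0)) SC), vmean_const.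
      unfold j, fcoef. ring. }
    rewrite Ev. destruct S' as [F1 HF1].
    rewrite Rmult_assoc. apply (vmean_bound ya _ F1 t _ HF1). intros y Hy.
    specialize (HG t y Ht Hy). fold (red f r (t, y)) in HG. fold G in HG.
    replace (mode 0 (t, y)) with (RtoC 1).
    - replace (G (t, y) * 1 + - L)%C with (G (t, y) - L)%C by ring. exact HG.
    - unfold mode, ZtoC. replace (- (0%R * (t, y)))%C with (RtoC 0) by ring. symmetry; apply Cexp_0. }
  replace (j 0%Z x) with (j 0%Z x - 2 * PI * L + 2 * PI * L)%C by ring. rewrite E. ring. }
destruct (red_left_growth f f1 r ya Hs) as [N [K HK]]. fold G in HK.
assert (Jneg : forall n x, (n < - Z.of_nat N)%Z -> j n x = 0).
{ intros n x Hn. apply Cmod_eq_0. apply Rle_antisym; [|apply Cmod_ge_0].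
  apply (decay_le _ _ (4 * PI * Rabs K) 0). intros t Ht.
  rewrite (Jc n x (- t)). rewrite Rplus_0_l.
  assert (Bd := fcoef_bound ya G n (- t) (Rabs K * exp (INR N * t)) SG). fold j in Bd.
  eapply Rle_trans; [apply Bd|].
  - intros y Hy. eapply Rle_trans; [apply HK; [lra|exact Hy]|]. rewrite Ropp_involutive.
    apply Rmult_le_compat_r; [left; apply exp_pos|apply Rle_abs].
  - rewrite !Rmult_assoc. rewrite <- exp_plus.
    apply Rmult_le_compat_l; [lra|]. apply Rmult_le_compat_l; [lra|]. apply Rmult_le_compat_l; [apply Rabs_pos|].
    apply exp_le. assert (IZR n <= - INR N - 1).
    { rewrite INR_IZR_INZ, <- opp_IZR, <- minus_IZR. apply IZR_le; lia. }
    nra. }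
set (a := fun n => (j n 0 / (2 * PI))%C).
assert (P2 : (2 * PI)%C <> 0).
{ intros E. apply (f_equal Re) in E. simpl in E. lra. }
assert (Ha0 : a 0%Z = L) by (unfold a; rewrite J0; field; auto; intros E; apply P2; rewrite E; ring).
assert (Ha0' : a 0%Z <> 0) by (rewrite Ha0; auto).
destruct (lowest_index a N Ha0') as [k [Hk1 Hk2]].
{ intros n Hn. unfold a. rewrite Jneg by auto. unfold Cdiv; ring. }
assert (Hsupp : forall n, (0 < n \/ n < - Z.of_nat k)%Z -> a n = 0).
{ intros n [Hn|Hn]; [|auto]. unfold a. rewrite Jpos by auto. unfold Cdiv; ring. }
assert (Hrec : recurrence r a).
{ intros n. assert (R := fcoef_recurrence M HM f f1 Hs r Hper ya n 0).
  fold G j in R. unfold a.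
  transitivity (((n * n + 2 * g r * n + we0 D r) * j n 0 + (2 * sgn r * c1 * (n - 1) + we1 D r) * j (n - 1)%Z 0 +
      2 * sgn r * (n - M) * j (n - M)%Z 0) / (2 * PI))%C.
  - unfold Cdiv. ring.
  - rewrite R. unfold Cdiv; ring. }
exists r, k, a. split; auto. split; auto. split; auto. split; auto.
assert (Hv := wave_solves r k a Hsupp Hrec).
assert (Hc' : center (negb r) y0) by (rewrite <- Er; exact Hc).
destruct (wave_coef_bounds r k a Hsupp y0 Hc') as [B' [HB1 HB2]].
(* Comparing both coefficients on the single ray y0 identifies f with the finite sum without any
   convergence theorem for Fourier series. *)
assert (Z : forall z, (f z - 1 * wave r k a z)%C = 0).
{ apply (subdominant_unique s (fun z => f z - 1 * wave r k a z)%C (fun z => f1 z - 1 * wave1 r k a z)%C y0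
    (B0 + B') (B + B') (vbase)); auto.
  - apply solves_sub; auto.
  - intros x Hx. rewrite coef_sub. rewrite Cmult_1_l. unfold Cminus.
    eapply Rle_trans; [apply Cmod_triangle|]. rewrite Cmod_opp. specialize (HA x Hx).
    specialize (HB1 x Hx). rewrite <- Er in HB1. lra.
  - intros x Hx. fold r. rewrite coef_sub. rewrite Cmult_1_l.
    specialize (HB x Hx). specialize (HB2 x ltac:(lra)). rewrite Ha0 in HB2.
    replace (coef r f f1 (x, y0) - coef r (wave r k a) (wave1 r k a) (x, y0))%C with
     ((coef r f f1 (x, y0) - L) + - (coef r (wave r k a) (wave1 r k a) (x, y0) - L))%C by ring.
    eapply Rle_trans; [apply Cmod_triangle|]. rewrite Cmod_opp. lra. }
intros z. specialize (Z z).
replace (f z) with (f z - 1 * wave r k a z + 1 * wave r k a z)%C by ring. rewrite Z.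
unfold wave. ring.
Qed.
End Representation.
End Wkb.

(** * The three equations *)

Lemma Cexp_double (z : C) : Cexp (2 * z) = (Cexp z * Cexp z)%C.
Proof. rewrite <- Cexp_plus. f_equal. ring. Qed.

Lemma Cexp_triple (z : C) : Cexp (3 * z) = (Cexp z * Cexp z * Cexp z)%C.
Proof. rewrite <- !Cexp_plus. f_equal. ring. Qed.

Lemma Cexp_quadruple (z : C) : Cexp (4 * z) = (Cexp z * Cexp z * (Cexp z * Cexp z))%C.
Proof. rewrite <- !Cexp_plus. f_equal. ring. Qed.

(** For p = s e^z + g, p^2 + p' = e^(2z) + s (2g + 1) e^z + g^2; matching e^z gives g = (s b2 - 1) /
    2 and the constant defect g^2 - b3. *)
Definition wkb_12 (b2 b3 : C) : wkb.
Proof.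
refine {| wm := 1; wc := 0;
  wg := fun s => ((sgn s * b2 - 1) / 2)%C;
  we1 := fun s => 0;
  we0 := fun s => ((sgn s * b2 - 1) / 2 * ((sgn s * b2 - 1) / 2) - b3)%C;
  wA := fun z => (Cexp (2%Z * z) + b2 * Cexp (1%Z * z) + b3)%C |}.
- left; reflexivity.
- left; reflexivity.
- intros s; left; reflexivity.
- intros s z. change (ZtoC 2) with (RtoC 2). change (ZtoC 1) with (RtoC 1).
  rewrite Cexp_double, !Cmult_1_l. destruct s; simpl sgn; [|replace (RtoC (-1)) with (- (1))%C by (rewrite <- RtoC_opp; f_equal; lra)]; field;
    intros E; apply RtoC_inj in E; lra.
Defined.

(** For p = s e^(2z) + g the coefficient of e^(2z) in p^2 + p' is 2 s (g + 1), so g = -1; the term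
    b2 e^z is of lower order and goes into the defect. *)
Definition wkb_14 (b2 b3 : C) : wkb.
Proof.
refine {| wm := 2; wc := 0;
  wg := fun s => (- (1))%C;
  we1 := fun s => (- b2)%C;
  we0 := fun s => (1 - b3)%C;
  wA := fun z => (Cexp (4%Z * z) + b2 * Cexp (1%Z * z) + b3)%C |}.
- right; reflexivity.
- left; reflexivity.
- intros s; right; reflexivity.
- intros s z. change (ZtoC 4) with (RtoC 4). change (ZtoC 1) with (RtoC 1).
  rewrite Cexp_double, Cexp_quadruple, !Cmult_1_l. destruct s; simpl sgn; [|replace (RtoC (-1)) with (- (1))%C by (rewrite <- RtoC_opp; f_equal; lra)]; ring.
Defined.

(** For p = s (e^(2z) + c1 e^z) + g, matching e^(3z) gives c1 = b2 / 2, and cancelling c1^2 + 2 s (g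
    + 1) at e^(2z) gives g = -1 - s b2^2 / 8. The terms in e^z and the constant form the defect. *)
Definition wkb_34 (b2 b3 : C) : wkb.
Proof.
refine {| wm := 2; wc := (b2 / 2)%C;
  wg := fun s => (- (1) - sgn s * (b2 * b2 / 8))%C;
  we1 := fun s => ((2 * (- (1) - sgn s * (b2 * b2 / 8)) * sgn s + sgn s) * (b2 / 2))%C;
  we0 := fun s => ((- (1) - sgn s * (b2 * b2 / 8)) * (- (1) - sgn s * (b2 * b2 / 8)) - b3)%C;
  wA := fun z => (Cexp (4%Z * z) + b2 * Cexp (3%Z * z) + b3)%C |}.
- right; reflexivity.
- right; reflexivity.
- intros s; right; reflexivity.
- intros s z. change (ZtoC 4) with (RtoC 4). change (ZtoC 3) with (RtoC 3).
  rewrite Cexp_double, Cexp_triple, Cexp_quadruple. destruct s; simpl sgn; [|replace (RtoC (-1)) with (- (1))%C by (rewrite <- RtoC_opp; f_equal; lra)]; field;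
    repeat split; intros E; apply RtoC_inj in E; lra.
Defined.

Lemma is_solution_solves (D : wkb) (f : C -> C) : is_solution (wA D) f -> exists f1, solves D f f1.
Proof.
intros [f1 [f2 [H1 [H2 H3]]]]. exists f1. intros z. split; [apply H1|].
replace (wA D z * f z)%C with (f2 z); [apply H2|].
replace (f2 z) with (f2 z - wA D z * f z + wA D z * f z)%C by ring. rewrite H3. ring.
Qed.

Section Reindex.
Context (k : nat) (a : Z -> C).
Context (Hsupp : forall n, (0 < n \/ n < - Z.of_nat k)%Z -> a n = 0).
Let a' (i : Z) : C := a (i - Z.of_nat k)%Z.

Lemma exp_sum_csum (w0 n : Z) (c : Z -> C) (z : C) :
  exp_sum w0 n c z = laurent w0 (Z.to_nat (n - w0 + 1)) c z.
Proof. reflexivity. Qed.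

(** The factor exp(-k z) taken out here joins the phase and turns the linear coefficient g into c =
    g - k. *)
Lemma laurent_reindex (z : C) :
  laurent (- Z.of_nat k - 2) (k + 5) a z = (Cexp (- (Z.of_nat k * z)) * exp_sum (-2) (Z.of_nat k + 1) a' z)%C.
Proof.
rewrite exp_sum_csum. replace (Z.to_nat (Z.of_nat k + 1 - -2 + 1)) with (k + 4)%nat by lia.
unfold laurent. replace (k + 5)%nat with (S (k + 4)) by lia. rewrite csum_S.
rewrite (Hsupp (- Z.of_nat k - 2 + Z.of_nat (k + 4))%Z) by lia.
rewrite Cmult_0_l, Cplus_0_r, csum_scal. apply csum_ext. intros j _. unfold a'.
replace (-2 + Z.of_nat j - Z.of_nat k)%Z with (- Z.of_nat k - 2 + Z.of_nat j)%Z by lia.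
replace (Cexp ((- Z.of_nat k - 2 + Z.of_nat j)%Z * z)) with
  (Cexp (- (Z.of_nat k * z)) * Cexp ((-2 + Z.of_nat j)%Z * z))%C; [ring|].
rewrite <- Cexp_plus. f_equal. rewrite !ZtoC_plus, ZtoC_minus, ZtoC_opp.
change (ZtoC (-2)) with (RtoC (-2)). change (ZtoC 2) with (RtoC 2).
replace (RtoC (-2)) with (- (2))%C by (rewrite <- RtoC_opp; f_equal; lra). ring.
Qed.

Lemma exp_sum_trim (z : C) :
  exp_sum (-2) (Z.of_nat k + 1) a' z = exp_sum (-1) (Z.of_nat k) a' z.
Proof.
rewrite !exp_sum_csum. replace (Z.to_nat (Z.of_nat k + 1 - -2 + 1)) with (S (S (k + 2))) by lia.
replace (Z.to_nat (Z.of_nat k - -1 + 1)) with (k + 2)%nat by lia.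
unfold laurent. rewrite csum_S, csum_S_l.
unfold a' at 1 3. rewrite (Hsupp (-2 + Z.of_nat 0 - Z.of_nat k)%Z), (Hsupp (-2 + Z.of_nat (S (k + 2)) - Z.of_nat k)%Z) by lia.
rewrite !Cmult_0_l, Cplus_0_l, Cplus_0_r. apply csum_ext. intros j _.
replace (-2 + Z.of_nat (S j))%Z with (-1 + Z.of_nat j)%Z by lia. reflexivity.
Qed.
End Reindex.

(** At the lowest index n = -k the shifted coefficients vanish, leaving n^2 + 2 g n + g^2 - b3 = (g
    - k)^2 - b3 = 0. With c = g - k this simplifies the diagonal factor at n = i - k to i^2 + 2 i
    c. *)
Lemma recurrence_reindex (D : wkb) (M : Z) (r : bool) (k : nat) (a : Z -> C) (b3 c : C) :
  recurrence D M r a -> M = 1%Z \/ M = 2%Z ->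
  a (- Z.of_nat k)%Z <> 0 -> (forall n, (0 < n \/ n < - Z.of_nat k)%Z -> a n = 0) ->
  we0 D r = (wg D r * wg D r - b3)%C -> c = (wg D r - Z.of_nat k)%C ->
  (c ^ 2)%C = b3 /\
  forall i : Z, ((2 * i * c + i ^ 2) * a (i - Z.of_nat k)%Z
   + (2 * sgn r * wc D * (i - Z.of_nat k - 1) + we1 D r) * a (i - 1 - Z.of_nat k)%Z
   + 2 * sgn r * (i - Z.of_nat k - M) * a (i - M - Z.of_nat k)%Z = 0)%C.
Proof.
intros Hrec HM Hk Hsupp He0 Hc.
assert (Hc2 : (c ^ 2)%C = b3).
{ assert (R := Hrec (- Z.of_nat k)%Z).
  rewrite (Hsupp (- Z.of_nat k - 1)%Z), (Hsupp (- Z.of_nat k - M)%Z) in R by lia.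
  rewrite ZtoC_opp, He0 in R.
  assert (R' : ((c ^ 2 - b3) * a (- Z.of_nat k)%Z = 0)%C) by (rewrite <- R, Hc; ring).
  assert (E : (c ^ 2 - b3 = 0)%C).
  { replace (c ^ 2 - b3)%C with ((c ^ 2 - b3) * a (- Z.of_nat k)%Z / a (- Z.of_nat k)%Z)%C by (field; auto).
    rewrite R'. unfold Cdiv; ring. }
  replace (c ^ 2)%C with (c ^ 2 - b3 + b3)%C by ring. rewrite E. ring. }
split; auto. intros i. assert (R := Hrec (i - Z.of_nat k)%Z). rewrite <- R.
rewrite ZtoC_minus, He0, <- Hc2, Hc.
replace (i - Z.of_nat k - 1)%Z with (i - 1 - Z.of_nat k)%Z by lia.
replace (i - Z.of_nat k - M)%Z with (i - M - Z.of_nat k)%Z by lia. ring.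
Qed.

Lemma sgn_sq (r : bool) : (sgn r * sgn r)%C = 1.
Proof. rewrite <- RtoC_mult. f_equal. destruct r; simpl; ring. Qed.

Open Scope C_scope.

Theorem theorem4p4 (b2 b3 : C) (s l : Z)
  (hb2 : b2 <> 0)
  (hsl : Z.gcd s l = 1%Z)
  (hs : (1 <= s)%Z) (hlt : (s < l)%Z) (hl : (l <= 4)%Z)
  (f : C -> C)
  (hf : is_solution (fun z : C => Cexp (l * z) + b2 * Cexp (s * z) + b3) f)
  (hf0 : exists z : C, f z <> 0)
  (hlambda : Rbar_lt (exponent_of_convergence f) p_infty) :
  (s = 1%Z -> l = 2%Z ->
    exists (k : Z) (c0 c : C) (a : Z -> C),
      (0 <= k)%Z /\
      (forall z : C, f z = exp_sum (-1) k a z * Cexp (c0 * Cexp z + c * z)) /\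
      c0 ^ 2 = 1 /\ 2 * c0 * (c + k) + c0 = b2 /\ c ^ 2 = b3 /\
      a 0%Z * a k <> 0 /\ a (-1)%Z = 0 /\
      (forall i : Z, (0 <= i <= k)%Z ->
        2 * c0 * (k + 1 - i) * a (i - 1)%Z = (2 * i * c + i ^ 2) * a i)) /\
  (s = 1%Z -> l = 4%Z ->
    exists (k : Z) (c0 c : C) (a : Z -> C),
      (1 <= k)%Z /\
      (forall z : C,
        f z = exp_sum (-2) (k + 1) a z * Cexp (c0 / 2 * Cexp (2 * z) + c * z)) /\
      c0 ^ 2 = 1 /\ 2 * c + 2 * k + 2 = 0 /\ c ^ 2 = b3 /\
      a 0%Z * a k <> 0 /\
      a (-2)%Z = 0 /\ a (-1)%Z = 0 /\ a (k + 1)%Z = 0 /\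
      (forall i : Z, (0 <= i <= k + 1)%Z ->
        2 * c0 * (k - i + 2) * a (i - 2)%Z =
          - b2 * a (i - 1)%Z + (2 * i * c + i ^ 2) * a i)) /\
  (s = 3%Z -> l = 4%Z ->
    exists (k : Z) (c0 c1 c : C) (a : Z -> C),
      (0 <= k)%Z /\
      (forall z : C,
        f z = exp_sum (-2) (k + 1) a z *
              Cexp (c0 / 2 * Cexp (2 * z) + c1 * Cexp z + c * z)) /\
      c0 ^ 2 = 1 /\ 2 * c0 * c1 = b2 /\ c ^ 2 = b3 /\
      c1 ^ 2 + (2 + 2 * c + 2 * k) * c0 = 0 /\
      a 0%Z * a k <> 0 /\
      a (-2)%Z = 0 /\ a (-1)%Z = 0 /\ a (k + 1)%Z = 0 /\
      (forall i : Z, (0 <= i <= k + 1)%Z ->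
        (2 * k - 2 * i + 4) * c0 * a (i - 2)%Z =
          (2 * c + 2 * i - 1) * c1 * a (i - 1)%Z + (2 * i * c + i ^ 2) * a i)).
Proof.
assert (N2 : RtoC 2 <> 0) by (intros E; apply RtoC_inj in E; lra).
assert (N8 : RtoC 8 <> 0) by (intros E; apply RtoC_inj in E; lra).
assert (Hmul : forall x y : C, x <> 0 -> y <> 0 -> x * y <> 0).
{ intros x y Hx Hy E. apply Hx. replace x with (x * y / y) by (field; auto). rewrite E. unfold Cdiv; ring. }
split; [|split]; intros -> ->.
- destruct (is_solution_solves (wkb_12 b2 b3) f hf) as [f1 Hs].
  destruct (representation (wkb_12 b2 b3) 1 eq_refl f f1 Hs hf0 hlambda)
    as [r [k [a [Ha0 [Hak [Hsupp [Hrec Hf]]]]]]].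
  set (gr := (sgn r * b2 - 1) / 2). set (K := Z.of_nat k) in *.
  destruct (recurrence_reindex _ 1 r k a b3 (gr - K) Hrec (or_introl eq_refl) Hak Hsupp eq_refl eq_refl) as [Hc Hi].
  (* Indices are counted from the lowest Fourier index, so a_0 of the statement is the lowest
     coefficient and a_k the one at index 0; both are nonzero. *)
  exists K, (RtoC (sgn r)), (gr - K), (fun i => a (i - K)%Z).
  assert (Sq := sgn_sq r).
  split; [unfold K; lia|]. split.
  { intros z. rewrite Hf, (laurent_reindex k a Hsupp), (exp_sum_trim k a Hsupp). fold K.
    rewrite (Cmult_comm (Cexp _)), <- Cmult_assoc, <- Cexp_plus. f_equal. f_equal.
    unfold phase. simpl wm. simpl wc. simpl wg. fold gr. rewrite Cmult_1_l. field. }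
  split; [simpl; rewrite Cmult_1_r; exact Sq|]. split.
  (* As c + k = g, the relation with b2 is the equation that determined g. *)
  { replace (gr - K + K) with gr by ring. unfold gr.
    transitivity (sgn r * sgn r * b2); [field; auto|rewrite Sq; ring]. }
  split; [exact Hc|]. split.
  { apply Hmul.
    - replace (0 - K)%Z with (- K)%Z by lia. exact Hak.
    - replace (K - K)%Z with 0%Z by lia. exact Ha0. }
  split; [apply Hsupp; unfold K; lia|].
  intros i _. specialize (Hi i). fold K in Hi. simpl wc in Hi. simpl we1 in Hi. change (ZtoC 1) with (RtoC 1) in Hi.
  set (x := a (i - K)%Z) in *. set (y := a (i - 1 - K)%Z) in *.
  (* The recurrence, which equals 0, is added; its last term cancels the left side. *)
  transitivity (2 * sgn r * (K + 1 - i) * y + ((2 * i * (gr - K) + i ^ 2) * x + (2 * sgn r * 0 * (i - K - 1) + 0) * y + 2 * sgn r * (i - K - 1) * y)).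
  + rewrite Hi. ring.
  + ring.
- destruct (is_solution_solves (wkb_14 b2 b3) f hf) as [f1 Hs].
  destruct (representation (wkb_14 b2 b3) 2 eq_refl f f1 Hs hf0 hlambda)
    as [r [k [a [Ha0 [Hak [Hsupp [Hrec Hf]]]]]]].
  set (K := Z.of_nat k) in *.
  destruct (recurrence_reindex _ 2 r k a b3 (- (1) - K) Hrec (or_intror eq_refl) Hak Hsupp ltac:(simpl; ring) eq_refl) as [Hc Hi].
  exists K, (RtoC (sgn r)), (- (1) - K), (fun i => a (i - K)%Z).
  assert (Sq := sgn_sq r).
  split.
  (* If k = 0, only a_0 is nonzero and the recurrence at n = 1 reads - b2 a_0 = 0, against b2 and
     a_0 being nonzero. *)
  { destruct k as [|k]; [exfalso|unfold K; lia].
    assert (R := Hrec 1%Z). simpl wc in R. simpl we1 in R. simpl we0 in R. simpl wg in R.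
    simpl (1 - 1)%Z in R. simpl (1 - 2)%Z in R.
    rewrite (Hsupp 1%Z), (Hsupp (-1)%Z) in R by (simpl; lia). change (ZtoC 1) with (RtoC 1) in R.
    apply (Hmul b2 (a 0%Z) hb2 Ha0).
    transitivity (- (((1 * 1 + 2 * - (1) * 1 + (1 - b3)) * 0 + (2 * sgn r * 0 * (1 - 1) + - b2) * a 0%Z + 2 * sgn r * (1 - 2%Z) * 0))); [ring|].
    rewrite R. ring. }
  split.
  { intros z. rewrite Hf, (laurent_reindex k a Hsupp). fold K.
    rewrite (Cmult_comm (Cexp _)), <- Cmult_assoc, <- Cexp_plus. f_equal. f_equal.
    unfold phase. simpl wm. simpl wc. simpl wg. field; auto. }
  split; [simpl; rewrite Cmult_1_r; exact Sq|]. split; [ring|].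
  split; [exact Hc|]. split.
  { apply Hmul.
    - replace (0 - K)%Z with (- K)%Z by lia. exact Hak.
    - replace (K - K)%Z with 0%Z by lia. exact Ha0. }
  split; [apply Hsupp; unfold K; lia|]. split; [apply Hsupp; unfold K; lia|]. split; [apply Hsupp; unfold K; lia|].
  intros i _. specialize (Hi i). fold K in Hi. simpl wc in Hi. simpl we1 in Hi. change (ZtoC 2) with (RtoC 2) in Hi.
  set (x := a (i - K)%Z) in *. set (y := a (i - 1 - K)%Z) in *. set (w := a (i - 2 - K)%Z) in *.
  transitivity (2 * sgn r * (K - i + 2) * w + ((2 * i * (- (1) - K) + i ^ 2) * x + (2 * sgn r * 0 * (i - K - 1) + - b2) * y + 2 * sgn r * (i - K - 2) * w)).
  + rewrite Hi. ring.
  + ring.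
- destruct (is_solution_solves (wkb_34 b2 b3) f hf) as [f1 Hs].
  destruct (representation (wkb_34 b2 b3) 2 eq_refl f f1 Hs hf0 hlambda)
    as [r [k [a [Ha0 [Hak [Hsupp [Hrec Hf]]]]]]].
  set (gr := - (1) - sgn r * (b2 * b2 / 8)). set (K := Z.of_nat k) in *.
  destruct (recurrence_reindex _ 2 r k a b3 (gr - K) Hrec (or_intror eq_refl) Hak Hsupp eq_refl eq_refl) as [Hc Hi].
  exists K, (RtoC (sgn r)), (sgn r * (b2 / 2)), (gr - K), (fun i => a (i - K)%Z).
  assert (Sq := sgn_sq r).
  split; [unfold K; lia|]. split.
  { intros z. rewrite Hf, (laurent_reindex k a Hsupp). fold K.
    rewrite (Cmult_comm (Cexp _)), <- Cmult_assoc, <- Cexp_plus. f_equal. f_equal.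
    unfold phase. simpl wm. simpl wc. simpl wg. fold gr. field; auto. }
  split; [simpl; rewrite Cmult_1_r; exact Sq|]. split.
  { transitivity (sgn r * sgn r * b2); [field; auto|rewrite Sq; ring]. }
  split; [exact Hc|]. split.
  (* k cancels, and what remains is the condition c1^2 + 2 s (g + 1) = 0 that fixed g. *)
  { replace (2 + 2 * (gr - K) + 2 * K) with (2 + 2 * gr) by ring. unfold gr.
    transitivity (sgn r * sgn r * (b2 * b2 / 4) - sgn r * sgn r * (b2 * b2 / 4)); [|ring].
    field. }
  split.
  { apply Hmul.
    - replace (0 - K)%Z with (- K)%Z by lia. exact Hak.
    - replace (K - K)%Z with 0%Z by lia. exact Ha0. }
  split; [apply Hsupp; unfold K; lia|]. split; [apply Hsupp; unfold K; lia|]. split; [apply Hsupp; unfold K; lia|].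
  intros i _. specialize (Hi i). fold K in Hi. simpl wc in Hi. simpl we1 in Hi. fold gr in Hi. change (ZtoC 2) with (RtoC 2) in Hi.
  set (x := a (i - K)%Z) in *. set (y := a (i - 1 - K)%Z) in *. set (w := a (i - 2 - K)%Z) in *.
  transitivity ((2 * K - 2 * i + 4) * sgn r * w + ((2 * i * (gr - K) + i ^ 2) * x +
     (2 * sgn r * (b2 / 2) * (i - K - 1) + (2 * gr * sgn r + sgn r) * (b2 / 2)) * y + 2 * sgn r * (i - K - 2) * w)).
  + rewrite Hi. ring.
  + field; auto.
Qed.
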